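(* Let $\zeta$ be a primitive aperiodic substitution on an alphabet of $d\ge 2$ letters such that its substitution matrix $S_\zeta$ has a characteristic polynomial that is irreducible over $\mathbb{Q}$ and $S_\zeta$ has no eigenvalues on the unit circle. Suppose that $(X_\zeta,T,\mu)$ is weakly mixing. Then there are constants $K_\zeta,\gamma>0$ such that for every cylindrical function $f$ of level $0$ on $X_\zeta$ with $\int f\,d\mu=0$, every $g\in L^2(X_\zeta,\mu)$, and every integer $N\ge2$, $$\frac1N\sum_{k=0}^{N-1}|\langle U^kf,g\rangle|^2\le K_\zeta\,\|f\|_\infty^2\cdot\|g\|_2^2\cdot(\log N)^{-\gamma}.$$
   Context: Alphabet and substitution: $\mathcal{A}=\{0,\dots,d-1\}$, $d\ge2$; $\mathcal{A}^+$ is the set of nonempty finite words. A substitution is a map $\zeta:\mathcal{A}\to\mathcal{A}^+$, extended to words and sequences by concatenation. The substitution space $X_\zeta$ is the set of $x\in\mathcal{A}^{\mathbb{Z}}$ such that every finite word in $x$ is a subword of $\zeta^n(a)$ for some $a\in\mathcal{A}$, $n\in\mathbb{N}$. $T$ is the left shift on $X_\zeta$. The substitution matrix $S_\zeta$ is the $d\times d$ matrix whose entry $S_\zeta(i,j)$ is the number of symbols $i$ in $\zeta(j)$. $\zeta$ is primitive if some power of $S_\zeta$ has all entries strictly positive; a primitive $\zeta$ is aperiodic (non-periodic) iff $X_\zeta$ is infinite. For primitive $\zeta$ the system is uniquely ergodic and $\mu$ denotes the unique $T$-invariant Borel probability measure. A cylindrical function of level $0$ is a function $f:X_\zeta\to\mathbb{C}$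 depending only on $x_0$. $Uf=f\circ T$ is the Koopman operator on $L^2(X_\zeta,\mu)$, and $\langle\cdot,\cdot\rangle$ is the scalar product of $L^2(X_\zeta,\mu)$. *)

(* Defs.v *)
From HB Require Import structures.
From mathcomp Require Import all_boot all_order all_algebra.
From mathcomp Require Import all_classical all_reals all_analysis.
From mathcomp Require Import complex.
Set Implicit Arguments.
Unset Strict Implicit.
Unset Printing Implicit Defensive.
Import Order.TTheory GRing.Theory Num.Theory.
Import numFieldNormedType.Exports Normc.
Local Open Scope classical_set_scope.
Local Open Scope ring_scope.

(* Over an arbitrary [R : realType], the complex numbers are [R[i]]; [normc] is
   the modulus with values in [R], whereas the generic norm of [R[i]] takes its
   values in [R[i]]. *)

(* The alphabet ['I_d.+2] has [d.+2] letters, so [d : nat] covers exactly the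
   alphabets with at least two letters. *)
Definition full_shift (d : nat) := {ptws int -> discrete_topology 'I_d.+2}.

HB.instance Definition _ d := Topological.on (full_shift d).
HB.instance Definition _ d := isPointed.Build (full_shift d) (fun=> ord0).
HB.instance Definition _ d :=
  Measurable.copy (full_shift d) (g_sigma_algebraType (@open (full_shift d))).

Section Substitution.
Variable d : nat.
Notation letter := 'I_d.+2.

Definition substitution (zeta : letter -> seq letter) : Prop :=
  forall a, zeta a != [::].

Definition subst_word (zeta : letter -> seq letter) (w : seq letter) :
  seq letter := flatten (map zeta w).

Definition left_shift (x : full_shift d) : full_shift d := fun n => x (n + 1).

(* The word of length [n] starting at position [i] is
   [x i, x (i + 1), ..., x (i + n - 1)]. *)
Definition subst_space (zeta : letter -> seq letter) : set (full_shift d) :=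
  [set x | forall (i : int) (n : nat), exists (m : nat) (a : letter),
     infix (mkseq (fun k => x (i + k%:Z) : letter) n)
           (iter m (subst_word zeta) [:: a])].

Definition subst_mx (F : pzRingType) (zeta : letter -> seq letter) :
  'M[F]_d.+2 := \matrix_(i, j) (count_mem i (zeta j))%:R.

Definition primitive_subst (zeta : letter -> seq letter) : Prop :=
  exists n : nat, forall i j, 0 < (subst_mx int zeta ^+ n) i j.

(* Meant for primitive substitutions only. *)
Definition aperiodic_subst (zeta : letter -> seq letter) : Prop :=
  infinite_set (subst_space zeta).

End Substitution.

(* The system carried by [subst_space zeta] is modelled on the full shift: a
   Borel probability measure on [subst_space zeta] is one on the full shift
   giving [subst_space zeta] mass 1, and a function on [subst_space zeta] is a
   function on the full shift whose values elsewhere are never used. *)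

Section Dynamics.
Context d (T : measurableType d) (R : realType).

Definition invariant_measure (mu : probability T R) (S : T -> T) : Prop :=
  forall A, measurable A -> mu (S @^-1` A) = mu A.

Definition weakly_mixing (mu : probability T R) (S : T -> T) : Prop :=
  forall A B, measurable A -> measurable B ->
    N%:R^-1 * \sum_(k < N)
        `| fine (mu (iter k S @^-1` A `&` B)) - fine (mu A) * fine (mu B) |
      @[N --> \oo] --> (0 : R).

End Dynamics.

Definition koopman (T : Type) (R : realType) (S : T -> T) (f : T -> R[i]) :
  T -> R[i] := f \o S.

(* Complex-valued functions on a measurable set [X]; everything below depends
   only on the restriction of the functions to [X]. *)
Section ComplexL2.
Context d (T : measurableType d) (R : realType).
Variables (mu : {measure set T -> \bar R}) (X : set T).

Definition cintegral (f : T -> R[i]) : R[i] :=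
  Complex (\int[mu]_(x in X) complex.Re (f x))
          (\int[mu]_(x in X) complex.Im (f x)).

Definition in_L2 (f : T -> R[i]) : Prop :=
  [/\ measurable_fun X (fun x => complex.Re (f x)),
      measurable_fun X (fun x => complex.Im (f x)) &
      (\int[mu]_(x in X) (normc (f x) ^+ 2)%:E < +oo)%E].

Definition inner (f g : T -> R[i]) : R[i] :=
  cintegral (fun x => f x * conjc (g x)).

Definition norm2 (f : T -> R[i]) : R :=
  Num.sqrt (\int[mu]_(x in X) normc (f x) ^+ 2).

Definition sup_norm (f : T -> R[i]) : R := sup [set normc (f x) | x in X].

End ComplexL2.

Definition cylindrical0 (d : nat) (R : realType)
    (X : set (full_shift d)) (f : full_shift d -> R[i]) : Prop :=
  forall x y, X x -> X y -> x 0 = y 0 -> f x = f y.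

(* Main.v *)
Require Import Defs.
From HB Require Import structures.
From mathcomp Require Import all_boot all_order all_algebra.
From mathcomp Require Import all_classical all_reals all_analysis.
From mathcomp Require Import complex.
From mathcomp Require Import separable measurable_realfun.
From mathcomp Require Import zify ring lra.
Set Implicit Arguments.
Unset Strict Implicit.
Unset Printing Implicit Defensive.
Import Order.TTheory GRing.Theory Num.Theory.
Import numFieldNormedType.Exports Normc.
Local Open Scope classical_set_scope.
Local Open Scope ring_scope.

(** Put [e(t) = exp(2 i pi t)] and [S(om, w) = \sum_j F(w_j) e(om j)] for a word [w] of
   the language, [F] being the mean-zero letter function defining [f].

   Reduction to a uniform bound on [S].  Let [c_k = <U^k f, g>].  Then
   [\sum_(k < N) |c_k|^2] is the scalar product of [h = \sum_k conj(c_k) U^k f] with [g],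
   and [|h|_2^2] is, by invariance, the mean over [m < N] of [|h \o T^m|_2^2].  The sums
   [\sum_k conj(c_k) F(x_(k+m))] form a convolution, so Parseval on Z/2N gives
   [N |h|_2^2 <= \sum_k |c_k|^2 * sup |S(om, w)|^2], the supremum being over the words [w]
   of length [2N].  Hence [(1/N) \sum_k |c_k|^2 <= |g|_2^2 (sup |S| / N)^2].

   Bound on [S].  Let [D_n] be the least [D] such that
   [|S(om, zeta^n(a))| <= D |zeta^n(a)|] for all letters [a] and all [om].  Fix a letter
   [c] and its return words [v].  If [om |zeta^k(v)|] is far from the integers for some
   [v] and some [k] in a window [[n, Cn]], two consecutive occurrences of [zeta^k(c)]
   partly cancel and [D] shrinks by a constant factor.  Otherwise the nearest integers
   follow an exact integral orbit of the substitution matrix along the window; a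
   Liouville inequality for its eigenvalues then provides an [om'] exponentially close to
   [om] for which [om' |zeta^k(v)|] tends to the integers exponentially fast.  For such
   an [om'] the averages [S(om', zeta^k(v)) / |zeta^k(v)|] converge exponentially fast to
   a common limit (Doeblin contraction), and weak mixing forces this limit to be 0.  In both cases
   [D_(Cn) <= (1 - kappa) D_n] up to an exponentially small error, and iterating along
   [n, Cn, C^2 n, ...] yields a power of the logarithm of the length. *)

(** * Complex exponentials *)

(** Weak mixing has no rate, whereas the conclusion has one. Mixing is therefore used only to
    identify a limit: at a frequency [om'] whose products with the lengths tend to integers
    geometrically, the means converge at a speed fixed by the substitution, and mixing merely says
    that the limit is 0. The given [om] is known to be resonant on a finite window only, hence the
    detour through [om']. Replacing one by the other costs [|om - om'|] times the square of a
    length, so [om'] must be exponentially close to [om], with a base prescribed in advance. The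
    Liouville inequality involves matrices with entries exponential in the starting level, which
    forces a window of proportional length. This is why each gain multiplies the level by a
    constant, and why only a power of the logarithm of the length is obtained. Irreducibility makes
    the eigenvalues simple and every nonzero integral vector cyclic; in particular the lengths of
    the images of letters are rational combinations of those of the images of one return word at
    successive levels. *)

Section ComplexModulus.
Variable R : realType.
Implicit Types (x y : R[i]).

Lemma normcD_le x y : normc (x + y) <= normc x + normc y.
Proof. exact: (@le_normcD R x y). Qed.

Lemma normc_opp x : normc (- x) = normc x.
Proof. exact: (@normcN R x). Qed.

Lemma normc_distC x y : normc (x - y) = normc (y - x).
Proof. by rewrite -normc_opp opprB. Qed.

Lemma normc_ge0 x : 0 <= normc x.
Proof. by case: x => a b; exact: sqrtr_ge0. Qed.

Lemma normc_sum (I : Type) (r : seq I) (P : pred I) (f : I -> R[i]) :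
  normc (\sum_(i <- r | P i) f i) <= \sum_(i <- r | P i) normc (f i).
Proof.
elim/big_ind2 : _ => [|x1 x2 y1 y2 h1 h2|//]; first by rewrite normc0.
by rewrite (le_trans (normcD_le _ _))// lerD.
Qed.

Lemma normc_sub_le x y : normc (x - y) <= normc x + normc y.
Proof. by rewrite -(normc_opp y); exact: normcD_le. Qed.

Lemma normcX x n : normc (x ^+ n) = normc x ^+ n.
Proof.
elim: n => [|n IH]; first by rewrite !expr0 normc1.
by rewrite !exprS normcM IH.
Qed.

Lemma normcR (a : R) : normc (a%:C)%C = `|a|.
Proof. by rewrite /= expr0n addr0 sqrtr_sqr. Qed.

Lemma normc_nat n : normc (n%:R : R[i]) = n%:R.
Proof.
by rewrite -(rmorph_nat (real_complex R)) normcR ger0_norm.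
Qed.

Lemma normc_int (m : int) : normc (m%:~R : R[i]) = `|m%:~R|.
Proof. by rewrite -(rmorph_int (real_complex R)) normcR. Qed.

Lemma sqr_normcE x : normc x ^+ 2 = complex.Re x ^+ 2 + complex.Im x ^+ 2.
Proof.
by case: x => a b /=; rewrite sqr_sqrtr// addr_ge0 ?sqr_ge0.
Qed.

Lemma sqr_normc_Re x : normc x ^+ 2 = complex.Re (x * conjc x).
Proof. by rewrite sqr_normcE; case: x => a b /=; rewrite mulrN opprK !expr2. Qed.

Lemma normcJ_eq x : normc (conjc x) = normc x.
Proof. by case: x => a b /=; rewrite sqrrN. Qed.

Lemma ge_normc_Re x : `|complex.Re x| <= normc x.
Proof.
rewrite -ler_sqr ?nnegrE ?normc_ge0// sqr_normcE real_normK ?num_real//.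
by rewrite lerDl sqr_ge0.
Qed.

Lemma ge_normc_Im x : `|complex.Im x| <= normc x.
Proof.
rewrite -ler_sqr ?nnegrE ?normc_ge0// sqr_normcE real_normK ?num_real//.
by rewrite lerDr sqr_ge0.
Qed.

Lemma normc_eq0 x : (normc x == 0) = (x == 0).
Proof.
by apply/eqP/eqP => [/eq0_normc//|->]; rewrite normc0.
Qed.

Lemma normc_gt0 x : (0 < normc x) = (x != 0).
Proof. by rewrite lt_def normc_ge0 normc_eq0 andbT. Qed.

End ComplexModulus.

Section CircleExponential.
Variable R : realType.
Implicit Types s t d : R.

Definition cis t : R[i] := Complex (cos (2 * pi * t)) (sin (2 * pi * t)).

Lemma cisD s t : cis (s + t) = cis s * cis t.
Proof.
rewrite /cis mulrDr cosD sinD; apply/eqP; rewrite eq_complex /=.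
by rewrite eqxx /= addrC.
Qed.

Lemma cis0 : cis 0 = 1.
Proof. by rewrite /cis mulr0 cos0 sin0. Qed.

Lemma cis1 : cis 1 = 1.
Proof. by rewrite /cis mulr1 mulr_natl cos2pi sin2pi. Qed.

Lemma cis_natM t n : cis (n%:R * t) = cis t ^+ n.
Proof.
elim: n => [|n IH]; first by rewrite mul0r cis0 expr0.
by rewrite -addn1 natrD mulrDl mul1r cisD IH exprD expr1.
Qed.

Lemma cisN t : cis (- t) = (cis t)^-1.
Proof.
have h : cis (- t) * cis t = 1 by rewrite -cisD addNr cis0.
have u : cis t != 0.
  by apply/eqP => h0; move/eqP: h; rewrite h0 mulr0 eq_sym oner_eq0.
by apply: (mulIf u); rewrite h mulVf.
Qed.

Lemma cis_int (m : int) : cis m%:~R = 1.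
Proof.
have hn (n : nat) : cis n%:R = 1 by rewrite -[n%:R]mulr1 cis_natM cis1 expr1n.
by case: m => n; [exact: hn | rewrite NegzE rmorphN /= cisN hn invr1].
Qed.

Lemma cisDint t (m : int) : cis (t + m%:~R) = cis t.
Proof. by rewrite cisD cis_int mulr1. Qed.

Lemma normc_cis t : normc (cis t) = 1.
Proof. by rewrite /= cos2Dsin2 sqrtr1. Qed.

Lemma conjc_cis t : conjc (cis t) = cis (- t).
Proof. by rewrite /cis /= mulrN cosN sinN. Qed.

Lemma ge0_sin_le t : 0 <= t -> `|sin t| <= t.
Proof.
rewrite le_eqVlt => /orP[/eqP<-|t0]; first by rewrite sin0 normr0.
have [c _ h] := @MVT R sin cos 0 t t0 (fun x _ => is_derive_sin x)
  (continuous_subspaceT (@continuous_sin R)).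
move: h; rewrite sin0 !subr0 => ->.
rewrite normrM (gtr0_norm t0); apply: ler_piMl; [exact: ltW|exact: cos_max].
Qed.

(** The squared modulus is [4 * sin (pi * t) ^+ 2], and the sine is at most its argument. *)
Lemma normc_cis_sub1 t : normc (cis t - 1) <= 2 * pi * `|t|.
Proof.
wlog t0 : t / 0 <= t.
  move=> H; have [/H//|/ltW t0] := leP 0 t.
  rewrite -normrN; apply: le_trans (H (- t) _); last by rewrite oppr_ge0.
  by rewrite -conjc_cis -[X in _ <= normc (_ - X)]conjc1 -rmorphB normcJ_eq.
have pt : 0 <= 2 * pi * t by rewrite !mulr_ge0 ?pi_ge0.
rewrite (ger0_norm t0) -ler_sqr ?nnegrE ?normc_ge0// sqr_normcE /=.
set u := 2 * pi * t in pt *.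
have hu : u = (u / 2) *+ 2 by rewrite -mulr_natr divfK.
have h2 : cos u = 1 - sin (u / 2) ^+ 2 *+ 2.
  by rewrite {1}hu cos_mulr2n cos2sin2 mulrnBl; ring.
have h3 := cos2Dsin2 u.
have h4 : `|sin (u / 2)| <= u / 2 by apply: ge0_sin_le; rewrite divr_ge0.
have h5 : sin (u / 2) ^+ 2 <= (u / 2) ^+ 2.
  by rewrite -real_normK ?num_real// lerXn2r// nnegrE// (le_trans _ h4).
rewrite h2 in h3 *.
have -> : (1 - sin (u / 2) ^+ 2 *+ 2 - 1) ^+ 2 + (sin u - 0) ^+ 2 =
  4 * sin (u / 2) ^+ 2.
  rewrite subr0; move: (sin u) h3 => y; move: (sin _ ^+ 2) => z h3.
  have {h3}-> : y ^+ 2 = 1 - (1 - z *+ 2) ^+ 2 by apply/eqP; rewrite eq_sym subr_eq addrC h3.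
  by ring.
by apply: le_trans (_ : 4 * (u / 2) ^+ 2 <= _); [rewrite ler_pM2l | rewrite expr_div_n; lra].
Qed.

Definition near_int d t := exists m : int, `|t - m%:~R| <= d.

Lemma normc_cis_near d t : near_int d t -> normc (cis t - 1) <= 2 * pi * d.
Proof.
case=> m hm; rewrite -(subrK m%:~R t) cisDint.
apply: le_trans (normc_cis_sub1 _) _; rewrite ler_pM2l// mulr_gt0// ; exact: pi_gt0.
Qed.

Lemma cos_le_far s t : 0 <= s -> s <= pi -> s <= t -> t <= 2 * pi - s ->
  cos t <= cos s.
Proof.
move=> s0 sp st ts; have p0 := pi_ge0 R.
have [tp|/ltW tp] := leP t pi.
  by rewrite leNgt ltr_cos -?leNgt// in_itv /= ?s0 ?sp// (le_trans s0 st).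
have e : 2 * pi = pi + pi :> R by rewrite mulr_natl mulr2n.
rewrite -cosN -cosD2pi -mulr_natl addrC.
have h1 : s <= 2 * pi - t by rewrite lerBrDr addrC -lerBrDr.
have h2 : 2 * pi - t <= pi by rewrite e -addrA gerDl subr_le0.
by rewrite leNgt ltr_cos -?leNgt// in_itv /= ?s0 ?sp ?h2// (le_trans s0 h1).
Qed.

(** The squared modulus is [2 + 2 * cos (2 * pi * t)], and away from the integers this cosine is at
    most [c < 1]. The choice [k = (1 - c) / 4] gives [2 + 2 * c <= (2 - k) ^+ 2]. *)
Lemma far_int_gain d : 0 < d -> d < 2^-1 ->
  exists k : R, [/\ 0 < k, k <= 1 & forall t, ~ near_int d t -> normc (1 + cis t) <= 2 - k].
Proof.
move=> d0 d1; set c := cos (2 * pi * d).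
have p0 := pi_gt0 R.
have pd : 2 * pi * d < pi.
  have : 2 * pi * d < 2 * pi * 2^-1 by rewrite ltr_pM2l// mulr_gt0.
  lra.
have pd0 : 0 < 2 * pi * d by rewrite !mulr_gt0.
have c1 : c < 1.
  rewrite /c -[ltRHS](cos0 R) ltr_cos// ?in_itv /= ?lexx ?pi_ge0 ?(ltW pd) ?(ltW pd0)//.
have cm := cos_geN1 (2 * pi * d); rewrite -/c in cm.
exists ((1 - c) / 4); split; [lra|lra|].
move=> t far; set s := t - (Num.floor t)%:~R.
have /andP[s0 s1] : d <= s <= 1 - d.
  have h0 : 0 <= s by rewrite subr_ge0 floor_le.
  have h1 : s < 1 by rewrite ltrBlDl -{2}[1]/(1%:~R) -intrD floorD1_gt.
  apply/andP; split; rewrite leNgt; apply/negP => h.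
    by apply: far; exists (Num.floor t); rewrite -/s ger0_norm// ltW.
  apply: far; exists (Num.floor t + 1); rewrite intrD opprD addrA -/s.
  by rewrite distrC ger0_norm; lra.
have -> : cis t = cis s by rewrite -(subrK (Num.floor t)%:~R t) cisDint.
have q0 : 0 < 2 * pi :> R by rewrite mulr_gt0.
have qs0 : 2 * pi * d <= 2 * pi * s by rewrite ler_pM2l.
have qs1 : 2 * pi * s <= 2 * pi * (1 - d) by rewrite ler_pM2l.
have cs : cos (2 * pi * s) <= c.
  by apply: cos_le_far => //; [exact: ltW|exact: ltW|apply: le_trans qs1 _; lra].
rewrite -ler_sqr ?nnegrE ?normc_ge0//; last by move: cm; lra.
rewrite sqr_normcE /=.
have h3 := cos2Dsin2 (2 * pi * s); have h4 := sqr_ge0 (1 - c).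
by move: h3 h4 cs c1; clear; rewrite add0r; lra.
Qed.

(** Otherwise [1 + cis t] would have modulus 2, against [far_int_gain] at a distance smaller than
    that from [t] to the integers. *)
Lemma cis_neq1 t : 0 < t -> t < 1 -> cis t != 1.
Proof.
move=> t0 t1; apply/eqP => h.
have [u [u0 ut ut1]] : exists u : R, [/\ 0 < u, u <= t & u <= 1 - t].
  by exists (Num.min t (1 - t)); rewrite lt_min t0 subr_gt0 t1 !ge_min !lexx orbT.
have [h1 h2] : 0 < u / 2 /\ u / 2 < 2^-1 by split; lra.
have [k [k0 _ H]] := far_int_gain h1 h2.
suff : ~ near_int (u / 2) t.
  move/H; rewrite h -(natrD _ 1 1) normc_nat; lra.
case=> m; rewrite ler_norml => /andP[h3 h4].
have m0 : 0 < m by rewrite -(ltr0z R); lra.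
have m1 : m < 1 by rewrite -(ltr_int R); lra.
by move: m0 m1; lia.
Qed.

End CircleExponential.

(** * Substitution words and return words *)

Lemma infix_cat_prefix (T : eqType) (u v w : seq T) : infix w (u ++ v) ->
  (infix w v \/ exists u1 u2 p, [/\ u = u1 ++ u2, w = u2 ++ p & prefix p v]) \/
  infix w u.
Proof.
case/infixP => s [t e].
have [h|h] := leqP (size u) (size s).
  left; left; apply/infixP; exists (drop (size u) s), t.
  have /(congr1 (drop (size u))) := e; rewrite drop_size_cat// drop_cat => ->.
  case: ltnP => // h1; have -> : size u = size s by apply/eqP; rewrite eqn_leq h h1.
  by rewrite subnn drop0 drop_size.
have eu : u = s ++ drop (size s) u.
  rewrite -{1}(cat_take_drop (size s) u); congr cat.
  have /(congr1 (take (size s))) := e.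
  by rewrite [take _ (s ++ _)]take_size_cat// take_cat h => ->.
set u2 := drop (size s) u in eu.
have e2 : u2 ++ v = w ++ t.
  move: e; rewrite {1}eu -catA => /eqP; rewrite eqseq_cat// eqxx /= => /eqP.
  by [].
have [h2|h2] := leqP (size u2) (size w).
  left; right; exists s, u2, (drop (size u2) w).
  have ew : w = u2 ++ drop (size u2) w.
    rewrite -{1}(cat_take_drop (size u2) w); congr cat.
    have /(congr1 (take (size u2))) := e2.
    rewrite take_size_cat// take_cat; case: ltnP => // h3 ->.
    have -> : size u2 = size w by apply/eqP; rewrite eqn_leq h2 h3.
    by rewrite subnn take0 cats0 take_size.
  split => //; move: e2; rewrite {1}ew -catA => /eqP.
  rewrite eqseq_cat// eqxx /= => /eqP ->; exact: prefix_prefix.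
right; rewrite eu; apply/infixP; exists s, (drop (size w) u2).
congr cat; rewrite -{1}(cat_take_drop (size w) u2); congr cat.
have /(congr1 (take (size w))) := e2.
by rewrite [take _ (w ++ _)]take_size_cat// take_cat h2.
Qed.

Section Blocks.
Variables (A T : eqType) (f : A -> seq T) (m : nat).
Hypothesis f_size : forall a, (size (f a) <= m)%N.

Lemma prefix_flatten_map (W : seq A) (w : seq T) : prefix w (flatten (map f W)) ->
  exists W' p, [/\ w = flatten (map f W') ++ p, prefix W' W & (size p <= m)%N].
Proof.
elim: W w => [[|b w] //= _|a W IH w /=]; first by exists [::], [::].
case/prefixP => t e.
have [h|h] := leqP (size w) (size (f a)).
  exists [::], w; split => //; exact: leq_trans h (f_size a).
have ew : w = f a ++ drop (size (f a)) w.
  rewrite -{1}(cat_take_drop (size (f a)) w); congr cat.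
  have /(congr1 (take (size (f a)))) := e.
  by rewrite take_size_cat// take_cat h => <-.
have /IH[W' [p [e1 e2 e3]]] : prefix (drop (size (f a)) w) (flatten (map f W)).
  apply/prefixP; exists t; move: e; rewrite {1}ew -catA => /eqP.
  by rewrite eqseq_cat// eqxx /= => /eqP.
exists (a :: W'), p; split => //; last by rewrite /= eqxx.
by rewrite ew e1 /= catA.
Qed.

(** Only the blocks cut by the two ends of [w] are lost; the whole blocks in between form [W']. *)
Lemma infix_flatten_map (W : seq A) (w : seq T) : infix w (flatten (map f W)) ->
  exists s W' p, [/\ w = s ++ flatten (map f W') ++ p, infix W' W,
    (size s <= m)%N & (size p <= m)%N].
Proof.
elim: W w => [[|b w] //= _|a W IH w /=]; first by exists [::], [::], [::].
case/infix_cat_prefix => [[/IH[s [W' [p [e1 e2 e3 e4]]]]|]|h].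
- by exists s, W', p; split => //; apply: (infix_catl [:: a]).
- case=> u1 [u2 [p [eu -> /prefix_flatten_map[W' [q [-> h2 h3]]]]]].
  exists u2, W', q; split => //.
    by apply: (infix_catl [:: a]); exact: prefixW.
  by apply: leq_trans (f_size a); rewrite eu size_cat leq_addl.
- exists w, [::], [::]; split => //; first by rewrite /= cats0.
  exact: leq_trans (size_infix h) (f_size a).
Qed.

End Blocks.

Section SubstitutionWords.
Variables (d : nat) (zeta : 'I_d.+2 -> seq 'I_d.+2).
Notation letter := 'I_d.+2.
Hypothesis zeta_subst : substitution zeta.
Implicit Types (a b c : letter) (w v : seq letter).

Definition zn n w := iter n (subst_word zeta) w.
Definition lam n w := size (zn n w).
Definition lang w := exists m a, infix w (zn m [:: a]).
Definition maxlen := \max_(a : letter) size (zeta a).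

Lemma zn_iter n w : zn n.+1 w = subst_word zeta (zn n w).
Proof. by []. Qed.

Lemma zn_cat n w1 w2 : zn n (w1 ++ w2) = zn n w1 ++ zn n w2.
Proof.
by elim: n => // n IH; rewrite !zn_iter IH /subst_word map_cat flatten_cat.
Qed.

Lemma zn_nil n : zn n [::] = [::].
Proof. by elim: n => // n IH; rewrite zn_iter IH. Qed.

Lemma zn_flatten n (ss : seq (seq letter)) : zn n (flatten ss) = flatten (map (zn n) ss).
Proof. by elim: ss => /= [|w ss IH]; rewrite ?zn_nil// zn_cat IH. Qed.

Lemma zn_letters n w : zn n w = flatten [seq zn n [:: a] | a <- w].
Proof. by rewrite -{1}(flatten_seq1 w) zn_flatten -map_comp. Qed.

Lemma znD m n w : zn (m + n) w = zn m (zn n w).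
Proof. exact: iterD. Qed.

Lemma zn1 a : zn 1 [:: a] = zeta a.
Proof. by rewrite /zn /= /subst_word /= cats0. Qed.

Lemma znS n a : zn n.+1 [:: a] = zn n (zeta a).
Proof. by rewrite -(addn1 n) znD zn1. Qed.

Lemma lam_cat n w1 w2 : lam n (w1 ++ w2) = (lam n w1 + lam n w2)%N.
Proof. by rewrite /lam zn_cat size_cat. Qed.

Lemma lam_nil n : lam n [::] = 0%N.
Proof. by rewrite /lam zn_nil. Qed.

Lemma lam_flatten n ss : lam n (flatten ss) = (\sum_(v <- ss) lam n v)%N.
Proof.
by elim: ss => [|v ss IH]; rewrite ?big_nil ?big_cons /= ?lam_nil// lam_cat IH.
Qed.

Lemma lam_cons n a w : lam n (a :: w) = (lam n [:: a] + lam n w)%N.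
Proof. by rewrite -cat1s lam_cat. Qed.

Lemma lamD m n w : lam (m + n) w = lam m (zn n w).
Proof. by rewrite /lam znD. Qed.

Lemma size_le_lam n w : (size w <= lam n w)%N.
Proof.
elim: n w => // n IH w; rewrite -(addn1 n) lamD; apply: leq_trans (IH _).
elim: w => // a w IHw; rewrite -cat1s zn_cat !size_cat leq_add//.
by rewrite addn0 lt0n size_eq0; exact: zeta_subst.
Qed.

Lemma lam_mono m n w : (m <= n)%N -> (lam m w <= lam n w)%N.
Proof. by move=> mn; rewrite -(subnK mn) lamD -/(lam m w); exact: size_le_lam. Qed.

Lemma lam_gt0 n a w : (0 < lam n (a :: w))%N.
Proof. exact: leq_trans (size_le_lam n _). Qed.

Lemma lam_bound n w B : (forall a, lam n [:: a] <= B)%N -> (lam n w <= size w * B)%N.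
Proof.
move=> h; elim: w => [|a w IH]; first by rewrite lam_nil.
by rewrite lam_cons mulSn leq_add.
Qed.

Lemma maxlen_gt0 : (0 < maxlen)%N.
Proof.
apply: leq_trans (leq_bigmax ord0).
by rewrite lt0n size_eq0; exact: zeta_subst.
Qed.

Lemma lam_le_exp n a : (lam n [:: a] <= maxlen ^ n)%N.
Proof.
elim: n a => [|n IH] a; first by rewrite expn0.
rewrite /lam znS -/(lam _ _) expnS.
apply: leq_trans (lam_bound _ IH) _.
by rewrite leq_mul2r leq_bigmax orbT.
Qed.

Lemma lang_infix v w : infix v w -> lang w -> lang v.
Proof. by move=> h [m [a hw]]; exists m, a; exact: infix_trans h hw. Qed.

Lemma infix_zn n v w : infix v w -> infix (zn n v) (zn n w).
Proof.
case/infixP => s [t ->]; rewrite !zn_cat; apply/infixP.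
by exists (zn n s), (zn n t).
Qed.

Lemma lang_zn n w : lang w -> lang (zn n w).
Proof. by case=> m [a h]; exists (n + m)%N, a; rewrite znD; exact: infix_zn. Qed.

Lemma mem_infix a w : a \in w -> infix [:: a] w.
Proof.
move=> /splitPr[p q]; apply/infixP; by exists p, q.
Qed.

Lemma count_zn (F : pzRingType) n a b :
  (subst_mx F zeta ^+ n) a b = (count_mem a (zn n [:: b]))%:R.
Proof.
elim: n b => [|n IH] b.
  by rewrite expr0 /= mxE addn0 eq_sym.
rewrite exprSr mxE znS.
under eq_bigr => k _ do rewrite IH mxE.
elim: (zeta b) => [|k w IHw].
  by rewrite zn_nil big1// => k _; rewrite mulr0.
rewrite -cat1s zn_cat count_cat natrD -IHw /=.
under eq_bigr => j _ do rewrite natrD mulrDr.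
rewrite big_split /=; congr (_ + _).
rewrite (bigD1 k)//= eqxx mulr1 big1 ?addr0// => j jk.
by rewrite eq_sym (negbTE jk) mulr0.
Qed.

Hypothesis zeta_prim : primitive_subst zeta.

(** [zn m [:: b]] is the [M0]-th image of a nonempty word, and the [M0]-th image of a single letter
    already contains all letters. *)
Lemma primitive_all : exists2 M, (0 < M)%N &
  forall m, (M <= m)%N -> forall a b, a \in zn m [:: b].
Proof.
case: zeta_prim => M0 h.
have h0 a b : a \in zn M0 [:: b].
  by have := h a b; rewrite count_zn ltr0n -has_count has_pred1.
exists M0.+1 => // m; move=> /ltnW mM a b; rewrite -(subnKC mM) znD.
have := size_le_lam (m - M0) [:: b]; rewrite /lam.
case: (zn _ [:: b]) => // k w _.
by rewrite -cat1s zn_cat mem_cat h0.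
Qed.

(** Taking the first letter of the image is a self-map of a finite set, so the orbit of [ord0]
    enters a cycle; [c] lies on it and [p] is its length. *)
Lemma head_cycle : exists c p, (0 < p)%N /\
  forall q, exists t, zn (p * q) [:: c] = c :: t.
Proof.
pose h a := head a (zeta a).
have hz a w : exists t, subst_word zeta (a :: w) = h a :: t.
  rewrite /subst_word /=; rewrite /h; have := zeta_subst a.
  by case: (zeta a) => // k u _ /=; exists (u ++ flatten (map zeta w)).
have hn n a : exists t, zn n [:: a] = iter n h a :: t.
  elim: n => [|n [t IH]]; first by exists [::].
  by rewrite zn_iter iterS IH; exact: hz.
have := looping_order h ord0; rewrite /looping => /trajectP[i ilt e].
pose p := (order h ord0 - i)%N.
exists (iter i h ord0), p; split; first by rewrite subn_gt0.
have per : iter p h (iter i h ord0) = iter i h ord0.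
  by rewrite -iterD subnK// ltnW.
move=> q; have [t ->] := hn (p * q)%N (iter i h ord0); exists t; congr cons.
elim: q => [|q IH]; first by rewrite muln0.
by rewrite mulnS iterD IH.
Qed.

(** The [M]-th image of a letter contains the two distinct letters [ord0] and [ord_max], so the
    least length doubles every [M] levels. One more block of [M] levels pays for passing from [a] to
    [b]. *)
Lemma lam_growth : exists2 M, (0 < M)%N &
  forall k j a b, (2 ^ j * lam k [:: a] <= lam (k + M * j.+1) [:: b])%N.
Proof.
have [M M0 hM] := primitive_all; exists M => // k.
have h1 n a b : (lam n [:: a] <= lam (n + M) [:: b])%N.
  rewrite lamD; have /mem_infix/(infix_zn n)/size_infix := hM M (leqnn M) a b.
  by [].
have h2 n B : (forall a, B <= lam n [:: a])%N -> forall b, (2 * B <= lam (n + M) [:: b])%N.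
  move=> hB b; rewrite lamD; have := hM M (leqnn M) ord0 b.
  have := hM M (leqnn M) ord_max b.
  case/splitPr => p q; rewrite mem_cat inE => hq.
  rewrite lam_cat lam_cons addnCA mul2n -addnn leq_add// -lam_cat.
  have /mem_infix/(infix_zn n)/size_infix : ord0 \in p ++ q.
    by move: hq; rewrite mem_cat.
  by apply: leq_trans; exact: hB.
elim=> [|j IH] a b; first by rewrite mul1n muln1.
by rewrite (mulnS M) addnA addnAC expnS -mulnA; apply: h2 => b'; exact: IH.
Qed.

Lemma lang_zn_inv k w : lang w -> (exists a, (size w <= lam k [:: a])%N) \/
  exists W, lang W /\ infix w (zn k W).
Proof.
case=> m [a h]; have [mk|km] := leqP m k.
  by left; exists a; apply: leq_trans (size_infix h) (lam_mono _ mk).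
right; exists (zn (m - k) [:: a]); split.
  by exists (m - k)%N, a; exact: infix_refl.
by rewrite -znD subnKC// ltnW.
Qed.

(** A word seen at a level at most [k] has length at most [B] and goes entirely into [s]; any other
    word lies in a [k]-th image and is cut along its blocks. *)
Lemma lang_decomp k B w : (forall a, lam k [:: a] <= B)%N -> lang w ->
  exists s W p, [/\ w = s ++ zn k W ++ p, lang W, (size s <= B)%N & (size p <= B)%N].
Proof.
move=> hB /(lang_zn_inv k)[[a h]|[W [lW]]].
  exists w, [::], [::]; split => //; first by rewrite zn_nil !cats0.
    exists 0%N, ord0; exact: infix0s.
  exact: leq_trans h (hB a).
rewrite zn_letters => /(infix_flatten_map hB)[s [W' [p [-> h1 h2 h3]]]].
exists s, W', p; split => //; first by rewrite [zn k W']zn_letters.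
exact: lang_infix h1 lW.
Qed.

End SubstitutionWords.

Section Occurrences.
Variables (T : eqType) (c : T).

Lemma first_occurrence (w : seq T) : exists p r,
  [/\ w = p ++ r, c \notin p & r = [::] \/ exists r', r = c :: r'].
Proof.
elim: w => [|a w [p [r [-> h1 h2]]]]; first by exists [::], [::]; split => //; left.
have [->|ac] := eqVneq a c.
  by exists [::], (c :: p ++ r); split => //; right; exists (p ++ r).
by exists (a :: p), r; split => //; rewrite inE negb_or eq_sym ac.
Qed.

Lemma last_occurrence (w : seq T) : c \in w ->
  exists p r, w = p ++ c :: r /\ c \notin r.
Proof.
elim: w => // a w IH; have [/IH[p [r [-> h]]] _|h] := boolP (c \in w).
  by exists (a :: p), r.
by rewrite inE (negbTE h) orbF => /eqP <-; exists [::], w.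
Qed.

End Occurrences.

Section ReturnWords.
Variables (d : nat) (zeta : 'I_d.+2 -> seq 'I_d.+2).
Notation letter := 'I_d.+2.
Hypothesis zeta_subst : substitution zeta.
Hypothesis zeta_prim : primitive_subst zeta.
Implicit Types (a b c : letter) (w v : seq letter).

Definition return_word c v :=
  exists v', [/\ v = c :: v', c \notin v' & lang zeta (rcons v c)].

(** A complete block of level [M] contains every letter, so a word avoiding [c] consists of two
    incomplete blocks at most. *)
Lemma gap_bound : exists G, forall c w, lang zeta w -> c \notin w -> (size w <= G)%N.
Proof.
have [M M0 hM] := primitive_all zeta_subst zeta_prim.
exists (maxlen zeta ^ M + maxlen zeta ^ M)%N => c w lw.
have [s [W [p [-> _ h1 h2]]]] := lang_decomp zeta_subst (lam_le_exp zeta M) lw.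
case: W => [|b W]; first by rewrite zn_nil /= size_cat leq_add.
rewrite -cat1s zn_cat !mem_cat !negb_or => /and3P[_ /andP[]].
by rewrite (hM _ (leqnn M)).
Qed.

Lemma return_chunks c w : lang zeta (rcons (c :: w) c) ->
  exists2 cs, c :: w = flatten cs & forall v, v \in cs -> return_word c v.
Proof.
move: {2}(size w).+1 (ltnSn (size w)) => n; elim: n w => // n IH w.
rewrite ltnS => hw; have [p [r [ew hp [hr|[r' hr]]]]] := first_occurrence c w => lw.
  exists [:: c :: w]; first by rewrite /= cats0.
  move=> v; rewrite inE => /eqP ->; exists w; split => //.
  by rewrite ew hr cats0.
have e1 : rcons (c :: w) c = rcons (c :: p) c ++ rcons r' c.
  by rewrite ew hr /= -rcons_cat -rcons_cons cat_rcons.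
have e2 : rcons (c :: w) c = (c :: p) ++ rcons (c :: r') c.
  by rewrite ew hr /= -!cats1 -!catA.
have [||cs h1 h2] := IH r'.
- by move: hw; rewrite ew hr size_cat /= addnS => /(leq_trans _); apply; rewrite ltnS leq_addl.
- by apply: lang_infix lw; rewrite e2; exact: suffix_infix.
exists ((c :: p) :: cs) => [|v]; first by rewrite /= -h1 ew hr.
rewrite inE => /orP[/eqP ->|/h2//]; exists p; split => //.
by apply: lang_infix lw; rewrite e1; exact: prefix_infix.
Qed.

(** Cut at the first and at the last [c]: the outer pieces avoid [c], except for the last [c]
    itself, whence [G.+1]. *)
Lemma return_factor : exists G, forall c W, lang zeta W ->
  exists q cs t, [/\ W = q ++ flatten cs ++ t, (size q <= G)%N, (size t <= G)%N &
    forall v, v \in cs -> return_word c v].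
Proof.
have [G hG] := gap_bound; exists G.+1 => c W lW.
have [q [r [eW hq hr]]] := first_occurrence c W.
have sq : (size q <= G.+1)%N.
  apply/leqW; apply: (hG c) => //; apply: lang_infix lW; rewrite eW; exact: prefix_infix.
case: hr => [hr|[r' hr]].
  by exists q, [::], [::]; split => //; rewrite eW hr.
have cr : c \in r by rewrite hr mem_head.
have [x [t [er ht]]] := last_occurrence cr.
have st : (size (c :: t) <= G.+1)%N.
  rewrite ltnS; apply: (hG c) => //; apply: lang_infix lW; rewrite eW er -cat_rcons catA.
  exact: suffix_infix.
case: x er => [|b x] er.
  by exists q, [::], (c :: t); split => //; rewrite eW er.
move: er; rewrite hr /= => -[eb er]; subst b.
have [|cs h1 h2] := @return_chunks c x.
  apply: lang_infix lW; apply/infixP; exists q, t.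
  by rewrite eW hr er -cats1 /= -catA.
by exists q, cs, (c :: t); split => //; rewrite eW hr -h1 er.
Qed.

(** Words of bounded length form a finite type, so the levels at which they first show up have a
    maximum; [M] more levels make the letter carrying the word occur in every image. *)
Lemma uniform_occurrence G : exists P0, forall w, lang zeta w -> (size w <= G)%N ->
  forall P, (P0 <= P)%N -> forall b, infix w (zn zeta P [:: b]).
Proof.
have [M M0 hM] := primitive_all zeta_subst zeta_prim.
have [f hf] : {f : G.-bseq letter -> nat & forall w : G.-bseq letter,
    lang zeta w -> exists a, infix w (zn zeta (f w) [:: a])}.
  apply: (@choice _ _ (fun (w : G.-bseq letter) (m : nat) =>
    lang zeta w -> exists a, infix w (zn zeta m [:: a]))) => w.
  have [[m [a h]]|h] := pselect (lang zeta w); last by exists 0%N.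
  by exists m => _; exists a.
exists (\max_w f w + M)%N => w lw sw P hP b.
have [a ha] := hf (Bseq sw) lw.
have hm : (f (Bseq sw) <= \max_w f w)%N by exact: leq_bigmax.
have hmP : (f (Bseq sw) + M <= P)%N by apply: leq_trans hP; rewrite leq_add2r.
have hfP : (f (Bseq sw) <= P)%N by apply: leq_trans hmP; rewrite leq_addr.
rewrite -(subnKC hfP) znD; apply: infix_trans ha _.
by apply/infix_zn/mem_infix/hM; rewrite leq_subRL.
Qed.

Lemma return_structure : exists c P G, [/\ (0 < P)%N,
    exists t, zn zeta P [:: c] = c :: t,
    forall v, return_word c v -> (size v <= G)%N,
    forall v, return_word c v -> forall b, infix (rcons v c) (zn zeta P [:: b]) &
    exists v, return_word c v] /\
    forall W, lang zeta W -> exists q cs t,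
      [/\ W = q ++ flatten cs ++ t, (size q <= G)%N, (size t <= G)%N &
    forall v, v \in cs -> return_word c v].
Proof.
have [G hG] := return_factor; have [G' hG'] := gap_bound.
have [c [p [p0 hc]]] := head_cycle zeta_subst.
have [P0 hP0] := uniform_occurrence G'.+2.
have hs v : return_word c v -> (size v <= G'.+1)%N.
  case=> v' [-> cv lv]; rewrite ltnS; apply: (hG' c) => //.
  apply: lang_infix lv; rewrite rcons_cons -cats1 -cat1s; exact: infix_infix.
(* A multiple of the period [p], so that [zeta^P(c)] begins with [c], and beyond [P0], so that every
   return word occurs in every image. *)
exists c, (p * P0.+1)%N, (maxn G G'.+1); split; last first.
  move=> W /(hG c)[q [cs [t [h1 h2 h3 h4]]]]; exists q, cs, t; split => //.
    by rewrite leq_max h2.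
  by rewrite leq_max h3.
split.
- by rewrite muln_gt0 p0.
- exact: hc.
- by move=> v /hs h; rewrite leq_max h orbT.
- move=> v hv b; apply: hP0.
  + by case: hv => v' [].
  + by rewrite size_rcons ltnS; exact: hs.
  + by apply: leq_trans (leqnSn _) _; rewrite leq_pmull.
- have [M M0 hM] := lam_growth zeta_subst zeta_prim.
  (* At this level the image of [c] is longer than the two remainders together, so at least one
     return word is left between them. *)
  pose n := (0 + M * (2 * G).+2)%N; pose W := zn zeta n [:: c].
  have lW : lang zeta W by exists n, c; exact: infix_refl.
  have [q [cs [t [h1 h2 h3 h4]]]] := hG c W lW.
  case: cs h1 h4 => [|v cs] h1 h4; last by exists v; apply: h4; rewrite mem_head.
  have := hM 0%N (2 * G).+1 c c; rewrite -/n -/(lam zeta n _) {2}/lam -/W h1 /= size_cat.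
  rewrite muln1 => h5; have := leq_trans h5 (leq_add h2 h3).
  have : ((2 * G).+1 < 2 ^ (2 * G).+1)%N by exact: ltn_expl.
  by move=> h6 /(leq_trans h6); rewrite addnn -mul2n ltnNge leqnSn.
Qed.

End ReturnWords.

Section LengthComparison.
Variables (d : nat) (zeta : 'I_d.+2 -> seq 'I_d.+2).
Hypothesis zeta_subst : substitution zeta.
Hypothesis zeta_prim : primitive_subst zeta.

(** Up to level [M] the length itself is at most [maxlen ^ M]. Beyond, [zeta^k(a)] consists of at
    most [maxlen ^ M] blocks of level [k - M], each no longer than [zeta^k(b)]. *)
Lemma lam_compare : exists2 Q, (0 < Q)%N &
  forall k a b, (lam zeta k [:: a] <= Q * lam zeta k [:: b])%N.
Proof.
have [M M0 hM] := lam_growth zeta_subst zeta_prim.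
have L0 := maxlen_gt0 zeta_subst.
have LM0 : (0 < maxlen zeta ^ M)%N by rewrite expn_gt0 L0.
exists (maxlen zeta ^ M)%N => // k a b.
have [kM|Mk] := leqP k M.
  apply: leq_trans (lam_le_exp zeta k a) _.
  apply: leq_trans (leq_pmulr _ (lam_gt0 zeta_subst k b [::])).
  by rewrite leq_pexp2l.
rewrite -(subnK (ltnW Mk)) lamD.
apply: leq_trans (lam_bound (B := lam zeta (k - M + M) [:: b]) _ _) _.
  by move=> a'; have := hM (k - M)%N 0%N a' b; rewrite mul1n muln1.
by rewrite leq_mul2r lam_le_exp orbT.
Qed.

Lemma lam_add_compare P : exists2 Q, (0 < Q)%N &
  forall n a b, (lam zeta (n + P) [:: a] <= Q * lam zeta n [:: b])%N.
Proof.
have [Q Q0 hQ] := lam_compare; exists (maxlen zeta ^ P * Q)%N.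
  by rewrite muln_gt0 expn_gt0 maxlen_gt0.
move=> n a b; rewrite lamD -mulnA.
apply: leq_trans (lam_bound _ (fun a' => hQ n a' b)) _.
by rewrite leq_mul2r lam_le_exp orbT.
Qed.

End LengthComparison.

(** * Twisted sums *)

Section TwistedSums.
Variables (R : realType) (d : nat) (zeta : 'I_d.+2 -> seq 'I_d.+2).
Notation letter := 'I_d.+2.
Hypothesis zeta_subst : substitution zeta.
Variable F : letter -> R[i].
Hypothesis F_le1 : forall a, normc (F a) <= 1.
Implicit Types (a b c : letter) (w v : seq letter) (om D : R).

Fixpoint tw om w : R[i] :=
  if w is a :: w' then F a + cis om * tw om w' else 0.

Lemma tw_cat om u v : tw om (u ++ v) = tw om u + cis (om * (size u)%:R) * tw om v.
Proof.
elim: u => [|a u IH] /=; first by rewrite mulr0 cis0 mul1r add0r.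
have -> : om * (size u).+1%:R = om + om * (size u)%:R by rewrite -nat1r mulrDr mulr1.
by rewrite IH cisD; ring.
Qed.

Lemma normc_tw om w : normc (tw om w) <= (size w)%:R.
Proof.
elim: w => [|a w IH]; [by rewrite normc0 | rewrite /=].
rewrite -nat1r (le_trans (normcD_le _ _))// lerD//.
by rewrite normcM normc_cis mul1r.
Qed.

(** In the Horner form each letter adds at most [2 * pi * |om - om'|] times the length of what
    follows it, and these lengths add up to at most the square of the size. *)
Lemma normc_tw_diff om om' w :
  normc (tw om w - tw om' w) <= 2 * pi * `|om - om'| * (size w)%:R ^+ 2.
Proof.
elim: w => [|a w IH]; [by rewrite subrr normc0 expr0n mulr0 | rewrite /=].
have -> : F a + cis om * tw om w - (F a + cis om' * tw om' w) =
  cis om * (tw om w - tw om' w) + (cis om - cis om') * tw om' w by ring.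
apply: le_trans (normcD_le _ _) _; rewrite !normcM normc_cis mul1r.
have h1 : normc (cis om - cis om') <= 2 * pi * `|om - om'|.
  rewrite -(subrK om' om) cisD -{2}[cis om']mul1r -mulrBl normcM normc_cis mulr1.
  by rewrite addrK; exact: normc_cis_sub1.
have h2 := normc_tw om' w.
have h0 : 0 <= 2 * pi * `|om - om'| by rewrite !mulr_ge0 ?pi_ge0.
have h3 := ler_pM (normc_ge0 _) (normc_ge0 _) h1 h2.
apply: le_trans (lerD IH h3) _; rewrite -mulrDr ler_wpM2l//.
rewrite -natr1; move: (size w) => n; have := ler0n R n; move: (n%:R : R) => x.
by move=> x0; rewrite sqrrD mulr1 expr1n; lra.
Qed.

(** The constant [D_n] of the overview, as a relation at one frequency, which avoids forming
    suprema. *)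
Definition tw_bound om n D :=
  forall a, normc (tw om (zn zeta n [:: a])) <= D * (lam zeta n [:: a])%:R.

Lemma tw_bound_word om n D w : tw_bound om n D ->
  normc (tw om (zn zeta n w)) <= D * (lam zeta n w)%:R.
Proof.
move=> h; elim: w => [|a w IH]; first by rewrite zn_nil lam_nil normc0 mulr0.
rewrite -cat1s zn_cat tw_cat lam_cat natrD mulrDr.
apply: le_trans (normcD_le _ _) _; apply: lerD => //.
by rewrite normcM normc_cis mul1r.
Qed.

Lemma tw_bound_mono om m n D : (m <= n)%N -> tw_bound om m D -> tw_bound om n D.
Proof.
by move=> mn h a; rewrite -(subnKC mn) znD lamD; exact: tw_bound_word.
Qed.

Lemma tw_bound_le om n D D' : D <= D' -> tw_bound om n D -> tw_bound om n D'.
Proof. by move=> h1 h a; apply: le_trans (h a) _; rewrite ler_wpM2r. Qed.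

Lemma tw_bound0 om : tw_bound om 0 1.
Proof. by move=> a; rewrite mul1r; exact: normc_tw. Qed.

(** The image of [b] contains two copies of [zeta^n(c)] separated by [zeta^n(v')]. Their relative
    phase is [cis (om * |zeta^n(c v')|)], so together they lose [k * D * |zeta^n(c)|]. The share of
    [zeta^n(c)] in the image is at least [1 / Q]. *)
Lemma tw_gain om n P c v' k Q D :
  (forall b, infix (rcons (c :: v') c) (zn zeta P [:: b])) ->
  (forall a, (lam zeta (n + P) [:: a] <= Q * lam zeta n [:: c])%N) -> (0 < Q)%N ->
  0 <= k -> 0 <= D ->
  normc (1 + cis (om * (lam zeta n (c :: v'))%:R)) <= 2 - k ->
  tw_bound om n D -> tw_bound om (n + P) (D * (1 - k / Q%:R)).
Proof.
move=> hinf hQ Q0 k0 D0 hk hD b.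
have /infixP[x [y e]] := hinf b.
have e' : zn zeta P [:: b] = x ++ [:: c] ++ v' ++ [:: c] ++ y.
  by rewrite e -cats1 /= -!catA.
have hl := hQ b; move: hl; rewrite znD lamD e' !zn_cat !lam_cat !tw_cat.
have hx := tw_bound_word x hD; have hv := tw_bound_word v' hD.
have hy := tw_bound_word y hD; have hc := hD c.
move: hk; rewrite -cat1s lam_cat; rewrite /lam.
set X := zn zeta n x in hx *; set V := zn zeta n v' in hv *.
set Y := zn zeta n y in hy *; set C := zn zeta n [:: c] in hc *.
rewrite !natrD => hk; rewrite /lam -/X -/V -/Y -/C in hx hv hy hc.
rewrite -(ler_nat R) natrM !natrD => hl.
set sx := ((size X)%:R : R) in hx hl *; set sv := ((size V)%:R : R) in hv hl hk *.
set sy := ((size Y)%:R : R) in hy hl *; set sc := ((size C)%:R : R) in hc hl hk *.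
have -> : tw om X + cis (om * sx) * (tw om C + cis (om * sc) *
   (tw om V + cis (om * sv) * (tw om C + cis (om * sc) * tw om Y))) =
  tw om X + cis (om * sx) * ((1 + cis (om * (sc + sv))) * tw om C) +
  cis (om * sx) * (cis (om * sc) * tw om V) +
  cis (om * sx) * (cis (om * sc) * (cis (om * sv) * (cis (om * sc) * tw om Y))).
  by rewrite [om * (sc + sv)]mulrDr cisD; ring.
apply: le_trans (normcD_le _ _) _.
apply: le_trans (lerD (normcD_le _ _) (lexx _)) _.
apply: le_trans (lerD (lerD (normcD_le _ _) (lexx _)) (lexx _)) _.
rewrite !normcM !normc_cis !mul1r.
have h1 := ler_pM (normc_ge0 _) (normc_ge0 _) hk hc.
have Q0' : 0 < Q%:R :> R by rewrite ltr0n.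
have h2 : D * (k / Q%:R) * (sx + (sc + (sv + (sc + sy)))) <= D * k * sc.
  by rewrite mulrA -!mulrA ler_wpM2l// ler_wpM2l// ler_pdivrMl.
move: h1 h2 hx hv hy; move: (normc (tw om X)) (normc (tw om V)) (normc (tw om Y)).
move: (normc _ * normc _) => W x1 x2 x3; move: (k / Q%:R) => q.
rewrite mulrBr mulr1 => h1 h2 h3 h4 h5.
apply: le_trans (lerD (lerD (lerD h3 h1) h4) h5) _.
rewrite [leRHS]mulrBl lerBrDr -lerBrDl.
by apply: le_trans h2 _; rewrite le_eqVlt; apply/orP; left; apply/eqP; ring.
Qed.

End TwistedSums.

(** * Frequencies that are nearly integral along a window *)

Section IrreducibleCharPoly.
Variables (n : nat) (S : 'M[int]_n.+1).
Local Notation SQ := (map_mx intr S : 'M[rat]_n.+1).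
Hypothesis irr : irreducible_poly (char_poly SQ).

(** A row killing the Krylov matrix from the left gives a nonzero polynomial [q] of degree at most
    [n] with [r q(S) = 0]. It is coprime to the irreducible characteristic polynomial, so a Bezout
    relation evaluated at [S] kills [r]. *)
Lemma row_cyclic (r : 'rV[int]_n.+1) : r != 0 ->
  \det (\matrix_(i < n.+1) (r *m S ^+ i)) != 0.
Proof.
move=> r0; set U := \matrix_i _.
have rQ0 : map_mx intr r != 0 :> 'rV[rat]_n.+1.
  apply/eqP => /rowP h; move/eqP: r0; apply; apply/rowP => i.
  by have := h i; rewrite !mxE => /eqP; rewrite intr_eq0 => /eqP.
have UE : map_mx intr U = \matrix_(i < n.+1) (map_mx intr r *m SQ ^+ i) :> 'M[rat]_n.+1.
  by apply/row_matrixP => i; rewrite -map_row !rowK map_mxM rmorphXn.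
suff : \det (map_mx intr U : 'M[rat]_n.+1) != 0 by rewrite det_map_mx intr_eq0.
apply/det0P => -[x x0 hx].
pose q := \sum_(i < n.+1) x 0 i *: 'X^i : {poly rat}.
have hq : map_mx intr r *m horner_mx SQ q = 0.
  rewrite -hx /q rmorph_sum /= mulmx_sumr [RHS]mulmx_sum_row; apply: eq_bigr => i _.
  by rewrite UE rowK linearZ /= rmorphXn /= horner_mx_X scalemxAr.
have q0 : q != 0.
  apply: contra x0 => /eqP h; apply/eqP/rowP => i; rewrite mxE.
  have := congr1 (fun p : {poly rat} => p`_i) h; rewrite coef0 coef_sum => <-.
  rewrite (bigD1 i)//= coefZ coefXn eqxx mulr1 big1 ?addr0// => j ji.
  by rewrite coefZ coefXn eq_sym (inj_eq val_inj) (negbTE ji) mulr0.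
have sq : (size q <= n.+1)%N.
  apply: (leq_trans (size_sum _ _ _)); apply/bigmax_leqP => i _.
  by apply: leq_trans (size_scale_leq _ _) _; rewrite size_polyXn.
have cop : coprimep (char_poly SQ) q.
  rewrite irreducible_poly_coprime//; apply/negP => /dvdp_leq; move/(_ q0).
  by rewrite size_char_poly ltnNge sq.
have /Bezout_coprimepP[[u v] /= huv] := cop.
have [c c0 e] : exists2 c, c != 0 & u * char_poly SQ + v * q = c%:P.
  move: huv; rewrite -size_poly_eq1 => /eqP/esym h.
  by move/eqP: h; rewrite eq_sym => /size_poly1P.
have := congr1 (fun p => map_mx intr r *m horner_mx SQ p) e.
rewrite /= rmorphD !rmorphM /= Cayley_Hamilton mulr0 add0r horner_mx_C.
have -> : horner_mx SQ v * horner_mx SQ q = horner_mx SQ q * horner_mx SQ v.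
  by rewrite -!rmorphM mulrC.
rewrite -[_ * _]/(_ *m _) mulmxA hq mul0mx => /esym; rewrite mul_mx_scalar => /eqP.
by rewrite scalemx_eq0 (negbTE c0) (negbTE rQ0).
Qed.

(** An irreducible polynomial over the rationals is prime to its derivative, so the eigenvalues are
    simple. The columns of [Q] are right eigenvectors, the rows of [P] left ones. *)
Lemma irreducible_char_diag (C : closedFieldType) (f : {rmorphism rat -> C}) :
  exists (P Q : 'M[C]_n.+1) (t : 'rV[C]_n.+1),
    [/\ P *m Q = 1%:M, Q *m P = 1%:M & map_mx intr S *m Q = Q *m diag_mx t].
Proof.
pose p := char_poly SQ; have irrp : irreducible_poly p := irr.
have p0 : p != 0 by rewrite -size_poly_eq0 size_char_poly.
have sep : coprimep p p^`().
  rewrite irreducible_poly_coprime//; apply/negP => /dvdp_leq.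
  have sp : size p^`() = n.+1 by rewrite polyorder.size_deriv size_char_poly.
  rewrite sp size_char_poly -size_poly_eq0 sp => /(_ isT).
  by rewrite ltnn.
have SE : map_mx intr S = map_mx f SQ.
  by apply/matrixP => i j; rewrite !mxE rmorph_int.
set A := map_mx intr S in SE *.
have pE : char_poly A = map_poly f p by rewrite SE -map_char_poly.
have [rs rsE] := closed_field_poly_normal (char_poly A).
rewrite (monicP (char_poly_monic A)) scale1r in rsE.
have [B Bu] : exists2 B, B \in unitmx & similar_diag B A.
  apply/diagonalizableP; exists rs; last by rewrite -rsE mxminpoly_dvd_char.
  rewrite -separable_prod_XsubC -rsE pE separable_poly.unlock.
  by rewrite deriv_map coprimep_map.
rewrite /similar_to conjumx// => /diag_mxP[t ht].
exists B, (invmx B), t; split; [exact: mulmxV|exact: mulVmx|].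
by rewrite -ht !mulmxA mulVmx// mul1mx.
Qed.

End IrreducibleCharPoly.

Section Liouville.
Variable R : realType.
Local Notation C := R[i].

(** Read the eigenvector equation at the entry of largest modulus. *)
Lemma eigenvalue_normc_le m (N : 'M[int]_m) (H : R) (z : C) :
  (forall i j, `|(N i j)%:~R| <= H) ->
  eigenvalue (map_mx intr N : 'M[C]_m) z -> normc z <= m%:R * H.
Proof.
move=> hN /eigenvalueP[v hv v0].
have [j0 vj0] : exists j, v 0 j != 0 by apply/rV0Pn.
pose j := [arg max_(j > j0) (normc (v 0 j))]%O.
have hj l : normc (v 0 l) <= normc (v 0 j).
  by rewrite /j; case: Order.TotalTheory.arg_maxP => // i _; exact.
have vj : 0 < normc (v 0 j) by apply: lt_le_trans (hj j0); rewrite normc_gt0.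
rewrite -(ler_pM2r vj) -normcM.
have := congr1 (fun u : 'rV[C]_m => u 0 j) hv; rewrite !mxE => <-.
apply: le_trans (normc_sum _ _ _) _.
apply: le_trans (_ : \sum_(l < m) normc (v 0 j) * H <= _).
  apply: ler_sum => l _; rewrite !mxE normcM normc_int.
  by apply: ler_pM => //; exact: normc_ge0.
by rewrite sumr_const card_ord -[leLHS]mulr_natl mulrA mulrAC.
Qed.

Lemma prod_le_exp (B : R) (s : seq C) : 1 <= B -> (forall y, y \in s -> normc y <= B) ->
  \prod_(y <- s) normc y <= B ^+ size s.
Proof.
move=> B1; elim: s => [|y s IH] h; first by rewrite big_nil.
rewrite big_cons exprS ler_pM ?normc_ge0//.
- by apply: prodr_ge0 => ? _; exact: normc_ge0.
- by apply: h; rewrite mem_head.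
- by apply: IH => u us; apply: h; rewrite inE us orbT.
Qed.

(* The product of the nonzero eigenvalues is, up to sign, the lowest nonzero
   coefficient of the characteristic polynomial, hence a nonzero integer. *)
Lemma integer_eigenvalue_lower_bound m (N : 'M[int]_m) (H : R) (z : C) :
  0 <= H -> (forall i j, `|(N i j)%:~R| <= H) ->
  eigenvalue (map_mx intr N : 'M[C]_m) z -> z != 0 ->
  1 <= normc z * (1 + m%:R * H) ^+ m.
Proof.
move=> H0 hN hz z0; set NC := map_mx intr N in hz.
have [rs rsE] := closed_field_poly_normal (char_poly NC).
rewrite (monicP (char_poly_monic NC)) scale1r in rsE.
have srs : size rs = m.
  have := congr1 (fun p : {poly C} => size p) rsE.
  by rewrite size_char_poly size_prod_XsubC => -[].
pose rs' := [seq y <- rs | y != 0].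
pose q := \prod_(y <- rs') ('X - y%:P).
have [k chE] : exists k, char_poly NC = 'X^k * q.
  rewrite rsE /q /rs'; elim: (rs) => [|y s [k IH]] /=.
    by exists 0%N; rewrite expr0 mul1r !big_nil.
  rewrite big_cons IH; have [->|y0] /= := eqVneq y 0.
    by exists k.+1; rewrite subr0 exprS mulrA.
  by exists k; rewrite big_cons mulrCA.
have q0 : (char_poly NC)`_k = \prod_(y <- rs') (- y).
  rewrite chE coefXnM ltnn subnn -horner_coef0 /q horner_prod.
  by apply: eq_bigr => y _; rewrite hornerXsubC sub0r.
have mem_eig y : y \in rs -> normc y <= 1 + m%:R * H.
  move=> yrs; apply: le_trans (_ : m%:R * H <= _); last by rewrite lerDr.
  apply: eigenvalue_normc_le hN _.
  by rewrite eigenvalue_root_char -/NC rsE root_prod_XsubC.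
have one_le : 1 <= \prod_(y <- rs') normc y.
  have -> : \prod_(y <- rs') normc y = normc (char_poly NC)`_k.
    rewrite q0; elim: rs' {q chE q0} => [|y s IH]; first by rewrite !big_nil normc1.
    by rewrite !big_cons normcM normc_opp IH.
  rewrite /NC -(map_char_poly (intr : {rmorphism int -> C})) coef_map /= normc_int.
  suff : (char_poly N)`_k != 0.
    by rewrite -intr_norm ler1z -gtz0_ge1 normr_gt0.
  apply/eqP => h0; have : (char_poly NC)`_k != 0.
    rewrite q0 prodf_seq_neq0; apply/allP => y.
    by rewrite mem_filter oppr_eq0 => /andP[].
  by rewrite /NC -(map_char_poly (intr : {rmorphism int -> C})) coef_map /= h0 eqxx.
have zrs' : z \in rs'.
  by rewrite mem_filter z0 -root_prod_XsubC -rsE -eigenvalue_root_char.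
apply: le_trans one_le _; rewrite (perm_big _ (perm_to_rem zrs')) big_cons.
rewrite ler_wpM2l ?normc_ge0//.
have B1 : 1 <= 1 + m%:R * H by rewrite lerDl mulr_ge0.
apply: le_trans (prod_le_exp B1 _) _.
  by move=> y /mem_rem; rewrite mem_filter => /andP[_ /mem_eig].
rewrite ler_weXn2l// size_rem//; apply: leq_trans (leq_pred _) _.
by rewrite -srs size_filter count_size.
Qed.

Lemma sandwich_delta_mx (F : comPzRingType) n (A B : 'M[F]_n) i j k l :
  (A *m delta_mx i j *m B) k l = A k i * B j l.
Proof.
rewrite mxE (bigD1 j)//= big1 => [|b bj].
  rewrite addr0 mxE (bigD1 i)//= big1 => [|a ai].
    by rewrite addr0 mxE !eqxx mulr1.
  by rewrite mxE (negbTE ai) mulr0.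
rewrite mxE big1 ?mul0r// => a _.
by rewrite mxE (negbTE bj) andbF mulr0.
Qed.

(* [al i * be j - be i * al j] is an eigenvalue of the integral operator
   [Y |-> A Y B - B Y A], with eigenvector (column i of Q) (row j of P). *)
Lemma simultaneous_eigenvalue_gap n (A B : 'M[int]_n.+1) (P Q : 'M[C]_n.+1)
    (al be : 'I_n.+1 -> C) (a b : R) (i j : 'I_n.+1) :
  P *m Q = 1%:M -> Q *m P = 1%:M ->
  map_mx intr A *m Q = Q *m diag_mx (\row_k al k) ->
  map_mx intr B *m Q = Q *m diag_mx (\row_k be k) ->
  (forall k l, `|(A k l)%:~R| <= a) -> (forall k l, `|(B k l)%:~R| <= b) ->
  al i * be j - be i * al j != 0 ->
  1 <= normc (al i * be j - be i * al j) *
    (1 + (n.+1 * n.+1)%:R * (2 * a * b)) ^+ (n.+1 * n.+1).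
Proof.
move=> PQ QP hA hB ha hb hne.
have a0 : 0 <= a by apply: le_trans (ha ord0 ord0).
have b0 : 0 <= b by apply: le_trans (hb ord0 ord0).
have rowE (M : 'M[int]_n.+1) mu : map_mx intr M *m Q = Q *m diag_mx (\row_k mu k) ->
    P *m map_mx intr M = diag_mx (\row_k mu k) *m P.
  move=> h; rewrite -[LHS]mulmx1 -QP mulmxA -(mulmxA P) h !mulmxA PQ.
  by rewrite mul1mx.
pose N := lin_mx (mulmxr B \o mulmx A) - lin_mx (mulmxr A \o mulmx B) : 'M[int]_(n.+1 * n.+1).
apply: (@integer_eigenvalue_lower_bound _ N (2 * a * b)) => //.
- by rewrite !mulr_ge0.
- move=> /= x y; case/mxvec_indexP: x => k l; case/mxvec_indexP: y => k' l'.
  rewrite /N !mxE /= vec_mx_delta !mxvecE !sandwich_delta_mx.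
  rewrite rmorphB !rmorphM /= (le_trans (ler_normB _ _))// !normrM.
  rewrite -mulrA mulr_natl mulr2n; apply: lerD; first exact: ler_pM.
  by rewrite [leRHS]mulrC ler_pM.
apply/eigenvalueP; pose Y := Q *m delta_mx i j *m P.
have YE M L mu nu : map_mx intr M *m Q = Q *m diag_mx (\row_k mu k) ->
   map_mx intr L *m Q = Q *m diag_mx (\row_k nu k) ->
   mxvec Y *m map_mx intr (lin_mx (mulmxr L \o mulmx M) : 'M[int]_(n.+1 * n.+1)) =
   (mu i * nu j) *: mxvec Y.
  move=> hM hL.
  have -> : map_mx intr (lin_mx (mulmxr L \o mulmx M) : 'M[int]_(n.+1 * n.+1)) =
     lin_mx (mulmxr (map_mx intr L) \o mulmx (map_mx intr M : 'M[C]_n.+1)).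
    by apply: map_lin_mx => Z /=; rewrite !map_mxM.
  rewrite mul_vec_lin -linearZ /=; congr mxvec.
  have -> : map_mx intr M *m Y *m map_mx intr L =
      Q *m (diag_mx (\row_k mu k) *m delta_mx i j *m diag_mx (\row_k nu k)) *m P.
    by rewrite /Y !mulmxA hM -!mulmxA (rowE _ _ hL).
  have -> : diag_mx (\row_k mu k) *m delta_mx i j *m diag_mx (\row_k nu k) =
      (mu i * nu j) *: delta_mx i j.
    apply/matrixP => x y; rewrite sandwich_delta_mx !mxE.
    have [->|xi] := eqVneq x i; last by rewrite mulr0n mul0r mulr0.
    by have [_|_] := eqVneq y j; rewrite /= ?mulr0n ?mulr1n ?mulr0 ?mulr1.
  by rewrite -scalemxAr -scalemxAl.
exists (mxvec Y).
  by rewrite /N map_mxB mulmxBr (YE _ _ _ _ hA hB) (YE _ _ _ _ hB hA) scalerBl.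
apply/eqP => h; have Y0 : Y = 0 by rewrite -(mxvecK Y) h linear0.
have : P *m Y *m Q = delta_mx i j by rewrite /Y !mulmxA PQ mul1mx -mulmxA PQ mulmx1.
rewrite Y0 mulmx0 mul0mx => /matrixP/(_ i j); rewrite !mxE !eqxx => /eqP.
by rewrite eq_sym oner_eq0.
Qed.

End Liouville.

Section RealBounds.
Variable R : realType.

(** Provides a spectral gap: it separates from 1 the moduli of the eigenvalues below 1 and, after a
    change of sign, of those above 1. The bound [a] covers an empty family. *)
Lemma fin_sup_lt (I : finType) (f : I -> R) (a b : R) : a < b ->
  exists r, [/\ a <= r, r < b & forall i, f i < b -> f i <= r].
Proof.
move=> ab; exists (\big[Num.max/a]_(i | f i < b) f i); split.
- exact: bigmax_ge_id.
- by apply: bigmax_lt.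
- by move=> i hi; exact: le_bigmax_cond.
Qed.

Lemma expr_unbounded (x G : R) : 1 < x -> exists e, G < x ^+ e.
Proof.
move=> x1; have bern e : 1 + e%:R * (x - 1) <= x ^+ e.
  elim: e => [|e IH]; first by rewrite mul0r addr0 expr0.
  rewrite exprS -natr1; have e0 := ler0n R e; move: (e%:R : R) (x ^+ e) IH e0 => y z IH e0.
  have h1 : x * (1 + y * (x - 1)) <= x * z by rewrite ler_wpM2l// ltW// (lt_trans ltr01).
  have h2 : 0 <= y * (x - 1) ^+ 2 by rewrite mulr_ge0// sqr_ge0.
  by apply: le_trans h1; rewrite -subr_ge0; apply: le_trans h2 _; rewrite le_eqVlt;
    apply/orP; left; apply/eqP; ring.
have x10 : 0 < x - 1 by rewrite subr_gt0.
have [e he] : exists e : nat, `|G| / (x - 1) < e%:R.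
  exists (Num.bound (`|G| / (x - 1))); apply: archi_boundP.
  by rewrite divr_ge0// ltW.
exists e; apply: le_lt_trans (ler_norm G) _; apply: lt_le_trans (bern e).
by move: he; rewrite ltr_pdivrMr// => he; apply: lt_trans he _; rewrite ltrDr ltr01.
Qed.

Lemma geometric_le0 (x K r : R) : 0 < r -> r < 1 -> (forall k, x <= K * r ^+ k) -> x <= 0.
Proof.
move=> r0 r1 h; rewrite leNgt; apply/negP => x0.
have [e he] := @expr_unbounded r^-1 (K / x) (etrans (invf_gt1 r0) r1).
have := h e; rewrite leNgt => /negP; apply.
move: he; rewrite exprVn ltr_pdivrMr// -ltr_pdivrMl ?invr_gt0 ?exprn_gt0// invrK.
by rewrite mulrC.
Qed.

Lemma int_norm_lt1 (z : int) : `|z%:~R : R| < 1 -> z = 0.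
Proof. by rewrite -intr_norm ltrz1; lia. Qed.

End RealBounds.

Lemma mulmx_expSr (F : pzRingType) (m n : nat) (x : 'M[F]_(m, n.+1))
    (A : 'M[F]_n.+1) (k : nat) :
  x *m A ^+ k.+1 = x *m A ^+ k *m A.
Proof. by rewrite exprSr -mulmxE mulmxA. Qed.

Lemma scaled_sub_rowE (F : pzRingType) (m : nat) (a : F) (x y : 'rV[int]_m) j :
  (a *: map_mx intr x - map_mx intr y) 0 j = a * (x 0 j)%:~R - (y 0 j)%:~R.
Proof. by rewrite !mxE. Qed.

Section DiophantineCore.
Variables (R : realType) (n : nat) (S : 'M[int]_n.+1) (r : 'rV[int]_n.+1).
Local Notation C := R[i].
Hypothesis irr : irreducible_poly (char_poly (map_mx intr S : 'M[rat]_n.+1)).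
Hypothesis no_unit : forall z : C, eigenvalue (map_mx intr S : 'M[C]_n.+1) z ->
  normc z != 1.
Hypothesis orbit_ge1 : forall k j, 1 <= (r *m S ^+ k) 0 j.

Local Notation u k := (r *m S ^+ k).
Local Notation SC := (map_mx intr S : 'M[C]_n.+1).

Definition mxsize : R := 1 + \sum_i \sum_j `|(S i j)%:~R|.
Local Notation s := mxsize.

Lemma mxsize_ge1 : 1 <= s.
Proof. by rewrite lerDl; do 2!apply: sumr_ge0 => ? _. Qed.

Lemma mulmx_row_bound (x : 'rV[R]_n.+1) (X : R) : (forall j, `|x 0 j| <= X) ->
  forall j, `|(x *m map_mx intr S) 0 j| <= X * s.
Proof.
move=> hx j; have X0 : 0 <= X by apply: le_trans (hx ord0).
rewrite mxE; apply: le_trans (ler_norm_sum _ _ _) _.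
apply: le_trans (_ : \sum_i X * `|(S i j)%:~R| <= _).
  by apply: ler_sum => i _; rewrite normrM !mxE ler_wpM2r.
rewrite -mulr_sumr ler_wpM2l//.
apply: le_trans (_ : \sum_i \sum_j `|(S i j)%:~R| <= _); last by rewrite lerDr.
by apply: ler_sum => i _; rewrite (bigD1 j)//= lerDl sumr_ge0.
Qed.

Lemma expmx_row_bound (x : 'rV[int]_n.+1) (X : R) : (forall j, `|(x 0 j)%:~R| <= X) ->
  forall k j, `|((x *m S ^+ k) 0 j)%:~R| <= X * s ^+ k.
Proof.
move=> hx; elim=> [|k IH] j; first by rewrite expr0 mulmx1 mulr1.
rewrite mulmx_expSr exprSr mulrA.
have hl l : `|(map_mx intr (x *m S ^+ k) : 'rV[R]_n.+1) 0 l| <= X * s ^+ k.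
  by rewrite [map_mx _ _ _ _]mxE; exact: IH.
by have := mulmx_row_bound hl j; rewrite -map_mxM [map_mx _ _ _ _]mxE.
Qed.

Lemma expmx_bound k i j : `|((S ^+ k) i j)%:~R| <= s ^+ k.
Proof.
have := @expmx_row_bound (delta_mx 0 i) 1 _ k j.
rewrite mul1r -rowE mxE; apply => l; rewrite mxE eqxx /=.
by case: (l == i); rewrite ?normr0 ?normr1.
Qed.

(** Both [y] and [x *m S] are close to [om * u k.+1], within [d] and [d * s]; they are integral,
    hence equal. *)
Lemma near_orbit_step (om d : R) (x y : 'rV[int]_n.+1) k : d * (1 + s) < 1 ->
  (forall j, `|om * (u k 0 j)%:~R - (x 0 j)%:~R| <= d) ->
  (forall j, `|om * (u k.+1 0 j)%:~R - (y 0 j)%:~R| <= d) -> y = x *m S.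
Proof.
move=> hd hx hy; apply/rowP => j; apply/eqP; rewrite -subr_eq0; apply/eqP.
apply: (@int_norm_lt1 R); rewrite rmorphB /=; apply: le_lt_trans hd.
pose xi : 'rV[R]_n.+1 := om *: map_mx intr (u k) - map_mx intr x.
have hxi l : `|xi 0 l| <= d by rewrite scaled_sub_rowE; exact: hx.
have := mulmx_row_bound hxi j; rewrite mulmxBl -scalemxAl -!map_mxM.
rewrite -mulmx_expSr => h1.
have := hy j; move: h1; rewrite scaled_sub_rowE.
set a := om * _; set b := _%:~R; set c := _%:~R => h1 h2.
have -> : c - b = (a - b) - (a - c) by ring.
rewrite mulrDr mulr1 [leRHS]addrC.
by apply: le_trans (ler_normB _ _) _; exact: lerD.
Qed.

Section Coordinates.
Variables (P Q : 'M[C]_n.+1) (t : 'rV[C]_n.+1).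
Hypotheses (PQ : P *m Q = 1%:M) (QP : Q *m P = 1%:M).
Hypothesis SCQ : SC *m Q = Q *m diag_mx t.

Lemma eigen_t i : eigenvalue SC (t 0 i).
Proof.
apply/eigenvalueP; exists (row i P).
  have -> : row i P *m SC = row i (P *m SC) by rewrite row_mul.
  have -> : P *m SC = diag_mx t *m P.
    by rewrite -[LHS]mulmx1 -QP mulmxA -(mulmxA P) SCQ !mulmxA PQ mul1mx.
  by apply/rowP => j; rewrite mul_diag_mx !mxE.
apply/eqP => h; have : row i P *m Q = delta_mx 0 i by rewrite -row_mul PQ row1.
rewrite h mul0mx => /rowP/(_ i); rewrite !mxE !eqxx => /esym/eqP.
by rewrite oner_eq0.
Qed.

Lemma t_neq_unit i : normc (t 0 i) != 1.
Proof. exact: no_unit (eigen_t i). Qed.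

Lemma expmx_eigen k : SC ^+ k *m Q = Q *m diag_mx (\row_i (t 0 i) ^+ k).
Proof.
elim: k => [|k IH].
  rewrite expr0 mul1mx -[LHS]mulmx1; congr (_ *m _); apply/matrixP => i j.
  by rewrite !mxE expr0.
rewrite exprS -mulmxE -mulmxA IH mulmxA SCQ -mulmxA; congr (_ *m _).
rewrite mulmx_diag; congr diag_mx; apply/rowP => i.
by rewrite !mxE exprS.
Qed.

Lemma coord_expmx (x : 'rV[C]_n.+1) k i :
  (x *m SC ^+ k *m Q) 0 i = (x *m Q) 0 i * (t 0 i) ^+ k.
Proof. by rewrite -mulmxA expmx_eigen mulmxA mul_mx_diag !mxE. Qed.

Lemma coord_bound : exists2 K : R, 0 <= K & forall (x : 'rV[C]_n.+1) X i,
  (forall j, normc (x 0 j) <= X) -> normc ((x *m Q) 0 i) <= K * X.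
Proof.
exists (\sum_i \sum_j normc (Q i j)).
  by do 2!apply: sumr_ge0 => ? _; exact: normc_ge0.
move=> x X i hx; rewrite mxE; apply: le_trans (normc_sum _ _ _) _.
rewrite mulr_suml; apply: ler_sum => l _; rewrite normcM mulrC.
apply: ler_pM => //; try exact: normc_ge0.
by rewrite (bigD1 i)//= lerDl sumr_ge0// => ? _; exact: normc_ge0.
Qed.

(** Once the expanding coordinates vanish, only eigenvalues of modulus below 1 act, as none lies on
    the unit circle; [r0] bounds their moduli. *)
Lemma contraction : exists K r0 : R, [/\ 0 <= K, 0 < r0, r0 < 1 &
  forall (x : 'rV[C]_n.+1) X, (forall j, normc (x 0 j) <= X) ->
    (forall i, 1 < normc (t 0 i) -> (x *m Q) 0 i = 0) ->
    forall k j, normc ((x *m SC ^+ k) 0 j) <= K * X * r0 ^+ k].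
Proof.
have [K K0 hK] := coord_bound.
have h12 : (2^-1 : R) < 1 by rewrite invf_lt1// ltr1n.
have [r0 [hr0 r01 hr]] := fin_sup_lt (fun i => normc (t 0 i)) h12.
have r00 : 0 < r0 by apply: lt_le_trans hr0.
pose p := \sum_i \sum_j normc (P i j).
have p0 : 0 <= p by do 2!apply: sumr_ge0 => ? _; exact: normc_ge0.
exists (K * p), r0; split => //; first by rewrite mulr_ge0.
move=> x X hx hc k j; rewrite -[x *m _]mulmx1 -QP mulmxA [in X in X <= _]mxE.
have X0 : 0 <= X by apply: le_trans (hx ord0); exact: normc_ge0.
apply: le_trans (normc_sum _ _ _) _.
apply: le_trans (_ : \sum_i K * X * r0 ^+ k * normc (P i j) <= _).
  apply: ler_sum => i _; rewrite normcM coord_expmx ler_wpM2r ?normc_ge0//.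
  have [h1|h1] := leP (normc (t 0 i)) 1; last first.
    by rewrite hc// mul0r normc0 !mulr_ge0// exprn_ge0// ltW.
  have h2 : normc (t 0 i) < 1 by rewrite lt_neqAle t_neq_unit.
  rewrite normcM normcX; apply: ler_pM => //; try by rewrite ?exprn_ge0 ?normc_ge0.
    exact: hK.
  by apply: lerXn2r; rewrite ?nnegrE ?normc_ge0 ?(ltW r00)// hr.
rewrite -mulr_sumr.
have -> : K * p * X * r0 ^+ k = K * X * r0 ^+ k * p by ring.
apply: ler_wpM2l; first by rewrite !mulr_ge0// exprn_ge0// ltW.
by apply: ler_sum => i _; rewrite (bigD1 j)//= lerDl sumr_ge0// => ? _; exact: normc_ge0.
Qed.

End Coordinates.

End DiophantineCore.

Section DiophantineMain.
Variables (R : realType) (n : nat) (S : 'M[int]_n.+1) (r : 'rV[int]_n.+1).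
Local Notation C := R[i].
Hypothesis irr : irreducible_poly (char_poly (map_mx intr S : 'M[rat]_n.+1)).
Hypothesis no_unit : forall z : C, eigenvalue (map_mx intr S : 'M[C]_n.+1) z ->
  normc z != 1.
Hypothesis orbit_ge1 : forall k j, 1 <= (r *m S ^+ k) 0 j.

Local Notation u k := (r *m S ^+ k).
Local Notation SC := (map_mx intr S : 'M[C]_n.+1).
Local Notation s := (mxsize R S).
Local Notation toC x := (map_mx intr x : 'rV[C]_n.+1).
Local Notation U := (\matrix_(i < n.+1) u i).

Lemma det_orbit_neq0 : \det U != 0.
Proof.
apply: row_cyclic => //; apply/eqP => r0.
by have := orbit_ge1 0 ord0; rewrite r0 mul0mx mxE.
Qed.

Lemma toC_orbit k : toC (u k) = toC r *m SC ^+ k.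
Proof. by rewrite map_mxM rmorphXn. Qed.

(* The element of [int[S]] mapping [r] to [x], multiplied by [\det U] to clear
   denominators. *)
Definition commutant (x : 'rV[int]_n.+1) : 'M[int]_n.+1 :=
  \sum_(k < n.+1) (x *m \adj U) 0 k *: S ^+ k.

Lemma commutantE x : r *m commutant x = \det U *: x.
Proof.
rewrite /commutant mulmx_sumr.
transitivity (x *m \adj U *m U); last by rewrite -mulmxA mul_adj_mx mul_mx_scalar.
by rewrite [RHS]mulmx_sum_row; apply: eq_bigr => k _; rewrite rowK scalemxAr.
Qed.

Lemma commutant_bound : exists2 a : R, 0 <= a &
  forall (x : 'rV[int]_n.+1) X, (forall j, `|(x 0 j)%:~R| <= X) ->
  forall k l, `|(commutant x k l)%:~R| <= a * X.
Proof.
pose b := \sum_i \sum_j `|(\adj U i j)%:~R : R|.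
have b0 : 0 <= b by do 2!apply: sumr_ge0 => ? _.
exists (\sum_(k < n.+1) b * s ^+ k).
  by apply: sumr_ge0 => k _; rewrite mulr_ge0// exprn_ge0// (le_trans ler01)// mxsize_ge1.
move=> x X hx k l; rewrite /commutant summxE rmorph_sum /=.
apply: le_trans (ler_norm_sum _ _ _) _; rewrite mulr_suml.
apply: ler_sum => i _; rewrite mxE rmorphM /= normrM mulrAC.
apply: ler_pM => //; last exact: expmx_bound.
rewrite mxE rmorph_sum /=; apply: le_trans (ler_norm_sum _ _ _) _.
rewrite mulr_suml; apply: ler_sum => j _; rewrite rmorphM normrM mulrC.
apply: ler_pM => //; last exact: hx.
by rewrite (bigD1 i)//= lerDl sumr_ge0.
Qed.

Section Coordinates.
Variables (P Q : 'M[C]_n.+1) (t : 'rV[C]_n.+1).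
Hypotheses (PQ : P *m Q = 1%:M) (QP : Q *m P = 1%:M).
Hypothesis SCQ : SC *m Q = Q *m diag_mx t.

Lemma commutant_eigen x : exists al : 'I_n.+1 -> C,
  map_mx intr (commutant x) *m Q = Q *m diag_mx (\row_i al i).
Proof.
exists (fun i => \sum_(k < n.+1) ((x *m \adj U) 0 k)%:~R * (t 0 i) ^+ k).
rewrite /commutant raddf_sum /= mulmx_suml.
under eq_bigr => k _ do rewrite map_mxZ rmorphXn /= -scalemxAl (expmx_eigen SCQ) scalemxAr.
rewrite -mulmx_sumr; congr (_ *m _); apply/matrixP => i j; rewrite summxE !mxE.
rewrite -sumrMnl; apply: eq_bigr => k _.
by rewrite !mxE mulrnAr.
Qed.

(** A vanishing coordinate would vanish along the whole orbit, so the invertible matrix [U] would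
    kill a column of [Q]. *)
Lemma orbit_coord_neq0 i : (toC r *m Q) 0 i != 0.
Proof.
apply/eqP => h0.
have UQ : map_mx intr U *m col i Q = 0 :> 'cV[C]_n.+1.
  apply/colP => k; rewrite [in RHS]mxE.
  transitivity ((row k (map_mx intr U) *m Q) 0 i).
    by rewrite -row_mul [in RHS]mxE colE mulmxA -colE [in LHS]mxE.
  by rewrite -map_row rowK toC_orbit (coord_expmx SCQ) h0 mul0r.
have UU : (map_mx intr U : 'M[C]_n.+1) \in unitmx.
  by rewrite unitmxE det_map_mx unitfE intr_eq0 det_orbit_neq0.
have : col i Q = 0 by rewrite -(mulKmx UU (col i Q)) UQ mulmx0.
move/(congr1 (mulmx P)); rewrite mulmx0 colE mulmxA PQ mul1mx => /colP/(_ i).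
by rewrite !mxE !eqxx => /eqP; rewrite oner_eq0.
Qed.

End Coordinates.
End DiophantineMain.

Section DiophantineTheorem.
Variables (R : realType) (n : nat) (S : 'M[int]_n.+1) (r : 'rV[int]_n.+1).
Local Notation C := R[i].
Hypothesis irr : irreducible_poly (char_poly (map_mx intr S : 'M[rat]_n.+1)).
Hypothesis no_unit : forall z : C, eigenvalue (map_mx intr S : 'M[C]_n.+1) z ->
  normc z != 1.
Hypothesis orbit_ge1 : forall k j, 1 <= (r *m S ^+ k) 0 j.

Local Notation u k := (r *m S ^+ k).
Local Notation SC := (map_mx intr S : 'M[C]_n.+1).
Local Notation s := (mxsize R S).
Local Notation toC x := (map_mx intr x : 'rV[C]_n.+1).
Local Notation D := (\det (\matrix_(i < n.+1) u i)).

Lemma Re_affine (z : C) (a b : int) :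
  complex.Re (z * a%:~R - b%:~R) = complex.Re z * a%:~R - b%:~R.
Proof. by rewrite -!(rmorph_int (real_complex R)); case: z => x y /=; rewrite mulr0 subr0. Qed.

Lemma Im_affine (z : C) (a b : int) :
  complex.Im (z * a%:~R - b%:~R) = complex.Im z * a%:~R.
Proof.
by rewrite -!(rmorph_int (real_complex R)); case: z => x y /=; rewrite mulr0 add0r subr0.
Qed.

Section Coordinates.
Variables (P Q : 'M[C]_n.+1) (t : 'rV[C]_n.+1).
Hypotheses (PQ : P *m Q = 1%:M) (QP : Q *m P = 1%:M).
Hypothesis SCQ : SC *m Q = Q *m diag_mx t.

(** Otherwise the orbit of [r] would tend to 0, whereas its entries are integers at least 1. *)
Lemma expanding_exists : exists i, 1 < normc (t 0 i).
Proof.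
have [K [r0 [K0 r00 r01 hc]]] := contraction no_unit PQ QP SCQ.
apply: contrapT => /forallNP h.
pose X : R := \sum_j `|(r 0 j)%:~R|.
have hX j : normc (toC r 0 j) <= X.
  by rewrite mxE normc_int /X (bigD1 j)//= lerDl sumr_ge0.
suff : (1 : R) <= 0 by rewrite ler10.
apply: (@geometric_le0 R 1 (K * X) r0) => // k.
apply: le_trans (hc _ _ hX _ k ord0); last by move=> i /h.
rewrite -toC_orbit mxE normc_int -intr_norm -[leLHS]/(1%:~R) ler_int.
by apply: le_trans (orbit_ge1 k ord0) (ler_norm _).
Qed.

Lemma shift_entry (z : C) (x : 'rV[int]_n.+1) m k j :
  ((z *: toC (u m) - toC x) *m SC ^+ k) 0 j =
  z * (u (m + k) 0 j)%:~R - ((x *m S ^+ k) 0 j)%:~R.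
Proof.
have hS : SC ^+ k = map_mx intr (S ^+ k) by rewrite rmorphXn.
by rewrite mulmxBl -scalemxAl hS -!map_mxM scaled_sub_rowE -mulmxA mulmxE -exprD.
Qed.

(** From [r *m commutant x = D *: x], the coordinates of [x] are those of [r] multiplied by
    [al i / D]. Closeness of [z u_m] to [x] thus becomes closeness of [D z t_i^m] to [al i]. *)
Lemma coord_affine (z : C) (x : 'rV[int]_n.+1) m al i :
  map_mx intr (commutant S r x) *m Q = Q *m diag_mx (\row_i al i) ->
  D%:~R * ((z *: toC (u m) - toC x) *m Q) 0 i =
  (toC r *m Q) 0 i * (D%:~R * z * (t 0 i) ^+ m - al i).
Proof.
move=> hal.
have e1 : (toC (u m) *m Q) 0 i = (toC r *m Q) 0 i * (t 0 i) ^+ m.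
  by rewrite toC_orbit (coord_expmx SCQ).
have e2 : D%:~R * (toC x *m Q) 0 i = (toC r *m Q) 0 i * al i.
  transitivity ((toC (D *: x) *m Q) 0 i).
    by rewrite map_mxZ -scalemxAl [RHS]mxE.
  by rewrite -commutantE map_mxM -mulmxA hal mulmxA mul_mx_diag !mxE.
rewrite mulmxBl -scalemxAl.
have -> : (z *: (toC (u m) *m Q) - toC x *m Q) 0 i =
    z * (toC (u m) *m Q) 0 i - (toC x *m Q) 0 i by rewrite !mxE.
by rewrite mulrBr e2 e1; ring.
Qed.

End Coordinates.
End DiophantineTheorem.

Section DiophantineTheorem.
Variables (R : realType) (n : nat) (S : 'M[int]_n.+1) (r : 'rV[int]_n.+1).
Local Notation C := R[i].
Hypothesis irr : irreducible_poly (char_poly (map_mx intr S : 'M[rat]_n.+1)).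
Hypothesis no_unit : forall z : C, eigenvalue (map_mx intr S : 'M[C]_n.+1) z ->
  normc z != 1.
Hypothesis orbit_ge1 : forall k j, 1 <= (r *m S ^+ k) 0 j.

Local Notation u k := (r *m S ^+ k).
Local Notation SC := (map_mx intr S : 'M[C]_n.+1).
Local Notation s := (mxsize R S).
Local Notation toC x := (map_mx intr x : 'rV[C]_n.+1).
Local Notation D := (\det (\matrix_(i < n.+1) u i)).

Section Coordinates.
Variables (P Q : 'M[C]_n.+1) (t : 'rV[C]_n.+1).
Hypotheses (PQ : P *m Q = 1%:M) (QP : Q *m P = 1%:M).
Hypothesis SCQ : SC *m Q = Q *m diag_mx t.

(** An error along an expanding direction that is still bounded after [E] steps was of order
    [rho ^- E] at the start. *)
Lemma window_coord_bound (dl rho : R) : 0 <= dl -> 1 < rho ->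
  (forall i, 1 < normc (t 0 i) -> rho <= normc (t 0 i)) ->
  exists2 K1 : R, 0 <= K1 & forall (om : R) (x : 'rV[int]_n.+1) al m E,
    map_mx intr (commutant S r x) *m Q = Q *m diag_mx (\row_i al i) ->
    (forall j, `|om * (u (m + E) 0 j)%:~R - ((x *m S ^+ E) 0 j)%:~R| <= dl) ->
    forall i, 1 < normc (t 0 i) ->
    normc (D%:~R * om%:C%C * (t 0 i) ^+ m - al i) * rho ^+ E <= K1.
Proof.
move=> dl0 rho1 hrho; have [KC KC0 hKC] := coord_bound Q.
pose c i := normc ((toC r *m Q) 0 i).
have c0 i : 0 < c i by rewrite normc_gt0 (orbit_coord_neq0 irr orbit_ge1 PQ SCQ).
exists (`|D%:~R| * (KC * dl) * \sum_i (c i)^-1).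
  by rewrite !mulr_ge0// sumr_ge0// => i _; rewrite invr_ge0 ltW.
move=> om x al m E hal hw i ti.
have := coord_affine SCQ om%:C%C m i hal; set xi := om%:C%C *: _ - _.
set W := _ - al i => hxi.
have h1 : normc ((xi *m SC ^+ E *m Q) 0 i) <= KC * dl.
  apply: hKC => j; rewrite /xi shift_entry.
  by rewrite -!(rmorph_int (real_complex R)) -rmorphM -rmorphB normcR; exact: hw.
rewrite (coord_expmx SCQ) normcM normcX in h1.
have h2 : normc ((xi *m Q) 0 i) * rho ^+ E <= KC * dl.
  apply: le_trans h1; rewrite ler_wpM2l ?normc_ge0//.
  by apply: lerXn2r; rewrite ?nnegrE ?normc_ge0 ?hrho// ltW// (lt_trans ltr01).
have h3 : c i * (normc W * rho ^+ E) <= `|D%:~R| * (KC * dl).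
  rewrite mulrA -normcM -hxi normcM normc_int -mulrA ler_wpM2l//.
have h4 : (c i)^-1 <= \sum_i (c i)^-1.
  by rewrite (bigD1 i)//= lerDl sumr_ge0// => j _; rewrite invr_ge0 ltW.
apply: le_trans (_ : (`|D%:~R| * (KC * dl)) * (c i)^-1 <= _).
  by rewrite ler_pdivlMr// mulrC.
by apply: ler_wpM2l => //; rewrite !mulr_ge0.
Qed.

End Coordinates.

(** The numerical contradiction with [simultaneous_eigenvalue_gap]: [G] collects all the exponential
    rates of growth, and a window of length [e * m] with [G < rho ^+ e] beats them. As [1 <= m],
    multiplicative constants are absorbed in [m]-th powers. *)
Lemma resonance_gap (T a b G rho w1 w2 w K1 : R) (N m e : nat) :
  1 <= T -> 1 <= b -> 0 <= a -> 0 <= K1 -> (1 <= m)%N -> 0 <= w -> 0 < rho ->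
  (1 + 2 * K1) * T * ((1 + N%:R * (2 * a)) * b ^+ 2) ^+ N <= G -> G < rho ^+ e ->
  w1 * rho ^+ (e * m) <= K1 -> w2 * rho ^+ (e * m) <= K1 ->
  w <= w1 * T ^+ m + T ^+ m * w2 ->
  w * (1 + N%:R * (2 * (a * b ^+ m) * b ^+ m)) ^+ N < 1.
Proof.
move=> T1 b1 a0 K10 m1 w0 rho0 hG hGr h1 h2 h3.
have T0 : 0 <= T by apply: le_trans T1.
have b0 : 0 <= b by apply: le_trans b1.
have Na : 0 <= N%:R * (2 * a) by rewrite !mulr_ge0.
set X1 := (_ * _) ^+ N in hG.
have rm : 0 < rho ^+ (e * m) by rewrite exprn_gt0.
have hX : (1 + N%:R * (2 * (a * b ^+ m) * b ^+ m)) ^+ N <= X1 ^+ m.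
  rewrite /X1 -exprM mulnC exprM; apply: lerXn2r; rewrite ?nnegrE.
  - by rewrite addr_ge0// !mulr_ge0 ?exprn_ge0.
  - by rewrite exprn_ge0// mulr_ge0 ?addr_ge0 ?exprn_ge0.
  rewrite exprMn [(b ^+ 2) ^+ m]exprAC.
  have bm : 1 <= (b ^+ m) ^+ 2 by rewrite exprn_ege1// exprn_ege1.
  apply: le_trans (_ : (1 + N%:R * (2 * a)) * (b ^+ m) ^+ 2 <= _).
    rewrite [leRHS]mulrDl mul1r; apply: lerD => //.
    by rewrite le_eqVlt; apply/orP; left; apply/eqP; ring.
  rewrite -[X in _ <= X * _]/(_ ^+ m) ler_wpM2r//; first exact: le_trans bm.
  by apply: ler_eXnr => //; rewrite lerDl.
apply: le_lt_trans (ler_wpM2l w0 hX) _.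
have X10 : 0 <= X1 by rewrite exprn_ge0// mulr_ge0 ?addr_ge0 ?exprn_ge0.
rewrite -(ltr_pM2r rm) mul1r.
apply: le_lt_trans (_ : (1 + 2 * K1) * T ^+ m * X1 ^+ m < _).
  have h4 : w * rho ^+ (e * m) <= 2 * K1 * T ^+ m.
    apply: le_trans (ler_wpM2r (ltW rm) h3) _.
    have Tm : 0 <= T ^+ m by rewrite exprn_ge0.
    have h5 := ler_wpM2r Tm h1; have h6 := ler_wpM2r Tm h2.
    apply: le_trans (_ : K1 * T ^+ m + K1 * T ^+ m <= _).
      apply: le_trans (lerD h5 h6); rewrite le_eqVlt; apply/orP; left; apply/eqP; ring.
    by rewrite le_eqVlt; apply/orP; left; apply/eqP; ring.
  rewrite mulrAC; apply: ler_wpM2r; first by rewrite exprn_ge0.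
  apply: le_trans h4 _; by rewrite [leRHS]mulrDl mul1r lerDr exprn_ge0.
have G0 : 0 <= G by apply: le_trans hG; rewrite !mulr_ge0 ?addr_ge0 ?mulr_ge0.
rewrite exprM; apply: le_lt_trans (_ : G ^+ m < _).
  apply: le_trans (_ : ((1 + 2 * K1) * T * X1) ^+ m <= _).
    rewrite !exprMn; apply: ler_wpM2r; first by rewrite exprn_ge0.
    apply: ler_wpM2r; first by rewrite exprn_ge0.
    by apply: ler_eXnr => //; rewrite lerDl mulr_ge0.
  by apply: lerXn2r; rewrite ?nnegrE ?mulr_ge0 ?addr_ge0 ?mulr_ge0.
by rewrite ltrXn2r// ?exprn_ge0 ?(ltW rho0)// -lt0n.
Qed.

End DiophantineTheorem.

Section DiophantineCoreTheorem.
Variables (R : realType) (n : nat) (S : 'M[int]_n.+1) (r : 'rV[int]_n.+1).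
Local Notation C := R[i].
Hypothesis irr : irreducible_poly (char_poly (map_mx intr S : 'M[rat]_n.+1)).
Hypothesis no_unit : forall z : C, eigenvalue (map_mx intr S : 'M[C]_n.+1) z ->
  normc z != 1.
Hypothesis orbit_ge1 : forall k j, 1 <= (r *m S ^+ k) 0 j.

Local Notation u k := (r *m S ^+ k).
Local Notation SC := (map_mx intr S : 'M[C]_n.+1).
Local Notation s := (mxsize R S).
Local Notation toC x := (map_mx intr x : 'rV[C]_n.+1).
Local Notation D := (\det (\matrix_(i < n.+1) u i)).

(* The vectors [kap k] form an exact orbit; let [al i] be the eigenvalues of
   [commutant (kap 0)].  Being nearly proportional to [t_i ^+ m] on the expanding
   directions, they are exactly so by Liouville's gap, and the ratio is [D * om']. *)
Lemma near_integer_orbit : exists dl r0 K : R, [/\ 0 < dl, 0 < r0, r0 < 1, 0 <= K &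
  forall H : R, 1 <= H -> exists e0 : nat, forall e : nat, (e0 <= e)%N ->
  forall (om : R) (kap : nat -> 'rV[int]_n.+1) m, 0 <= om -> om <= 1 -> (1 <= m)%N ->
  (forall k, (k <= e * m)%N ->
     forall j, `|om * (u (m + k) 0 j)%:~R - (kap k 0 j)%:~R| <= dl) ->
  exists om' : R, [/\ `|om' - om| * H ^+ m <= 1,
    forall k j, `|om' * (u (m + k) 0 j)%:~R - ((kap 0 *m S ^+ k) 0 j)%:~R| <= K * r0 ^+ k &
    forall k, (k <= e * m)%N -> kap k = kap 0 *m S ^+ k]].
Proof.
have [P [Q [t [PQ QP SCQ]]]] := irreducible_char_diag irr (ratr : {rmorphism rat -> C}).
have [i0 ti0] := expanding_exists no_unit orbit_ge1 PQ QP SCQ.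
have [KA [r0 [KA0 r00 r01 hKA]]] := contraction no_unit PQ QP SCQ.
have [rho [rho1 hrho]] : exists rho : R, 1 < rho /\
    forall i, 1 < normc (t 0 i) -> rho <= normc (t 0 i).
  have h21 : (-2 : R) < -1 by rewrite ltrN2 ltr1n.
  have [x [_ x1 hx]] := fin_sup_lt (fun i => - normc (t 0 i)) h21.
  exists (- x); split=> [|i hi]; first by rewrite ltrNr.
  by rewrite lerNl; apply: hx; rewrite ltrN2.
have rho0 : 0 < rho by apply: lt_trans rho1.
pose T : R := 1 + \sum_i normc (t 0 i).
have hT i : normc (t 0 i) <= T.
  rewrite /T (bigD1 i)//= addrCA lerDl addr_ge0// sumr_ge0// => j _; exact: normc_ge0.
have T1 : 1 <= T by rewrite lerDl sumr_ge0// => j _; exact: normc_ge0.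
have s1 := mxsize_ge1 R S; have s0 : 0 <= s by apply: le_trans s1.
(* Makes [dl * (1 + s)] equal to [1 / 2], as [near_orbit_step] needs a value below 1. *)
pose dl : R := (2 * (1 + s))^-1.
have ds : 0 < 1 + s by rewrite ltr_wpDr.
have dl0 : 0 < dl by rewrite invr_gt0 mulr_gt0.
have dls : dl * (1 + s) < 1.
  by rewrite /dl invfM mulfVK ?gt_eqF// invf_lt1// ltr1n.
have dl1 : dl <= 1.
  apply: le_trans (ltW dls); rewrite ler_peMr ?(ltW dl0)//.
  by rewrite lerDl.
have [K1 K10 hK1] := window_coord_bound irr orbit_ge1 PQ SCQ (ltW dl0) rho1 hrho.
have [a0 a00 ha0] := commutant_bound R S r.
pose u0 : R := 1 + \sum_j `|(r 0 j)%:~R|.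
have u01 : 1 <= u0 by rewrite lerDl sumr_ge0.
have hu k j : `|(u k 0 j)%:~R : R| <= u0 * s ^+ k.
  apply: expmx_row_bound => l.
  by rewrite /u0 (bigD1 l)//= addrCA lerDl addr_ge0// sumr_ge0.
have D0 : D != 0 by exact: det_orbit_neq0.
have D1 : 1 <= normc (D%:~R : C).
  by rewrite normc_int -intr_norm ler1z -gtz0_ge1 normr_gt0.
have DC0 : (D%:~R : C) != 0 by rewrite intr_eq0.
pose N := (n.+1 * n.+1)%N.
have [a [a_ge0 aE]] : exists a, 0 <= a /\ a = a0 * (u0 + 1).
  exists (a0 * (u0 + 1)); split=> //.
  by rewrite mulr_ge0// addr_ge0// (le_trans _ u01).
pose X1 := ((1 + N%:R * (2 * a)) * s ^+ 2) ^+ N.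
have X11 : 1 <= X1.
  apply: exprn_ege1; apply: mulr_ege1; last exact: exprn_ege1.
  by rewrite lerDl !mulr_ge0.
exists dl, r0, (KA * 2); split => //; first by rewrite mulr_ge0.
move=> H H1.
(* The first three factors are those of [resonance_gap]; the last one makes [om'] so close to [om]
   that the error stays below [H ^- m], and bounded even after multiplication by the entries of
   [u m], of size [u0 * s ^+ m]. *)
pose G := (1 + 2 * K1) * T * X1 * (H * (u0 * s)).
have c1 : 1 <= 1 + 2 * K1 by rewrite lerDl mulr_ge0.
have Hus : 1 <= H * (u0 * s) by rewrite !mulr_ege1.
have [e0 he0] := expr_unbounded G rho1.
exists e0 => e e0e om kap m om0 om1 m1 hw.
have he : G < rho ^+ e by apply: lt_le_trans he0 _; rewrite ler_weXn2l// ltW.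
have hkap k : (k <= e * m)%N -> kap k = kap 0 *m S ^+ k.
  elim: k => [|k IH] hk; first by rewrite mulmx1.
  rewrite mulmx_expSr -IH ?(ltnW hk)//.
  by apply: (near_orbit_step dls (hw k (ltnW hk))); rewrite -addnS; exact: hw.
set x := kap 0 in hkap *.
have hx j : `|(x 0 j)%:~R : R| <= (u0 + 1) * s ^+ m.
  have := hw 0%N (leq0n _) j; rewrite addn0 -/x => h.
  have sm : 1 <= s ^+ m by rewrite exprn_ege1.
  rewrite mulrDl mul1r -(subrK (om * (u m 0 j)%:~R) (x 0 j)%:~R) addrC.
  apply: le_trans (ler_normD _ _) _; apply: lerD.
    rewrite normrM (ger0_norm om0) -[leRHS]mul1r; apply: ler_pM => //.
  by rewrite distrC; apply: le_trans h _; apply: le_trans dl1 sm.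
have [al hal] := commutant_eigen r SCQ x.
have hE j : `|om * (u (m + e * m) 0 j)%:~R - ((x *m S ^+ (e * m)) 0 j)%:~R| <= dl.
  by rewrite -hkap//; exact: hw.
pose W i := normc (D%:~R * om%:C%C * (t 0 i) ^+ m - al i).
have hW i : 1 < normc (t 0 i) -> W i * rho ^+ (e * m) <= K1.
  exact: hK1 hal hE i.
have tT i : normc (t 0 i) ^+ m <= T ^+ m.
  by apply: lerXn2r; rewrite ?nnegrE ?normc_ge0// (le_trans ler01).
have res i j : 1 < normc (t 0 i) -> 1 < normc (t 0 j) ->
    al i * (t 0 j) ^+ m - (t 0 i) ^+ m * al j = 0.
  move=> hi hj; apply: contrapT => /eqP hne.
  have hB : map_mx intr (S ^+ m) *m Q = Q *m diag_mx (\row_k (t 0 k) ^+ m).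
    by rewrite -(expmx_eigen SCQ) rmorphXn.
  have hA k l : `|(commutant S r x k l)%:~R : R| <= a * s ^+ m.
    by rewrite aE -mulrA; exact: ha0.
  have := simultaneous_eigenvalue_gap PQ QP hal hB hA (expmx_bound R S m) hne.
  rewrite -/N; set w := normc _.
  apply/negP; rewrite -ltNge.
  apply: (@resonance_gap R T a s G rho (W i) (W j) w K1 N m e) => //.
  - exact: normc_ge0.
  - by rewrite /G -/X1 ler_peMr// !mulr_ge0 ?(le_trans ler01).
  - exact: hW.
  - exact: hW.
  have -> : w = normc ((D%:~R * om%:C%C * (t 0 j) ^+ m - al j) * (t 0 i) ^+ m -
      (D%:~R * om%:C%C * (t 0 i) ^+ m - al i) * (t 0 j) ^+ m).
    by rewrite /w; congr normc; ring.
  apply: le_trans (normc_sub_le _ _) _; rewrite !normcM !normcX addrC.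
  apply: lerD; first by apply: ler_wpM2l; [exact: normc_ge0|].
  by rewrite mulrC; apply: ler_wpM2r; [exact: normc_ge0|].
have ti00 : t 0 i0 != 0 by rewrite -normc_gt0 (lt_trans ltr01).
have tim0 : (t 0 i0) ^+ m != 0 by rewrite expf_neq0.
(* The future [om'], still complex: it cancels the coordinate [i0], and by the proportionality [res]
   all the other expanding coordinates too. *)
pose z : C := al i0 / (D%:~R * (t 0 i0) ^+ m).
have hz1 : normc (z - om%:C%C) * rho ^+ (e * m) <= K1.
  apply: le_trans (hW i0 ti0); apply: ler_wpM2r; first by rewrite exprn_ge0// ltW.
  have -> : z - om%:C%C =
      (al i0 - D%:~R * om%:C%C * (t 0 i0) ^+ m) / (D%:~R * (t 0 i0) ^+ m).
    by rewrite /z; field; rewrite ?DC0 ?ti00 ?tim0.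
  rewrite normcM normc_distC normcV -/(W i0) normcM normcX.
  have w1 : 1 <= normc (D%:~R : C) * normc (t 0 i0) ^+ m.
    by apply: mulr_ege1 => //; apply: exprn_ege1; exact: ltW.
  rewrite ler_pdivrMr; last exact: lt_le_trans ltr01 w1.
  by apply: ler_peMr => //; exact: normc_ge0.
have Gm : G ^+ m <= rho ^+ (e * m).
  rewrite exprM; apply: lerXn2r; rewrite ?nnegrE ?exprn_ge0 ?(ltW rho0) ?(ltW he)//.
  by rewrite !mulr_ge0 ?(le_trans ler01).
have hz2 : normc (z - om%:C%C) * (H * (u0 * s)) ^+ m <= 1.
  have c0 : 0 < 1 + 2 * K1 by apply: lt_le_trans c1.
  rewrite -(ler_pM2l c0) mulr1; apply: le_trans (_ : K1 <= _); last first.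
    by rewrite addrC ler_wpDr// -[leLHS]mul1r ler_wpM2r// ler1n.
  apply: le_trans hz1; rewrite mulrCA; apply: ler_wpM2l; first exact: normc_ge0.
  apply: le_trans Gm; rewrite /G [leRHS]exprMn; apply: ler_wpM2r.
    by rewrite exprn_ge0// (le_trans ler01).
  apply: le_trans (_ : (1 + 2 * K1) ^+ m <= _); first by apply: ler_eXnr => //; rewrite -lt0n.
  apply: lerXn2r; rewrite ?nnegrE ?(ltW c0)// ?mulr_ge0 ?(ltW c0) ?(le_trans ler01)//.
  by rewrite -mulrA ler_peMr ?(ltW c0)// mulr_ege1.
pose xi := z *: toC (u m) - toC x.
have xi_exp i : 1 < normc (t 0 i) -> (xi *m Q) 0 i = 0.
  move=> hi; apply: (mulfI DC0); rewrite mulr0 /xi (coord_affine SCQ z m i hal).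
  have -> : D%:~R * z * (t 0 i) ^+ m - al i =
      (al i0 * (t 0 i) ^+ m - (t 0 i0) ^+ m * al i) / (t 0 i0) ^+ m.
    by rewrite /z; field; rewrite ?DC0 ?ti00 ?tim0.
  by rewrite res// mul0r mulr0.
have hxi j : normc (xi 0 j) <= 2.
  rewrite /xi scaled_sub_rowE.
  have -> : z * (u m 0 j)%:~R - (x 0 j)%:~R =
     (z - om%:C%C) * (u m 0 j)%:~R + (om%:C%C * (u m 0 j)%:~R - (x 0 j)%:~R) by ring.
  apply: le_trans (normcD_le _ _) _; rewrite -[2]/(1 + 1 : R); apply: lerD.
    rewrite normcM normc_int; apply: le_trans hz2; apply: ler_wpM2l; first exact: normc_ge0.
    apply: le_trans (hu m j) _; rewrite !exprMn.
    rewrite mulrA ler_wpM2r ?exprn_ge0// -[leLHS]mul1r ler_pM ?(le_trans ler01)//.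
      by rewrite exprn_ege1.
    by apply: ler_eXnr => //; rewrite -lt0n.
  rewrite -!(rmorph_int (real_complex R)) -rmorphM -rmorphB normcR; apply: le_trans dl1.
  by have := hw 0%N (leq0n _) j; rewrite addn0.
have hdec k j : normc (z * (u (m + k) 0 j)%:~R - ((x *m S ^+ k) 0 j)%:~R) <= KA * 2 * r0 ^+ k.
  by rewrite -shift_entry; exact: hKA.
(* The approximating integers are real, so [|Im z|] times an entry at least 1 of the orbit is below
   an error tending to 0. *)
have Imz : complex.Im z = 0.
  apply/eqP; rewrite -normr_le0; apply: (@geometric_le0 R _ (KA * 2) r0) => // k.
  apply: le_trans (hdec k ord0); apply: le_trans (ge_normc_Im _); rewrite Im_affine normrM.
  rewrite ler_peMr// -intr_norm ler1z; apply: le_trans (orbit_ge1 (m + k) ord0) (ler_norm _).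
exists (complex.Re z); split => //.
- apply: le_trans hz2; apply: ler_pM => //.
  + by rewrite exprn_ge0// (le_trans ler01).
  + have -> : complex.Re z - om = complex.Re (z - om%:C%C) by case: (z).
    exact: ge_normc_Re.
  by apply: lerXn2r; rewrite ?nnegrE ?(le_trans ler01)// ler_peMr ?mulr_ege1 ?(le_trans ler01).
- move=> k j; apply: le_trans (hdec k j); rewrite -Re_affine; exact: ge_normc_Re.
Qed.

End DiophantineCoreTheorem.

Lemma char_poly_tr (F : comNzRingType) n (A : 'M[F]_n) : char_poly A^T = char_poly A.
Proof.
rewrite /char_poly -[RHS]det_tr; congr (\det _).
by rewrite /char_poly_mx linearB /= tr_scalar_mx map_trmx.
Qed.

Lemma expmx_tr (F : comNzRingType) n (A : 'M[F]_n.+1) k : A^T ^+ k = (A ^+ k)^T.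
Proof.
elim: k => [|k IH]; first by rewrite !expr0 trmx1.
by rewrite exprS IH exprSr -!mulmxE trmx_mul.
Qed.

(** By Cayley-Hamilton these integers satisfy a linear recurrence with integral coefficients and
    leading coefficient 1, so divisibility of the first [n.+1] terms propagates. *)
Lemma dvd_linear_recurrence n (S : 'M[int]_n.+1) (y : 'rV[int]_n.+1)
    (w : 'cV[int]_n.+1) (M : int) :
  (forall k, (k <= n)%N -> (M %| (y *m S ^+ k *m w)%R 0%R 0%R)%Z) ->
  forall k, (M %| (y *m S ^+ k *m w)%R 0%R 0%R)%Z.
Proof.
move=> h k; elim/ltn_ind: k => k IH; have [/h//|nk] := leqP k n.
pose p := char_poly S.
have CH : \sum_(i < n.+2) p`_i *: S ^+ i = 0.
  have pE : p = \poly_(i < n.+2) p`_i by rewrite -[LHS]coefK size_char_poly.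
  transitivity (horner_mx S (\poly_(i < n.+2) p`_i)); last by rewrite -pE Cayley_Hamilton.
  rewrite poly_def rmorph_sum /=.
  by apply: eq_bigr => i _; rewrite linearZ /= rmorphXn /= horner_mx_X.
have p1 : p`_n.+1 = 1.
  by have := monicP (char_poly_monic S); rewrite /lead_coef size_char_poly.
have hp : S ^+ n.+1 = - \sum_(i < n.+1) p`_i *: S ^+ i.
  by move: CH; rewrite big_ord_recr /= p1 scale1r => /eqP; rewrite addrC addr_eq0 => /eqP.
rewrite -(subnKC nk) exprD hp mulNr mulmxN mulNmx mxE.
rewrite mulr_suml mulmx_sumr mulmx_suml summxE dvdzE abszN -dvdzE.
apply: rpred_sum => i _; rewrite -scalerAl -exprD -scalemxAr -scalemxAl mxE.
apply: dvdz_mull; apply: IH.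
by rewrite -[ltnRHS](subnKC nk) ltn_add2r.
Qed.

(** * Word lengths as integral orbits of the substitution matrix *)

Section WordLengths.
Variables (d : nat) (zeta : 'I_d.+2 -> seq 'I_d.+2).
Local Notation S := (subst_mx int zeta).
Definition ones : 'rV[int]_d.+2 := const_mx 1.
Definition popv (w : seq 'I_d.+2) : 'cV[int]_d.+2 := \col_i (count_mem i w)%:Z.

Lemma mul_popv (y : 'rV[int]_d.+2) w : (y *m popv w) 0 0 = \sum_(a <- w) y 0 a.
Proof.
rewrite mxE; elim: w => [|a w IH].
  by rewrite big_nil big1// => i _; rewrite mxE mulr0.
rewrite big_cons -IH (bigD1 a)//= [in RHS](bigD1 a)//= addrA; congr (_ + _).
  by rewrite !mxE /= eqxx PoszD mulrDr mulr1.
by apply: eq_bigr => i ia; rewrite !mxE /= eq_sym (negbTE ia).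
Qed.

Lemma ones_expmx k a : (ones *m S ^+ k) 0 a = (lam zeta k [:: a])%:Z.
Proof.
rewrite mxE; under eq_bigr => i _ do rewrite mxE mul1r count_zn.
rewrite /lam; elim: (zn _ _ _) => [|b w IH]; first by rewrite big1.
under eq_bigr => i _ do rewrite /= natrD.
rewrite big_split /= IH -[(size w).+1]add1n PoszD; congr (_ + _).
rewrite (bigD1 b)//= eqxx big1 ?addr0// => i ib.
by rewrite eq_sym (negbTE ib).
Qed.

Lemma lam_popv k w : (ones *m S ^+ k *m popv w) 0 0 = (lam zeta k w)%:Z.
Proof.
rewrite mul_popv; elim: w => [|a w IH]; first by rewrite big_nil lam_nil.
by rewrite big_cons IH ones_expmx [in RHS]lam_cons PoszD.
Qed.

End WordLengths.

Section WordResonance.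
Variables (R : realType) (d : nat) (zeta : 'I_d.+2 -> seq 'I_d.+2).
Local Notation S := (subst_mx int zeta).
Local Notation C := R[i].
Hypothesis zeta_subst : substitution zeta.
Hypothesis irr : irreducible_poly (char_poly (subst_mx rat zeta)).
Hypothesis no_unit : forall z : C, eigenvalue (subst_mx C zeta) z -> normc z != 1.

Lemma map_subst_mx (F : pzRingType) : map_mx intr S = subst_mx F zeta.
Proof. by apply/matrixP => i j; rewrite !mxE natz -pmulrn. Qed.

(* [M * lam k [:: a]] is an integral combination of the lengths [lam (k + i) v]. *)
Lemma lam_letter_from_word v : v != [::] -> exists (M : int) (c : 'M[int]_d.+2), M != 0 /\
  forall k a, M * (lam zeta k [:: a])%:Z = \sum_i c a i * (lam zeta (k + i) v)%:Z.
Proof.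
move=> v0; pose W := \matrix_(i < d.+2) ((popv v)^T *m S^T ^+ i).
exists (\det W), (\adj W); split.
  apply: row_cyclic; first by rewrite -map_trmx char_poly_tr map_subst_mx.
  case: v v0 {W} => // a v _; apply/eqP => /rowP/(_ a); rewrite !mxE /= eqxx.
  by [].
move=> k a; have h : W *m (ones d *m S ^+ k)^T = \col_i (lam zeta (k + i) v)%:Z.
  apply/colP => i; rewrite [RHS]mxE -lam_popv exprD -mulmxE.
  transitivity ((row i W *m (ones d *m S ^+ k)^T) 0 0).
    by rewrite -row_mul [RHS]mxE.
  by rewrite rowK expmx_tr -!trmx_mul [LHS]mxE !mulmxA.
have := congr1 (fun z => (\adj W *m z) a 0) h.
rewrite mulmxA mul_adj_mx mul_scalar_mx [LHS]mxE [in LHS]mxE ones_expmx => ->.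
by rewrite mxE; apply: eq_bigr => i _; rewrite [X in _ * X]mxE.
Qed.

Lemma near_row_word (o dl : R) k (x : 'rV[int]_d.+2) w :
  (forall a, `|o * ((ones d *m S ^+ k) 0 a)%:~R - (x 0 a)%:~R| <= dl) ->
  `|o * (lam zeta k w)%:R - (\sum_(a <- w) x 0 a)%:~R| <= (size w)%:R * dl.
Proof.
move=> h; elim: w => [|a w IH].
  by rewrite lam_nil big_nil mulr0 subrr normr0 mul0r.
rewrite lam_cons big_cons natrD rmorphD /= -nat1r mulrDl mul1r mulrDr opprD addrACA.
apply: le_trans (ler_normD _ _) _; apply: lerD => //.
by have := h a; rewrite ones_expmx.
Qed.

(* The lengths of images of letters are only rational combinations of those of images
   of [v0], so the orbit is followed at [M * om], where [M] is a common denominator;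
   [dvd_linear_recurrence] divides the integers found there by [M]. *)
Lemma word_resonance (B : seq 'I_d.+2 -> Prop) (G : nat) v0 :
  v0 != [::] -> B v0 -> (forall v, B v -> (size v <= G)%N) ->
  exists dl r0 K : R, [/\ 0 < dl, 0 < r0, r0 < 1, 0 <= K &
  forall H : R, 1 <= H -> exists e : nat, forall (om : R) m, 0 <= om -> om <= 1 ->
  (1 <= m)%N ->
  (forall k v, (k <= e * m)%N -> B v -> near_int dl (om * (lam zeta (m + k) v)%:R)) ->
  exists om' : R, `|om' - om| * H ^+ m <= 1 /\
    forall k v, B v -> near_int (K * r0 ^+ k) (om' * (lam zeta (m + k) v)%:R)].
Proof.
move=> v00 Bv0 hB.
have [M [c [M0 hM]]] := lam_letter_from_word v00.
have irr' : irreducible_poly (char_poly (map_mx intr S : 'M[rat]_d.+2)).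
  by rewrite map_subst_mx.
have no_unit' (z : C) : eigenvalue (map_mx intr S : 'M[C]_d.+2) z -> normc z != 1.
  by rewrite map_subst_mx; exact: no_unit.
have orbit_ge1 k j : 1 <= (ones d *m S ^+ k) 0 j.
  by rewrite ones_expmx lez_nat lam_gt0.
have [dc [r0 [K [dc0 r00 r01 K0 hcore]]]] := near_integer_orbit irr' no_unit' orbit_ge1.
have [A [A0 hA]] : exists A : R, 0 <= A /\ forall a, \sum_i `|(c a i)%:~R : R| <= A.
  exists (\sum_a \sum_i `|(c a i)%:~R : R|); split.
    by do 2!apply: sumr_ge0 => ? _.
  move=> a; rewrite [leRHS](bigD1 a)//= lerDl; do 2!apply: sumr_ge0 => ? _ //.
have M1 : 1 <= `|M%:~R : R| by rewrite -intr_norm ler1z -gtz0_ge1 normr_gt0.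
have MR0 : (M%:~R : R) != 0 by rewrite intr_eq0.
(* The bound by [dc] feeds the orbit theorem; the bound by 1 serves in [hdiv], where two nearby
   integers are identified. *)
have [dl [dl0 dlA dlG]] : exists dl : R, [/\ 0 < dl, A * dl <= dc &
    G%:R * (A * dl) + `|M%:~R| * dl < 1].
  pose Z : R := 1 + A + G%:R * A + `|M%:~R|.
  have Z0 : 0 < Z by rewrite /Z -!addrA ltr_wpDr ?ltr01// !addr_ge0// mulr_ge0.
  have [dm [dm0 dmc dmh]] : exists dm : R, [/\ 0 < dm, dm <= dc & dm <= 2^-1].
    exists (Num.min dc 2^-1); rewrite lt_min dc0 invr_gt0 ltr0n /=.
    by rewrite !ge_min !lexx orbT.
  exists (dm / Z); split; first by rewrite divr_gt0.
    rewrite mulrCA; apply: le_trans dmc; apply: ler_piMr; first exact: ltW.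
    by rewrite ler_pdivrMr// mul1r /Z -!addrA addrCA lerDl !addr_ge0// mulr_ge0.
  have -> : G%:R * (A * (dm / Z)) + `|M%:~R| * (dm / Z) = dm * ((G%:R * A + `|M%:~R|) / Z) by ring.
  apply: le_lt_trans (_ : dm * 1 < 1); last by rewrite mulr1 (le_lt_trans dmh)// invf_lt1// ltr1n.
  apply: ler_wpM2l; first exact: ltW.
  by rewrite ler_pdivrMr// mul1r /Z -addrA lerDr addr_ge0.
exists dl, r0, (G%:R * K); split => //; first by rewrite mulr_ge0.
move=> H H1; have [e0 he0] := hcore H H1.
(* The inner [d.+1] puts the first [d.+2] terms of the recurrence in the window; the outer one is
   needed because lengths of letters at one level use those of [v0] up to [d.+1] levels higher. *)
pose e := (e0 + d.+1)%N; exists (e + d.+1)%N => om m om0 om1 m1 hw.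
have widx k i : (k <= e * m)%N -> (i <= d.+1)%N -> (k + i <= (e + d.+1) * m)%N.
  by move=> ke id; rewrite mulnDl leq_add// (leq_trans id)// leq_pmulr.
(* The orbit theorem is stated for frequencies in [[0, 1]]: it is applied to the fractional part of
   [M * om], and [F] is put back in [y]. *)
pose F := Num.floor (M%:~R * om).
pose o1 := M%:~R * om - F%:~R.
have o10 : 0 <= o1 by rewrite subr_ge0 floor_le.
have o11 : o1 <= 1.
  by rewrite lerBlDl -[X in _ + X]/(1%:~R) -intrD ltW// floorD1_gt.
have hlet k a : (k <= e * m)%N -> exists x : int,
    `|o1 * ((ones d *m S ^+ (m + k)) 0 a)%:~R - x%:~R| <= A * dl.
  move=> hk; rewrite ones_expmx.
  have [J hJ] : {J : 'I_d.+2 -> int & forall i : 'I_d.+2,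
      `|om * (lam zeta (m + k + i) v0)%:R - (J i)%:~R| <= dl}.
    apply: (@choice _ _ (fun (i : 'I_d.+2) (x : int) =>
      `|om * (lam zeta (m + k + i) v0)%:R - x%:~R| <= dl)) => i.
    by rewrite -addnA; apply: hw => //; apply: widx => //; rewrite -ltnS.
  exists (\sum_i c a i * J i - F * (lam zeta (m + k) [:: a])%:Z).
  have e1 : M%:~R * (lam zeta (m + k) [:: a])%:R =
      \sum_(i < d.+2) (c a i)%:~R * (lam zeta (m + k + i) v0)%:R :> R.
    have := congr1 (fun z : int => z%:~R : R) (hM (m + k)%N a).
    rewrite rmorphM rmorph_sum /= => ->.
    by apply: eq_bigr => i _; rewrite rmorphM.
  have -> : o1 * (lam zeta (m + k) [:: a])%:R -
      (\sum_i c a i * J i - F * (lam zeta (m + k) [:: a])%:Z)%:~R =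
      \sum_(i < d.+2) (c a i)%:~R * (om * (lam zeta (m + k + i) v0)%:R - (J i)%:~R).
    rewrite rmorphB rmorph_sum rmorphM /= /o1.
    under [in RHS]eq_bigr => i _ do rewrite mulrBr mulrCA.
    rewrite sumrB -mulr_sumr -e1.
    under [in LHS]eq_bigr => i _ do rewrite rmorphM /=.
    by rewrite -pmulrn; ring.
  apply: le_trans (ler_norm_sum _ _ _) _.
  apply: le_trans (_ : (\sum_i `|(c a i)%:~R|) * dl <= _); last by rewrite ler_wpM2r// ltW.
  by rewrite mulr_suml; apply: ler_sum => i _; rewrite normrM ler_wpM2l.
have [kap hkap] : {kap : nat -> 'rV[int]_d.+2 & forall k, (k <= e * m)%N -> forall a,
    `|o1 * ((ones d *m S ^+ (m + k)) 0 a)%:~R - (kap k 0 a)%:~R| <= A * dl}.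
  apply: (@choice _ _ (fun (k : nat) (x : 'rV[int]_d.+2) => (k <= e * m)%N -> forall a,
    `|o1 * ((ones d *m S ^+ (m + k)) 0 a)%:~R - (x 0 a)%:~R| <= A * dl)) => k.
  have [hk|hk] := leqP k (e * m); last by exists 0.
  have [x hx] : {x : 'I_d.+2 -> int & forall a,
    `|o1 * ((ones d *m S ^+ (m + k)) 0 a)%:~R - (x a)%:~R| <= A * dl}.
    by apply: (@choice _ _ (fun (a : 'I_d.+2) (x : int) =>
    `|o1 * ((ones d *m S ^+ (m + k)) 0 a)%:~R - x%:~R| <= A * dl)) => a; exact: hlet.
  by exists (\row_a x a) => _ a; rewrite [(\row__ _) _ _]mxE; exact: hx.
have [ o1' [h1 h2 h3]] := he0 e (leq_addr _ _) o1 kap m o10 o11 m1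
  (fun k hk j => le_trans (hkap k hk j) dlA).
pose y := kap 0%N + F *: (ones d *m S ^+ m).
have yE k v : (y *m S ^+ k *m popv v) 0 0 =
    \sum_(a <- v) (kap 0%N *m S ^+ k) 0 a + F * (lam zeta (m + k) v)%:Z.
  rewrite !mulmxDl [LHS]mxE mul_popv -!scalemxAl [X in _ + X]mxE.
  by rewrite -[X in X *m popv v]mulmxA mulmxE -exprD lam_popv.
have hdiv v : B v -> forall k, (M %| (y *m S ^+ k *m popv v)%R 0%R 0%R)%Z.
  move=> Bv; apply: dvd_linear_recurrence => k hk.
  have kem : (k <= e * m)%N.
    by apply: leq_trans hk (leq_trans _ (leq_pmulr _ m1)); rewrite leq_addl.
  have [J hJ] : near_int dl (om * (lam zeta (m + k) v)%:R).
    by apply: hw => //; rewrite -[k]addn0; apply: widx.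
  suff -> : (y *m S ^+ k *m popv v) 0 0 = M * J by rewrite dvdz_mulr.
  apply/eqP; rewrite -subr_eq0; apply/eqP; apply: (@int_norm_lt1 R).
  apply: le_lt_trans dlG.
  have hk2 := near_row_word v (hkap k kem); rewrite (h3 k kem) in hk2.
  rewrite yE rmorphB rmorphD !rmorphM /=.
  set L := _%:R in hk2 hJ; set X := (\sum_(a <- v) _)%:~R in hk2 *.
  have -> : X + F%:~R * (lam zeta (m + k) v)%:~R - M%:~R * J%:~R =
      M%:~R * (om * L - J%:~R) - (o1 * L - X) by rewrite -pmulrn /o1 -/L; ring.
  rewrite [leRHS]addrC; apply: le_trans (ler_normB _ _) _; apply: lerD.
    by rewrite normrM ler_wpM2l.
  apply: le_trans hk2 _; apply: ler_wpM2r; first by rewrite mulr_ge0// ltW.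
  by rewrite ler_nat hB.
exists ((o1' + F%:~R) / M%:~R); split.
  apply: le_trans h1; apply: ler_wpM2r; first by rewrite exprn_ge0// (le_trans ler01).
  have -> : (o1' + F%:~R) / M%:~R - om = (o1' - o1) / M%:~R by rewrite /o1; field.
  by rewrite normrM normfV ler_pdivrMr ?(lt_le_trans ltr01)// ler_peMr.
move=> k v Bv; have /dvdzP[q hq] := hdiv v Bv k; exists q.
have hk2 := near_row_word v (h2 k).
have -> : (o1' + F%:~R) / M%:~R * (lam zeta (m + k) v)%:R - q%:~R =
    (o1' * (lam zeta (m + k) v)%:R - (\sum_(a <- v) (kap 0%N *m S ^+ k) 0 a)%:~R) / M%:~R.
  have := congr1 (fun z : int => z%:~R : R) hq; rewrite yE rmorphD !rmorphM /= -pmulrn => e1.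
  have -> : q%:~R = ((\sum_(a <- v) (kap 0%N *m S ^+ k) 0 a)%:~R
     + F%:~R * (lam zeta (m + k) v)%:R) / M%:~R :> R by rewrite e1 mulfK.
  by field.
rewrite normrM normfV ler_pdivrMr ?(lt_le_trans ltr01)//.
apply: le_trans hk2 _; rewrite -[leLHS]mulr1; apply: ler_pM => //.
  by rewrite !mulr_ge0// exprn_ge0// ltW.
rewrite -mulrA ler_wpM2r//; last by rewrite ler_nat hB.
by rewrite mulr_ge0// exprn_ge0// ltW.
Qed.

End WordResonance.

(** * Decay of twisted sums *)

Lemma cat_cons_inj (T : eqType) (c : T) (u x z y : seq T) : c \notin u -> c \notin x ->
  u ++ c :: z = x ++ c :: y -> u = x /\ z = y.
Proof.
move=> cu cx e; have su : size u = size x.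
  have := congr1 (index c) e; rewrite !index_cat (negbTE cu) (negbTE cx) /= eqxx.
  by rewrite !addn0.
by move/eqP: e; rewrite eqseq_cat// => /andP[/eqP -> /eqP[->]].
Qed.

Section ReturnStructure.
Variables (d : nat) (zeta : 'I_d.+2 -> seq 'I_d.+2).
Notation letter := 'I_d.+2.
Hypothesis zeta_subst : substitution zeta.
Hypothesis zeta_prim : primitive_subst zeta.
Variables (c : letter) (P G : nat).
Notation ret := (return_word zeta c).
Hypothesis P_gt0 : (0 < P)%N.
Hypothesis zn_c : exists t, zn zeta P [:: c] = c :: t.
Hypothesis ret_size : forall v, ret v -> (size v <= G)%N.
Hypothesis ret_occurs : forall v, ret v -> forall b, infix (rcons v c) (zn zeta P [:: b]).
Hypothesis ret_factor : forall W, lang zeta W -> exists q cs t,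
  [/\ W = q ++ flatten cs ++ t, (size q <= G)%N, (size t <= G)%N &
    forall v, v \in cs -> ret v].

Lemma ret_cons v : ret v -> exists v', v = c :: v'.
Proof. by case=> v' [-> _ _]; exists v'. Qed.

Lemma ret_lam k v : ret v -> (lam zeta k [:: c] <= lam zeta k v)%N.
Proof. by move=> /ret_cons[v' ->]; rewrite [leqRHS]lam_cons leq_addr. Qed.

(** Since [c] occurs only at the beginnings of the chunks, an occurrence of [c x c] with no [c] in
    [x] fills exactly one chunk. *)
Lemma mem_return_chunks (cs : seq (seq letter)) v : ret v -> (forall u, u \in cs -> ret u) ->
  infix (rcons v c) (flatten cs) -> v \in cs.
Proof.
case=> x [-> cx _] hcs /infixP[s [y]].
elim: cs s hcs => [|u cs IH] s hcs /=.
  by move/(congr1 size); rewrite !size_cat /= addnS.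
have [u' [eu cu' _]] := hcs u (mem_head _ _); subst u.
have hcs' w : w \in cs -> ret w by move=> h; apply: hcs; rewrite inE h orbT.
have hd : flatten cs = [::] \/ exists z, flatten cs = c :: z.
  case: cs hcs' {IH hcs} => [|w cs] h; first by left.
  have [w' ->] := ret_cons (h w (mem_head _ _)).
  by right; exists (w' ++ flatten cs).
case: s => [|b s] /=; last case=> _.
  rewrite cat_rcons => -[e]; case: hd => [h|[z h]]; rewrite h in e.
    have : c \in u' by rewrite -[u']cats0 e mem_cat mem_head orbT.
    by rewrite (negbTE cu').
  by have [-> _] := cat_cons_inj cu' cx e; rewrite mem_head.
move=> e; rewrite inE; apply/orP; right.
have hsz : (size u' <= size s)%N.
  rewrite leqNgt; apply/negP => h.
  have := congr1 (fun w => c \in take (size u') w) e.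
  rewrite take_size_cat// (negbTE cu') take_cat ltnNge (ltnW h) /= mem_cat.
  by rewrite -[(size u' - size s)%N]prednK ?subn_gt0//= mem_head orbT.
apply: (IH (drop (size u') s) hcs').
have := congr1 (drop (size u')) e; rewrite drop_size_cat// drop_cat => ->.
rewrite ltn_neqAle hsz andbT; case: eqVneq => // h.
by rewrite h drop_size subnn drop0.
Qed.

(** The image of [v] starts with [c] and is followed in the language by the image of [c], which
    starts with [c] too, so it splits into return words. All of them appear: this is the Doeblin
    condition. *)
Lemma ret_zn v : ret v -> exists2 cs, zn zeta P v = flatten cs &
  (forall u, u \in cs -> ret u) /\ forall u, ret u -> u \in cs.
Proof.
move=> rv; case: (rv) => v' [ev cv lv]; have [t et] := zn_c.
have e1 : zn zeta P v = c :: (t ++ zn zeta P v').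
  by rewrite ev -(cat1s c v') zn_cat et.
have lz : lang zeta (rcons (c :: (t ++ zn zeta P v')) c).
  apply: lang_infix (lang_zn P lv); rewrite -e1 -!cats1 zn_cat et.
  by apply/infixP; exists [::], t; rewrite /= -catA.
have [cs h1 h2] := return_chunks lz; exists cs; first by rewrite e1.
split=> // u ru; apply: mem_return_chunks => //.
rewrite -h1 -e1 ev -(cat1s c v') zn_cat; apply: infix_catr; exact: ret_occurs.
Qed.

Lemma ret_decomp : exists C0, forall k w, lang zeta w -> exists s cs p,
  [/\ w = s ++ zn zeta k (flatten cs) ++ p, forall v, v \in cs -> ret v &
  (size s + size p <= C0 * lam zeta k [:: c])%N].
Proof.
have [Q Q0 hQ] := lam_compare zeta_subst zeta_prim.
exists (2 * (Q + G * Q))%N => k w lw.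
have hB a := hQ k a c.
have [s [W [p [-> lW hs hp]]]] := lang_decomp zeta_subst hB lw.
have [q [cs [t [-> hq ht hcs]]]] := ret_factor lW.
exists (s ++ zn zeta k q), cs, (zn zeta k t ++ p); split => //.
  by rewrite !zn_cat -!catA.
have hsz (x : seq letter) : (size x <= G)%N -> (lam zeta k x <= G * (Q * lam zeta k [:: c]))%N.
  by move=> hx; apply: leq_trans (lam_bound _ hB) _; rewrite leq_mul2r hx orbT.
rewrite !size_cat -!/(lam _ _ _) -mulnA mul2n -addnn mulnDl -mulnA.
by rewrite addnACA [X in (_ <= _ + X)%N]addnC addnACA leq_add// ?leq_add ?hsz// addnC.
Qed.

End ReturnStructure.

Section MeanDecay.
Variables (R : realType) (d : nat) (zeta : 'I_d.+2 -> seq 'I_d.+2).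
Notation letter := 'I_d.+2.
Hypothesis zeta_subst : substitution zeta.
Hypothesis zeta_prim : primitive_subst zeta.
Variables (c : letter) (P G : nat).
Notation ret := (return_word zeta c).
Hypothesis P_gt0 : (0 < P)%N.
Hypothesis zn_c : exists t, zn zeta P [:: c] = c :: t.
Hypothesis ret_size : forall v, ret v -> (size v <= G)%N.
Hypothesis ret_occurs : forall v, ret v -> forall b, infix (rcons v c) (zn zeta P [:: b]).
Hypothesis ret_factor : forall W, lang zeta W -> exists q cs t,
  [/\ W = q ++ flatten cs ++ t, (size q <= G)%N, (size t <= G)%N &
    forall v, v \in cs -> ret v].

(** The phase in front of a chunk is a product of at most [size cs] factors, each within [eps] of
    1. *)
Lemma tw_coherent (F : letter -> R[i]) om k eps (cs : seq (seq letter)) :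
  (forall a, normc (F a) <= 1) -> 0 <= eps ->
  (forall v, v \in cs -> normc (cis (om * (lam zeta k v)%:R) - 1) <= eps) ->
  normc (tw F om (zn zeta k (flatten cs)) - \sum_(v <- cs) tw F om (zn zeta k v)) <=
    (size cs)%:R * eps * (lam zeta k (flatten cs))%:R.
Proof.
move=> F1 eps0; elim: cs => [|v cs IH] h.
  by rewrite zn_nil big_nil subrr normc0 !mul0r.
rewrite big_cons [flatten _]/= zn_cat tw_cat lam_cat -/(lam zeta k v).
set X := tw F om (zn zeta k (flatten cs)); set e := cis _; set Y := \sum_(_ <- _) _.
have -> : tw F om (zn zeta k v) + e * X - (tw F om (zn zeta k v) + Y) =
  (e - 1) * X + (X - Y) by ring.
apply: le_trans (normcD_le _ _) _; rewrite normcM -nat1r natrD.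
have he : normc (e - 1) <= eps by apply: h; rewrite mem_head.
have hX : normc X <= (lam zeta k (flatten cs))%:R by exact: normc_tw.
have h1 := ler_pM (normc_ge0 _) (normc_ge0 _) he hX.
have h2 : normc (X - Y) <= (size cs)%:R * eps * (lam zeta k (flatten cs))%:R.
  by apply: IH => u hu; apply: h; rewrite inE hu orbT.
apply: le_trans (lerD h1 h2) _.
rewrite -!mulrA -[X in X + _ <= _]mul1r -mulrDl ler_wpM2l// ?addr_ge0//.
by rewrite ler_wpM2l// lerDr.
Qed.

(** The point at [1 / Q] of the way from [Z] to the mean over [v]. *)
Definition recenter (F : letter -> R[i]) om k (Q : nat) (v : seq letter) (Z : R[i]) : R[i] :=
  Z + (tw F om (zn zeta k v) - Z * (lam zeta k v)%:R) / (Q%:R * (lam zeta k v)%:R).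

Lemma ret_lam_gt0 k v : ret v -> (0 < lam zeta k v)%N.
Proof. by move=> /(ret_lam k); apply: leq_trans; exact: lam_gt0. Qed.

(* One Doeblin step: the averages over all return words are pulled towards the
   average over the fixed return word [vs], which occurs in each of them. *)
Lemma recenter_step : exists Q, (0 < Q)%N /\ forall (F : letter -> R[i]) om k eps (r : R) vs Z,
  (forall a, normc (F a) <= 1) -> 0 <= eps -> ret vs ->
  (forall v, ret v -> normc (cis (om * (lam zeta k v)%:R) - 1) <= eps) ->
  (forall v, ret v -> normc (tw F om (zn zeta k v) - Z * (lam zeta k v)%:R) <=
    r * (lam zeta k v)%:R) ->
  normc (recenter F om k Q vs Z - Z) <= r /\
  forall v, ret v -> normc (tw F om (zn zeta (k + P) v) -
      recenter F om k Q vs Z * (lam zeta (k + P) v)%:R) <=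
    ((1 - Q%:R^-1) * r + Q%:R * eps) * (lam zeta (k + P) v)%:R.
Proof.
have [Q1 Q10 hQ1] := lam_add_compare zeta_subst zeta_prim P.
(* The first bound gives [vs] a share at least [1 / Q] of the image of any return word; the second
   bounds the number of chunks of that image. *)
have [Q [Q0 QG QL]] : exists Q, [/\ (0 < Q)%N, (G * Q1 <= Q)%N & (G * maxlen zeta ^ P <= Q)%N].
  exists ((G * Q1).+1 + G * maxlen zeta ^ P)%N; split; first by rewrite addSn.
    by rewrite addSn leqW// leq_addr.
  by rewrite leq_addl.
exists Q; split => //.
move=> F om k eps r vs Z F1 eps0 rvs he hr.
have Qr : 0 < Q%:R :> R by rewrite ltr0n.
set lvs := (lam zeta k vs)%:R : R.
have lvs0 : 0 < lvs by rewrite ltr0n ret_lam_gt0.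
have lvsC : normc ((lam zeta k vs)%:R : R[i]) = lvs by rewrite normc_nat.
have r0 : 0 <= r.
  by rewrite -(pmulr_lge0 _ lvs0); apply: le_trans (hr vs rvs); exact: normc_ge0.
set Xs := tw F om (zn zeta k vs) - Z * (lam zeta k vs)%:R.
pose Y := Xs / (lam zeta k vs)%:R.
have lC0 : ((lam zeta k vs)%:R : R[i]) != 0 by rewrite pnatr_eq0 -lt0n ret_lam_gt0.
have QC0 : (Q%:R : R[i]) != 0 by rewrite pnatr_eq0 -lt0n.
have hY : normc Y <= r.
  by rewrite /Y normcM normcV lvsC ler_pdivrMr// hr.
have recE : recenter F om k Q vs Z = Z + Y / Q%:R.
  by rewrite /recenter -/Xs /Y; congr (_ + _); rewrite invfM mulrA mulrAC.
have Q1r : Q%:R^-1 <= 1 :> R by rewrite invf_le1// ler1n.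
split.
  rewrite recE addrC addKr normcM normcV normc_nat -[leRHS]mulr1.
  by apply: ler_pM => //; exact: normc_ge0.
move=> v rv.
have [cs ecs [hcs1 hcs2]] := ret_zn zn_c ret_occurs rv.
have [cs1 [cs2 ecs2]] : exists cs1 cs2, cs = cs1 ++ vs :: cs2.
  by case/splitPr: (hcs2 vs rvs) => x y; exists x, y.
have znE : zn zeta (k + P) v = zn zeta k (flatten cs) by rewrite znD ecs.
have scs : (size cs <= Q)%N.
  have h1 : (size cs <= size (flatten cs))%N.
    rewrite size_flatten sumnE big_map -sum1_size big_seq [leqRHS]big_seq.
    by apply: leq_sum => u /hcs1/ret_cons[u' ->].
  apply: (leq_trans h1); rewrite -ecs -/(lam zeta P v).
  apply: leq_trans (lam_bound _ (lam_le_exp zeta P)) _.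
  by apply: leq_trans QL; rewrite leq_mul2r ret_size ?orbT.
set L := (lam zeta (k + P) v)%:R : R.
have LE : L = (lam zeta k (flatten cs))%:R by rewrite /L /lam znE.
have hp : L <= Q%:R * lvs.
  rewrite /L /lvs -natrM ler_nat.
  apply: leq_trans (lam_bound _ (fun a => hQ1 k a c)) _.
  have h1 := ret_lam k rvs.
  apply: leq_trans (_ : G * Q1 * lam zeta k vs <= _)%N.
    by rewrite -mulnA leq_mul ?ret_size// leq_mul2l h1 orbT.
  by rewrite leq_mul2r QG orbT.
have h1 := @tw_coherent F om k eps cs F1 eps0 (fun u hu => he u (hcs1 u hu)).
pose X u := tw F om (zn zeta k u) - Z * (lam zeta k u)%:R.
(* The shift of the centre, [Y * L / Q] in total, is charged to the single chunk [vs], whose own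
   deviation is [Y * lvs] with [L / Q <= lvs]. What is left is
   [r * (L - lvs) + r * (lvs - L / Q)]. *)
have h2 : normc (\sum_(u <- cs) X u - (Y / Q%:R) * L%:C%C) <= (1 - Q%:R^-1) * r * L.
  have LQ : L = lvs + \sum_(u <- cs1 ++ cs2) (lam zeta k u)%:R.
    by rewrite LE lam_flatten natr_sum ecs2 /lvs !big_cat big_cons /=; ring.
  have -> : \sum_(u <- cs) X u - (Y / Q%:R) * L%:C%C =
      \sum_(u <- cs1 ++ cs2) X u + Y * (lvs - L / Q%:R)%:C%C.
    have -> : \sum_(u <- cs) X u = \sum_(u <- cs1 ++ cs2) X u + Y * lvs%:C%C.
      rewrite ecs2 !big_cat big_cons /= /Y /lvs rmorph_nat -/(X vs) mulfVK//.
      by rewrite addrCA addrC.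
    have -> : (lvs - L / Q%:R)%:C%C = lvs%:C%C - L%:C%C / Q%:R :> R[i].
      by rewrite rmorphB rmorphM fmorphV (rmorph_nat (real_complex R) Q).
    move: (lvs%:C%C) (L%:C%C) (\sum_(_ <- _ ++ _) _) (Y) => x1 x2 x3 x4.
    by ring.
  apply: le_trans (normcD_le _ _) _.
  have h3 : normc (\sum_(u <- cs1 ++ cs2) X u) <= r * (L - lvs).
    rewrite LQ addrAC subrr add0r mulr_sumr; apply: le_trans (normc_sum _ _ _) _.
    rewrite big_seq [leRHS]big_seq; apply: ler_sum => u hu; apply: hr; apply: hcs1.
    by move: hu; rewrite ecs2 !mem_cat inE => /orP[->//|->]; rewrite !orbT.
  have h4 : 0 <= lvs - L / Q%:R by rewrite subr_ge0 ler_pdivrMr// mulrC.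
  have h5 : normc (Y * (lvs - L / Q%:R)%:C%C) <= r * (lvs - L / Q%:R).
    rewrite normcM normcR ger0_norm// ler_wpM2r//.
  apply: le_trans (lerD h3 h5) _.
  by rewrite le_eqVlt; apply/orP; left; apply/eqP; ring.
have LC : (lam zeta (k + P) v)%:R = L%:C%C :> R[i] by rewrite /L rmorph_nat.
rewrite recE znE LC.
have -> : tw F om (zn zeta k (flatten cs)) - (Z + Y / Q%:R) * L%:C%C =
  (tw F om (zn zeta k (flatten cs)) - \sum_(u <- cs) tw F om (zn zeta k u)) +
  (\sum_(u <- cs) X u - Y / Q%:R * L%:C%C).
  have -> : \sum_(u <- cs) X u = \sum_(u <- cs) tw F om (zn zeta k u) - Z * L%:C%C.
    rewrite /X sumrB -mulr_sumr LE lam_flatten rmorph_nat natr_sum; congr (_ - _ * _).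
  by ring.
apply: le_trans (normcD_le _ _) _; rewrite mulrDl addrC.
apply: lerD => //; apply: le_trans h1 _; rewrite -LE.
by rewrite ler_wpM2r// ler_wpM2r// ler_nat.
Qed.

(* All that is used of weak mixing: for long words, the twisted means cannot all stay
   away from [0], whatever the frequency. *)
Definition small_means (F : letter -> R[i]) := forall om eps : R, 0 < eps ->
  exists N0, forall N, (N0 <= N)%N ->
  exists w, [/\ lang zeta w, size w = N & normc (tw F om w) <= eps * N%:R].

(** At such a level, every word of length [R0 * |zeta^k(c)|] has at most [R0] chunks, so its twisted
    sum is close to [Z] times its length and cannot be small. *)
Lemma small_means_center F om eta : (forall a, normc (F a) <= 1) -> small_means F ->
  0 < eta -> eta <= 1 ->
  ~ (forall dl N0, 0 < dl -> exists k Z, [/\ (N0 <= lam zeta k [:: c])%N, eta <= normc Z,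
      forall v, ret v -> normc (cis (om * (lam zeta k v)%:R) - 1) <= dl &
      forall v, ret v -> normc (tw F om (zn zeta k v) - Z * (lam zeta k v)%:R) <=
        dl * (lam zeta k v)%:R]).
Proof.
move=> F1 hF eta0 eta1 H.
have [C0 hC0] := ret_decomp zeta_subst zeta_prim ret_factor.
(* [R0] makes the two remainders an [eta / 8] part of the word; then [dl] keeps the total deviation
   over [R0] chunks below [eta / 4]. *)
have [R0 [R00 hR0]] : exists R0 : nat, (0 < R0)%N /\ 8 * C0%:R <= eta * R0%:R.
  exists (Num.bound (8 * C0%:R / eta)).+1; split => //.
  rewrite [leRHS]mulrC -ler_pdivrMr//; apply/ltW.
  have /archi_boundP h : 0 <= 8 * C0%:R / eta by rewrite !mulr_ge0// invr_ge0 ltW.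
  by apply: lt_le_trans h _; rewrite ler_nat.
pose dl : R := eta / (4 * R0.+1%:R).
have dl0 : 0 < dl by rewrite divr_gt0// mulr_gt0.
have dlE : R0.+1%:R * dl = eta / 4.
  by rewrite /dl; field; rewrite nat1r pnatr_eq0.
have eta8 : 0 < eta / 8 by rewrite divr_gt0.
have [N0 hN0] := hF om _ eta8.
have [k [Z [hk hZ hc ht]]] := H dl N0 dl0.
set l := lam zeta k [:: c] in hk *.
have l0 : (0 < l)%N by exact: lam_gt0.
have [w [lw sw hw]] : exists w, [/\ lang zeta w, size w = (R0 * l)%N &
    normc (tw F om w) <= eta / 8 * (R0 * l)%:R].
  by apply: hN0; apply: leq_trans hk _; rewrite leq_pmull.
have [s [cs [p [ew hcs hsp]]]] := hC0 k w lw; rewrite -/l in hsp.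
have lcs : (size cs * l <= lam zeta k (flatten cs))%N.
  rewrite lam_flatten -sum1_size big_distrl /= big_seq [leqRHS]big_seq.
  by apply: leq_sum => v hv; rewrite mul1n; apply: ret_lam; exact: hcs.
have sz : (R0 * l = size s + (lam zeta k (flatten cs) + size p))%N.
  by rewrite -sw ew !size_cat.
have scs : (size cs <= R0)%N.
  by rewrite -(leq_pmul2r l0) (leq_trans lcs)// sz addnCA leq_addr.
set mid := zn zeta k (flatten cs) in ew.
set Lf := lam zeta k (flatten cs) in sz lcs.
have h1 : normc (tw F om mid) <= normc (tw F om w) + (size s)%:R + (size p)%:R.
  have -> : tw F om mid = cis (- (om * (size s)%:R)) * (tw F om w - tw F om s) -
      cis (om * (size mid)%:R) * tw F om p.
    rewrite ew !tw_cat [tw F om s + _ - _]addrAC subrr add0r mulrA -cisD addNr cis0 mul1r.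
    by rewrite addrK.
  apply: le_trans (normc_sub_le _ _) _; rewrite !normcM !normc_cis !mul1r.
  apply: lerD; last exact: normc_tw.
  by apply: le_trans (normc_sub_le _ _) _; rewrite lerD2l; exact: normc_tw.
have h2 := @tw_coherent F om k dl cs F1 (ltW dl0) (fun v hv => hc v (hcs v hv)).
rewrite -/mid -/Lf in h2.
have h3 : normc (\sum_(v <- cs) tw F om (zn zeta k v) - Z * Lf%:R) <= dl * Lf%:R.
  rewrite /Lf lam_flatten !natr_sum !mulr_sumr -sumrB.
  apply: le_trans (normc_sum _ _ _) _; rewrite big_seq [leRHS]big_seq.
  by apply: ler_sum => v hv; apply: ht; exact: hcs.
have h4 : eta * Lf%:R <= normc (tw F om mid) + (size cs)%:R * dl * Lf%:R + dl * Lf%:R.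
  apply: le_trans (_ : normc (Z * Lf%:R) <= _).
    by rewrite normcM normc_nat ler_wpM2r.
  have -> : Z * Lf%:R = tw F om mid -
      (tw F om mid - \sum_(v <- cs) tw F om (zn zeta k v)) -
      (\sum_(v <- cs) tw F om (zn zeta k v) - Z * Lf%:R) by ring.
  apply: le_trans (normc_sub_le _ _) _; apply: lerD => //.
  by apply: le_trans (normc_sub_le _ _) _; exact: lerD.
have h5 : (size cs)%:R * dl * Lf%:R + dl * Lf%:R <= eta / 4 * Lf%:R.
  rewrite -mulrDl ler_wpM2r// -dlE -natr1 mulrDl mul1r lerD2r ler_wpM2r ?(ltW dl0)//.
  by rewrite ler_nat.
have sp : (size s)%:R + (size p)%:R <= eta / 8 * (R0 * l)%:R :> R.
  rewrite -natrD; apply: le_trans (_ : (C0 * l)%:R <= _); first by rewrite ler_nat.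
  rewrite !natrM mulrA ler_wpM2r// mulrAC ler_pdivlMr// mulrC.
  by [].
have szR : (R0 * l)%:R = (size s)%:R + (size p)%:R + Lf%:R :> R.
  by rewrite sz !natrD; ring.
have N_gt0 : 0 < (R0 * l)%:R :> R by rewrite ltr0n muln_gt0 R00.
move: h1 hw h4 h5 sp szR N_gt0.
move: (normc (tw F om mid)) (normc (tw F om w)) ((size cs)%:R * dl * Lf%:R) (dl * Lf%:R).
move: ((R0 * l)%:R : R) ((size s)%:R : R) ((size p)%:R : R) (Lf%:R : R).
move=> N a b f x y z1 z2 h1 hw h4 h5 sp szR N0'.
have e1 : 3 * (eta * f) <= eta * N by lra.
have e2 : eta * N <= N by rewrite ler_piMl// ltW.
have e3 : 7 * N <= 8 * f by lra.
have e4 : 7 * (eta * N) <= 8 * (eta * f).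
  by have := ler_wpM2l (ltW eta0) e3; lra.
have e5 : 0 < eta * N by rewrite mulr_gt0.
lra.
Qed.

(** The successive centres [Z j] move by geometrically decreasing amounts. If a sum at step [J] were
    too large, so would be [Z J], and all later centres would stay at distance at least [r1 ^+ J]
    from 0, against [small_means_center]. The constants are fixed before [F] and [om]. *)
Lemma centered_decay (K r0 : R) : 0 <= K -> 0 < r0 -> r0 < 1 -> (exists v, ret v) ->
  exists K2 r1 : R, [/\ 0 <= K2, 0 < r1, r1 < 1 &
  forall F, (forall a, normc (F a) <= 1) -> small_means F -> forall om m,
  (forall k v, ret v -> near_int (K * r0 ^+ k) (om * (lam zeta (m + k) v)%:R)) ->
  forall j v, ret v -> normc (tw F om (zn zeta (m + P * j) v)) <=
    K2 * r1 ^+ j * (lam zeta (m + P * j) v)%:R].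
Proof.
move=> K0 r00 r01 [vs rvs]; have [Q [Q0 hstep]] := recenter_step.
have Qr : 0 < Q%:R :> R by rewrite ltr0n.
pose q : R := 1 - Q%:R^-1.
have q1 : q < 1 by rewrite ltrBlDr ltrDl invr_gt0.
have q0 : 0 <= q by rewrite subr_ge0 invf_le1// ler1n.
have [r1 [r10 r11 r0r1 qr1]] : exists r1 : R, [/\ 0 < r1, r1 < 1, r0 <= r1 & q < r1].
  have mlt : Num.max q r0 < 1 by rewrite gt_max q1.
  have qm : q <= Num.max q r0 by rewrite le_max lexx.
  have rm : r0 <= Num.max q r0 by rewrite le_max lexx orbT.
  move: (Num.max q r0) mlt qm rm => x x1 qx rx.
  by exists ((1 + x) / 2); split; lra.
have pi0 : 0 <= pi :> R by exact: pi_ge0.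
pose E := Q%:R * (2 * pi * K).
have E0 : 0 <= E by rewrite !mulr_ge0.
(* Solves [q * K3 + E <= K3 * r1], the inequality that carries the bound [hZ] from [j] to [j.+1];
   hence the strict [q < r1]. *)
pose K3 := 1 + E / (r1 - q).
have K31 : 1 <= K3 by rewrite lerDl divr_ge0// subr_ge0 ltW.
have K30 : 0 <= K3 by apply: le_trans K31.
have hK3 : q * K3 + E <= K3 * r1.
  rewrite -lerBrDl [K3 * r1]mulrC -mulrBl /K3 mulrDr mulr1 mulrC divfK.
    by rewrite lerDr subr_ge0 ltW.
  by rewrite gt_eqF// subr_gt0.
have h1r : 0 < 1 - r1 by rewrite subr_gt0.
(* [K3] is for the deviation from the centre, [K3 / (1 - r1)] for all later moves of the centre, and
   1 for the distance kept from 0. *)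
exists (K3 + K3 / (1 - r1) + 1), r1; split => //.
  by apply: addr_ge0 => //; apply: addr_ge0 => //; apply: divr_ge0 => //; exact: ltW.
move=> F F1 hF om m hnear.
have hcis j v : ret v -> normc (cis (om * (lam zeta (m + P * j) v)%:R) - 1) <= 2 * pi * K * r0 ^+ j.
  move=> rv; apply: le_trans (normc_cis_near (hnear (P * j)%N v rv)) _.
  rewrite mulrA ler_wpM2l ?mulr_ge0//.
  by rewrite ler_wiXn2l ?(ltW r00) ?(ltW r01)// leq_pmull.
pose fix Z j : R[i] := if j is i.+1 then recenter F om (m + P * i) Q vs (Z i) else 0.
have hZ j : forall v, ret v ->
    normc (tw F om (zn zeta (m + P * j) v) - Z j * (lam zeta (m + P * j) v)%:R) <=
    K3 * r1 ^+ j * (lam zeta (m + P * j) v)%:R.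
  elim: j => [|j IH] v rv.
    rewrite mul0r subr0 mulr1; apply: le_trans (normc_tw _ _ _) _ => //.
    by rewrite -[leLHS]mul1r ler_wpM2r.
  have eps0 : 0 <= 2 * pi * K * r0 ^+ j by rewrite !mulr_ge0// exprn_ge0// ltW.
  have [_ h] := hstep F om _ _ _ vs _ F1 eps0 rvs (hcis j) IH.
  rewrite mulnS addnCA addnC [Z _]/=; apply: le_trans (h v rv) _.
  rewrite ler_wpM2r// exprS -/q.
  apply: le_trans (_ : (q * K3 + E) * r1 ^+ j <= _).
    have -> : q * (K3 * r1 ^+ j) + Q%:R * (2 * pi * K * r0 ^+ j) =
      q * K3 * r1 ^+ j + E * r0 ^+ j by rewrite /E; ring.
    rewrite [leRHS]mulrDl lerD2l; apply: ler_wpM2l => //.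
    by apply: lerXn2r; rewrite ?nnegrE ?(ltW r00) ?(ltW r10).
  by rewrite mulrA; apply: ler_wpM2r => //; rewrite exprn_ge0// ltW.
have hdZ j : normc (Z j.+1 - Z j) <= K3 * r1 ^+ j.
  have eps0 : 0 <= 2 * pi * K * r0 ^+ j by rewrite !mulr_ge0// exprn_ge0// ltW.
  by have [h _] := hstep F om _ _ _ vs _ F1 eps0 rvs (hcis j) (hZ j).
move=> J v1 rv1; rewrite leNgt; apply/negP => hlt.
set lv := (lam zeta _ v1)%:R in hlt.
have lv0 : 0 < lv :> R by rewrite ltr0n ret_lam_gt0.
have ZJ : (K3 / (1 - r1) + 1) * r1 ^+ J <= normc (Z J).
  rewrite -(ler_pM2r lv0).
  have h1 := hZ J v1 rv1; rewrite -/lv in h1.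
  have h2 : normc (tw F om (zn zeta (m + P * J) v1)) <= normc (Z J) * lv + K3 * r1 ^+ J * lv.
    rewrite -(subrK (Z J * (lam zeta (m + P * J) v1)%:R) (tw _ _ _)) addrC.
    by apply: le_trans (normcD_le _ _) _; rewrite normcM normc_nat lerD2l.
  have h3 := lt_le_trans hlt h2.
  rewrite -(lerD2r (K3 * r1 ^+ J * lv)); apply: le_trans (ltW h3).
  by rewrite le_eqVlt; apply/orP; left; apply/eqP; ring.
have hsum i : normc (Z (J + i)%N - Z J) <= K3 / (1 - r1) * r1 ^+ J * (1 - r1 ^+ i).
  elim: i => [|i IH]; first by rewrite addn0 subrr normc0 expr0 subrr mulr0.
  rewrite addnS -(subrKA (Z (J + i)%N)).
  apply: le_trans (normcD_le _ _) _; apply: le_trans (lerD (hdZ _) IH) _.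
  rewrite le_eqVlt; apply/orP; left; apply/eqP; rewrite exprD exprS.
  by field; rewrite gt_eqF.
have hlow i : r1 ^+ J <= normc (Z (J + i)%N).
  have h1 : normc (Z J) <= normc (Z (J + i)%N) + normc (Z (J + i)%N - Z J).
    have e : Z J = Z (J + i)%N - (Z (J + i)%N - Z J) by rewrite opprB addrC subrK.
    by rewrite {1}e; exact: normc_sub_le.
  have h2 := hsum i.
  have h3 : K3 / (1 - r1) * r1 ^+ J * (1 - r1 ^+ i) <= K3 / (1 - r1) * r1 ^+ J.
    rewrite ler_piMr//; first by rewrite mulr_ge0 ?exprn_ge0 ?divr_ge0 ?(ltW r10) ?(ltW h1r).
    by rewrite gerDl oppr_le0 exprn_ge0// ltW.
  move: ZJ; rewrite mulrDl mul1r => ZJ.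
  have := le_trans ZJ (le_trans h1 (lerD (lexx _) (le_trans h2 h3))).
  by rewrite addrC lerD2r.
apply: (@small_means_center F om (r1 ^+ J) F1 hF).
- by rewrite exprn_gt0.
- by rewrite exprn_ile1// ltW.
move=> dl N0 dl0.
pose K4 := K3 + 2 * pi * K.
have K40 : 0 <= K4 by apply: addr_ge0 => //; rewrite !mulr_ge0.
have [e he] : exists e, K4 / dl < r1^-1 ^+ e by apply: expr_unbounded; rewrite invf_gt1.
have K4e i : (e <= i)%N -> K4 * r1 ^+ i <= dl.
  move=> ei; apply: le_trans (_ : K4 * r1 ^+ e <= _).
    by apply: ler_wpM2l => //; rewrite ler_wiXn2l ?(ltW r10) ?(ltW r11).
  move: he; rewrite exprVn ltr_pdivrMr// mulrC => /ltW.
  by rewrite ler_pdivlMr ?exprn_gt0.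
have [M M0 hM] := lam_growth zeta_subst zeta_prim.
pose i := (e + M * N0.+1)%N.
exists (m + P * (J + i))%N, (Z (J + i)%N); split.
- apply: leq_trans (_ : lam zeta (0 + M * N0.+1) [:: c] <= _)%N.
    apply: leq_trans (hM 0%N N0 c c); rewrite muln1; apply/ltnW; exact: ltn_expl.
  apply: lam_mono => //; rewrite add0n; apply: leq_trans (leq_addl _ _).
  by apply: leq_trans (leq_pmull _ P_gt0); rewrite /i addnA leq_addl.
- exact: hlow.
- move=> v rv; apply: le_trans (hcis _ v rv) _.
  apply: le_trans (K4e (J + i)%N _); last by rewrite /i addnCA leq_addr.
  apply: ler_pM; rewrite ?mulr_ge0 ?exprn_ge0 ?(ltW r00)//; first by rewrite lerDr.
  by apply: lerXn2r; rewrite ?nnegrE ?(ltW r00) ?(ltW r10).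
- move=> v rv; apply: le_trans (hZ _ v rv) _; rewrite ler_wpM2r//.
  apply: le_trans (K4e (J + i)%N _); last by rewrite /i addnCA leq_addr.
  by apply: ler_wpM2r; rewrite ?exprn_ge0 ?(ltW r10)// lerDl !mulr_ge0.
Qed.

End MeanDecay.

(** * Uniform logarithmic bound for twisted sums *)

Section LogDecay.
Variables (R : realType) (d : nat) (zeta : 'I_d.+2 -> seq 'I_d.+2).
Notation letter := 'I_d.+2.
Hypothesis zeta_subst : substitution zeta.
Hypothesis zeta_prim : primitive_subst zeta.
Hypothesis irr : irreducible_poly (char_poly (subst_mx rat zeta)).
Hypothesis no_unit : forall z : R[i], eigenvalue (subst_mx R[i] zeta) z -> normc z != 1.

Lemma tw_int (F : letter -> R[i]) om (m : int) w : tw F (om + m%:~R) w = tw F om w.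
Proof. by elim: w => //= a w ->; rewrite cisDint. Qed.

Lemma near_int_le (x y t : R) : x <= y -> near_int x t -> near_int y t.
Proof. by move=> xy [m hm]; exists m; exact: le_trans xy. Qed.

Lemma tw_flatten_le (F : letter -> R[i]) om k D (cs : seq (seq letter)) :
  (forall v, v \in cs -> normc (tw F om (zn zeta k v)) <= D * (lam zeta k v)%:R) ->
  normc (tw F om (zn zeta k (flatten cs))) <= D * (lam zeta k (flatten cs))%:R.
Proof.
elim: cs => [|v cs IH] h; first by rewrite zn_nil normc0 lam_nil mulr0.
rewrite [flatten _]/= zn_cat tw_cat lam_cat natrD mulrDr.
apply: le_trans (normcD_le _ _) _; rewrite normcM normc_cis mul1r.
apply: lerD; first by apply: h; rewrite mem_head.
by apply: IH => u hu; apply: h; rewrite inE hu orbT.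
Qed.

(* Either some return word is badly approximated along the window, and then
   [tw_gain] applies; or the window is resonant, and then the sums decay
   exponentially because they do so at the resonant frequency. *)
Lemma tw_bound_step : exists (Q : nat) (kap E r : R),
  [/\ (1 < Q)%N, 0 < kap /\ kap <= 1, 0 <= E, 0 < r /\ r < 1 &
  forall F, (forall a, normc (F a) <= 1) -> small_means zeta F ->
  forall om n D, 0 <= om -> om <= 1 -> (1 <= n)%N -> 0 <= D ->
  tw_bound zeta F om n D ->
  tw_bound zeta F om (Q * n) (D * (1 - kap)) \/ tw_bound zeta F om (Q * n) (E * r ^+ n)].
Proof.
have [c [P [G [[P0 zn_c rsz rocc [v0 rv0]] rfac]]]] := return_structure zeta_subst zeta_prim.
have v00 : v0 != [::] by have [v' ->] := ret_cons rv0.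
have [dl [r0 [K [dl0 r00 r01 K0 hres]]]] := word_resonance zeta_subst irr no_unit v00 rv0 rsz.
have [dl' [dl'0 dl'h dl'dl]] : exists x : R, [/\ 0 < x, x < 2^-1 & x <= dl].
  exists (Num.min dl 4^-1); rewrite lt_min dl0 invr_gt0 ltr0n gt_min ge_min lexx /=.
  by split => //; rewrite ltf_pV2 ?posrE ?ltr0n// ltr_nat orbT.
have [kk [kk0 kk1 hgain]] := far_int_gain dl'0 dl'h.
have [K2 [r1 [K20 r10 r11 hdec]]] :=
  centered_decay zeta_subst zeta_prim P0 zn_c rsz rocc rfac K0 r00 r01 (ex_intro _ v0 rv0).
have [Qg [Qg0 hQg]] : exists Qg, (0 < Qg)%N /\
    forall n a, (lam zeta (n + P) [:: a] <= Qg * lam zeta n [:: c])%N.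
  by have [q q0 hq] := lam_add_compare zeta_subst zeta_prim P; exists q.
have [M M0 hM] := lam_growth zeta_subst zeta_prim.
pose L := maxlen zeta.
have L0 : (0 < L)%N by exact: maxlen_gt0.
(* The length at level [n + P * n] is at most a constant times [(L ^ P.+1) ^ n]; the factor 2 leaves
   a gain [2 ^- n] when [om'] is replaced by [om]. *)
pose H : R := 2 * (L ^ P.+1)%:R.
have LP1 : 1 <= (L ^ P.+1)%:R :> R by rewrite ler1n expn_gt0 L0.
have H1 : 1 <= H.
  by apply: le_trans LP1 _; rewrite /H ler_peMl// ler1n.
have [e he] := hres H H1.
have [r2 [r20 r21 r1r2 hr2]] : exists r2 : R, [/\ 0 < r2, r2 < 1, r1 <= r2 & 2^-1 <= r2].
  exists (Num.max r1 2^-1); rewrite lt_max r10 gt_max r11 !le_max !lexx orbT /=.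
  by rewrite invf_lt1 ?ltr1n.
have pi0 : 0 <= pi :> R by exact: pi_ge0.
pose E := K2 + 2 * pi * G%:R + 2 * G%:R.
(* Chosen so that level [Q * n] lies above both levels reached below, [n + k + P] with [k <= e * n],
   and [n + P * n + M * n.+1]. *)
exists (P + M * 2 + e).+2, (kk / Qg%:R), E, r2; split => //.
- split; first by rewrite divr_gt0// ltr0n.
  by rewrite ler_pdivrMr ?ltr0n// mul1r (le_trans kk1)// ler1n.
- by rewrite !addr_ge0// !mulr_ge0.
move=> F F1 hF om n D om0 om1 n1 D0 hD.
have [hnear|hfar] := pselect (forall k v, (k <= e * n)%N -> return_word zeta c v ->
    near_int dl' (om * (lam zeta (n + k) v)%:R)); last first.
  left; have [k [v [hk rv hv]]] : exists k v, [/\ (k <= e * n)%N, return_word zeta c v &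
      ~ near_int dl' (om * (lam zeta (n + k) v)%:R)].
    apply: contrapT => h; apply: hfar => k v hk rv; apply: contrapT => h2.
    by apply: h; exists k, v.
  have lvl : (n + k + P <= (P + M * 2 + e).+2 * n)%N.
    rewrite -addn2 mulnDl [(P + M * 2 + e)%N]addnC mulnDl.
    rewrite addnC [X in (_ <= X)%N]addnC addnA [(P + n)%N]addnC -addnA.
    apply: leq_add; first by rewrite leq_pmull.
    rewrite addnC; apply: leq_add => //; rewrite mulnDl.
    by apply: leq_trans (leq_addr _ _); rewrite leq_pmulr.
  apply: (tw_bound_mono lvl).
  have [v' [ev cv' lv]] := rv; rewrite ev in hv.
  apply: (@tw_gain R d zeta F om (n + k) P c v' kk Qg D) => //.
  - by move=> b; rewrite -ev; exact: rocc.
  - exact: ltW.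
  - exact: hgain.
  - exact: tw_bound_mono (leq_addr _ _) hD.
right.
have [om' [hom hn]] := he om n om0 om1 n1 (fun k v hk rv => near_int_le dl'dl (hnear k v hk rv)).
pose k := (n + P * n)%N.
have hret v : return_word zeta c v ->
    normc (tw F om (zn zeta k v)) <= ((K2 + 2 * pi * G%:R) * r2 ^+ n) * (lam zeta k v)%:R.
  move=> rv; have h1 := hdec F F1 hF om' n hn n v rv; rewrite -/k in h1.
  have h2 := normc_tw_diff F1 om om' (zn zeta k v); rewrite -/(lam zeta k v) in h2.
  set lv := (lam zeta k v)%:R in h1 h2 *.
  have lv0 : 0 <= lv by [].
  have lvle : lv <= G%:R * (L ^ P.+1)%:R ^+ n.
    rewrite -natrX -natrM ler_nat; apply: leq_trans (lam_bound _ (lam_le_exp zeta k)) _.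
    by rewrite -expnM leq_mul ?rsz// mulSn.
  have h3 : `|om - om'| * lv <= G%:R * r2 ^+ n.
    have Hn0 : 0 < H ^+ n by rewrite exprn_gt0// (lt_le_trans ltr01).
    have h4 : `|om - om'| * (L ^ P.+1)%:R ^+ n <= r2 ^+ n.
      move: hom; rewrite distrC /H exprMn => h.
      have t0 : 0 < 2 ^+ n :> R by rewrite exprn_gt0.
      apply: le_trans (_ : 2^-1 ^+ n <= _); last first.
        by apply: lerXn2r; rewrite ?nnegrE ?(ltW r20)// invr_ge0.
      by rewrite exprVn -[leRHS]mul1r ler_pdivlMr// -mulrA [X in _ * X]mulrC.
    apply: le_trans (ler_wpM2l (normr_ge0 _) lvle) _.
    by rewrite mulrCA ler_wpM2l.
  have -> : tw F om (zn zeta k v) =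
      tw F om' (zn zeta k v) + (tw F om (zn zeta k v) - tw F om' (zn zeta k v)) by ring.
  apply: le_trans (normcD_le _ _) _; apply: le_trans (lerD h1 h2) _.
  have h5 : r1 ^+ n <= r2 ^+ n.
    by apply: lerXn2r; rewrite ?nnegrE ?(ltW r20) ?(ltW r10).
  have h6 : K2 * r1 ^+ n * lv <= K2 * r2 ^+ n * lv by rewrite ler_wpM2r// ler_wpM2l.
  have h7 : 2 * pi * `|om - om'| * lv ^+ 2 <= 2 * pi * (G%:R * r2 ^+ n) * lv.
    have -> : 2 * pi * `|om - om'| * lv ^+ 2 = 2 * pi * (`|om - om'| * lv) * lv by ring.
    by rewrite ler_wpM2r// ler_wpM2l// mulr_ge0.
  apply: le_trans (lerD h6 h7) _.
  by rewrite le_eqVlt; apply/orP; left; apply/eqP; ring.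
(* These further levels make the remainders [q] and [t] a part of order [2 ^- n] of the image. *)
pose i := (M * n.+1)%N.
have lvl : (k + i <= (P + M * 2 + e).+2 * n)%N.
  have -> : ((P + M * 2 + e).+2 * n = n + P * n + (M * n + M * n) + (n + e * n))%N by ring.
  rewrite /k /i mulnS; apply: leq_trans (leq_addr _ _).
  by rewrite leq_add2l leq_add2r leq_pmulr.
apply: (tw_bound_mono lvl) => b.
have [q [cs [t [eW hq ht hcs]]]] := rfac (zn zeta i [:: b])
  (ex_intro _ i (ex_intro _ b (infix_refl _))).
set Lb := (lam zeta (k + i) [:: b]).
have hshort (x : seq letter) : (size x <= G)%N ->
    (lam zeta k x)%:R <= G%:R * r2 ^+ n * Lb%:R :> R.
  move=> hx; have h1 : (2 ^ n * lam zeta k x <= G * Lb)%N.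
    apply: leq_trans (_ : size x * Lb <= _)%N; last by rewrite leq_mul2r hx orbT.
    elim: x {hx} => [|a x IH]; first by rewrite lam_nil muln0.
    by rewrite lam_cons mulnDr mulSn leq_add// hM.
  have t0 : 0 < 2 ^+ n :> R by rewrite exprn_gt0.
  apply: le_trans (_ : G%:R * 2^-1 ^+ n * Lb%:R <= _).
    rewrite exprVn mulrAC ler_pdivlMr// -natrX -!natrM ler_nat mulnC.
    exact: h1.
  rewrite ler_wpM2r// ler_wpM2l//.
  by apply: lerXn2r; rewrite ?nnegrE ?(ltW r20)// invr_ge0.
rewrite znD eW !zn_cat !tw_cat.
apply: le_trans (normcD_le _ _) _; rewrite normcM normc_cis mul1r.
apply: le_trans (lerD (lexx _) (normcD_le _ _)) _; rewrite normcM normc_cis mul1r.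
have h1 : normc (tw F om (zn zeta k q)) <= G%:R * r2 ^+ n * Lb%:R.
  exact: le_trans (normc_tw F1 _ _) (hshort q hq).
have h2 : normc (tw F om (zn zeta k t)) <= G%:R * r2 ^+ n * Lb%:R.
  exact: le_trans (normc_tw F1 _ _) (hshort t ht).
have h3 := tw_flatten_le (fun v hv => hret v (hcs v hv)).
have h4 : (lam zeta k (flatten cs) <= Lb)%N.
  by rewrite /Lb lamD eW !lam_cat addnCA leq_addr.
have h5 : normc (tw F om (zn zeta k (flatten cs))) <=
    (K2 + 2 * pi * G%:R) * r2 ^+ n * Lb%:R.
  apply: le_trans h3 _; apply: ler_wpM2l; last by rewrite ler_nat.
  by apply: mulr_ge0; [rewrite addr_ge0// !mulr_ge0 | rewrite exprn_ge0// ltW].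
apply: le_trans (lerD h1 (lerD h5 h2)) _.
by rewrite /E le_eqVlt; apply/orP; left; apply/eqP; ring.
Qed.

(** Take [rho] above both [1 - kap] and [r]. In the resonant case the gain is ample, because
    [j < Q ^ j]. The lower bound on [rho] serves later to absorb boundary terms. *)
Lemma tw_bound_geometric : exists (Q : nat) (rho E : R),
  [/\ (1 < Q)%N, 2^-1 <= rho, rho < 1, 1 <= E &
  forall F, (forall a, normc (F a) <= 1) -> small_means zeta F ->
  forall om j, tw_bound zeta F om (Q ^ j) (E * rho ^+ j)].
Proof.
have [Q [kap [E [r [Q1 [k0 k1] E0 [r0 r1] hstep]]]]] := tw_bound_step.
have [rho [rhoh rho1 rhok rhor]] : exists rho : R,
    [/\ 2^-1 <= rho, rho < 1, 1 - kap <= rho & r <= rho].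
  have a1 : 1 - kap < 1 by rewrite ltrBlDr ltrDl.
  have a2 : 2^-1 < 1 :> R by rewrite invf_lt1 ?ltr1n.
  exists (Num.max 2^-1 (Num.max (1 - kap) r)).
  by split; rewrite ?gt_max ?a1 ?a2 ?r1// !le_max lexx ?orbT.
have rho0 : 0 < rho by apply: lt_le_trans rhoh; rewrite invr_gt0.
have [E' [E'1 EE']] : exists E' : R, 1 <= E' /\ E <= E'.
  by exists (1 + E); rewrite lerDl lerDr ler01.
have E'0 : 0 <= E' by apply: le_trans E'1.
exists Q, rho, E'; split => // F F1 hF om j.
wlog [om0 om1] : om / 0 <= om /\ om <= 1.
  move=> hw a; rewrite -(subrK (Num.floor om)%:~R om) tw_int; apply: hw; split.
    by rewrite subr_ge0 floor_le.
  by rewrite lerBlDl -[X in _ + X]/(1%:~R) -intrD ltW// floorD1_gt.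
elim: j => [|j IH].
  rewrite expr0 mulr1; apply: (tw_bound_le E'1).
  exact: tw_bound_mono (leq0n _) (tw_bound0 _ F1 _).
have Qj : (1 <= Q ^ j)%N by rewrite expn_gt0 (ltnW Q1).
have D0 : 0 <= E' * rho ^+ j by rewrite mulr_ge0// exprn_ge0// ltW.
rewrite expnS; have [h|h] := hstep F F1 hF om _ _ om0 om1 Qj D0 IH; apply: tw_bound_le h.
  by rewrite exprSr mulrA ler_wpM2l.
apply: ler_pM => //; first by rewrite exprn_ge0// ltW.
apply: le_trans (_ : rho ^+ (Q ^ j) <= _).
  by apply: lerXn2r; rewrite ?nnegrE ?(ltW r0) ?(ltW rho0).
by rewrite ler_wiXn2l ?(ltW rho0) ?(ltW rho1)// ltn_expl.
Qed.

Theorem tw_log_bound : exists K gam : R, [/\ 0 < K, 0 < gam &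
  forall F, (forall a, normc (F a) <= 1) -> small_means zeta F ->
  forall om w, lang zeta w -> (2 <= size w)%N ->
  normc (tw F om w) <= K * (size w)%:R * ln (size w)%:R `^ (- gam)].
Proof.
have [Q [rho [E [Q1 rhoh rho1 E1 hgeo]]]] := tw_bound_geometric.
have rho0 : 0 < rho by apply: lt_le_trans rhoh; rewrite invr_gt0.
have E0 : 0 <= E by apply: le_trans E1.
pose L := (maxlen zeta).+1.
have L1 : (1 < L)%N by rewrite ltnS maxlen_gt0.
have lnQ : 0 < ln Q%:R :> R by rewrite ln_gt0// ltr1n.
have lnL : 0 < ln L%:R :> R by rewrite ln_gt0// ltr1n.
have lnrho : ln rho < 0 by rewrite ln_lt0// rho0.
(* The exponent for which [Q ^ (- gam) = rho]. *)
pose gam : R := - ln rho / ln Q%:R.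
have gam0 : 0 < gam by rewrite divr_gt0// oppr_gt0.
pose A : R := 2 * Q%:R * ln L%:R.
have Q0 : 0 < Q%:R :> R by rewrite ltr0n (ltnW Q1).
have A0 : 0 < A by rewrite !mulr_gt0.
exists ((2 + E) * A `^ gam), gam; split => //.
  by rewrite mulr_gt0 ?powR_gt0// addr_gt0// (lt_le_trans ltr01).
move=> F F1 hF om w lw; set N := size w => N2.
have N0 : 0 < N%:R :> R by rewrite ltr0n (ltnW N2).
have lnN : 0 < ln N%:R :> R by rewrite ln_gt0// ltr1n.
have [j [hj hN]] : exists j, normc (tw F om w) <= (2 + E) * rho ^+ j * N%:R /\
    (N < L ^ (2 * Q ^ j.+1))%N.
  (* The least such index is written [j.+1]: then [L ^ (Q ^ j)], which bounds the remainders, is at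
     most the square root of [N]. If it is 0, the trivial bound suffices. *)
  have ex : exists j, (N < L ^ (2 * Q ^ j))%N.
    exists N; apply: leq_trans (ltn_expl N L1) _; rewrite leq_exp2l//.
    by apply: leq_trans (ltnW (ltn_expl N Q1)) _; rewrite leq_pmull.
  have [] := ex_minnP ex; case=> [|j] hj hmin.
    exists 0%N; split.
      rewrite mulr1; apply: le_trans (normc_tw F1 _ _) _.
      by rewrite ler_peMl// (le_trans E1)// lerDr.
    apply: leq_trans hj _; rewrite leq_exp2l// leq_mul2l /= leq_exp2l//.
  exists j; split => //.
  have {}hmin : (L ^ (2 * Q ^ j) <= N)%N.
    by rewrite leqNgt; apply/negP => /hmin; rewrite ltnn.
  have hB a : (lam zeta (Q ^ j) [:: a] <= L ^ (Q ^ j))%N.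
    by apply: leq_trans (lam_le_exp zeta _ a) _; rewrite leq_exp2r ?expn_gt0 ?(ltnW Q1).
  have [s [W [p [ew lW hs hp]]]] := lang_decomp zeta_subst hB lw.
  (* Reduces to [1 <= L ^ (Q ^ j) * rho ^+ j], which holds as [2 <= L] and [2^-1 <= rho]. *)
  have hLN : (L ^ (Q ^ j))%:R <= rho ^+ j * N%:R :> R.
    have t0 : 0 < (L ^ (Q ^ j))%:R :> R by rewrite ltr0n expn_gt0 (ltnW L1).
    rewrite -(ler_pM2l t0); apply: le_trans (_ : N%:R <= _).
      by rewrite -natrM -expnD addnn -mul2n ler_nat.
    rewrite mulrA ler_peMl// natrX.
    apply: le_trans (_ : 2 ^+ j * 2^-1 ^+ j <= _).
      by rewrite -exprMn divff// expr1n.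
    apply: ler_pM; rewrite ?exprn_ge0 ?invr_ge0//; last first.
      by apply: lerXn2r; rewrite ?nnegrE ?invr_ge0 ?(ltW rho0).
    apply: le_trans (_ : L%:R ^+ j <= _).
      by apply: lerXn2r; rewrite ?nnegrE// ler_nat.
    by rewrite ler_weXn2l ?ler1n ?(ltnW L1)// ltnW// ltn_expl.
  have szN : (size s)%:R + (lam zeta (Q ^ j) W)%:R + (size p)%:R = N%:R :> R.
    by rewrite /N ew !size_cat !natrD addrA.
  rewrite ew !tw_cat.
  apply: le_trans (normcD_le _ _) _; rewrite normcM normc_cis mul1r.
  apply: le_trans (lerD (lexx _) (normcD_le _ _)) _; rewrite normcM normc_cis mul1r.
  have hb (x : seq letter) : (size x <= L ^ (Q ^ j))%N -> normc (tw F om x) <= rho ^+ j * N%:R.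
    by move=> hx; apply: le_trans (normc_tw F1 _ _) (le_trans _ hLN); rewrite ler_nat.
  have hm := tw_bound_word W (hgeo F F1 hF om j).
  have hm2 : E * rho ^+ j * (lam zeta (Q ^ j) W)%:R <= E * rho ^+ j * N%:R.
    apply: ler_wpM2l; first by rewrite mulr_ge0// exprn_ge0// ltW.
    by rewrite -szN -addrA addrCA lerDl addr_ge0.
  apply: le_trans (lerD (hb s hs) (lerD (le_trans hm hm2) (hb p hp))) _.
  by rewrite le_eqVlt; apply/orP; left; apply/eqP; ring.
apply: le_trans hj _.
rewrite -!mulrA ler_wpM2l//; first by rewrite addr_ge0.
rewrite mulrCA [leLHS]mulrC ler_wpM2l//.
have lnle : ln (ln N%:R) <= ln A + j%:R * ln Q%:R.
  rewrite mulr_natl -lnXn// -lnM ?posrE ?exprn_gt0// ler_ln ?posrE ?mulr_gt0 ?exprn_gt0//.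
  apply: le_trans (_ : ln ((L ^ (2 * Q ^ j.+1))%:R : R) <= _).
    by rewrite ler_ln ?posrE// ?ltr0n ?expn_gt0 ?(ltnW L1)// ler_nat ltnW.
  rewrite natrX lnXn ?ltr0n ?(ltnW L1)// -[leLHS]mulr_natl natrM natrX exprS /A.
  by rewrite le_eqVlt; apply/orP; left; apply/eqP; ring.
rewrite /powR !gt_eqF//= -expRD -(lnK (x := rho ^+ j)) ?posrE ?exprn_gt0//.
rewrite ler_expR lnXn// -[leLHS]mulr_natl.
have -> : ln rho = - gam * ln Q%:R by rewrite /gam mulNr divfK ?opprK// gt_eqF.
have := ler_wpM2l (ltW gam0) lnle; rewrite mulrDr => h.
move: h; move: (ln (ln N%:R)) (ln A) (ln Q%:R) (gam) (j%:R : R) => x1 x2 x3 x4 x5 h.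
by move: h; rewrite !mulNr mulrN mulrCA; lra.
Qed.

End LogDecay.

(** * Discrete Fourier transform *)

Section DiscreteFourier.
Variable R : realType.

Lemma normc_sqrC (x : R[i]) : ((normc x ^+ 2)%:C)%C = x * conjc x.
Proof.
rewrite sqr_normcE; case: x => a b; apply/eqP; rewrite eq_complex /=.
by rewrite mulrN opprK -!expr2 eqxx/= mulrN (mulrC b) addNr.
Qed.

Lemma conjcM (x y : R[i]) : conjc (x * y) = conjc x * conjc y.
Proof. exact: (rmorphM (@conjc R)). Qed.

Lemma conjc_sum (I : Type) (r : seq I) (P : pred I) (f : I -> R[i]) :
  conjc (\sum_(i <- r | P i) f i) = \sum_(i <- r | P i) conjc (f i).
Proof. exact: (raddf_sum (@conjc R)). Qed.

Variable M : nat.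
Hypothesis M_gt0 : (0 < M)%N.
Notation e t := (cis (t / M%:R : R)).

Lemma root_orthogonal (n m : nat) : (n < M)%N -> (m < M)%N ->
  \sum_(j < M) e ((n%:R - m%:R) * j%:R) = (M * (n == m))%:R.
Proof.
move=> hn hm; have M0 : (0 : R) < M%:R by rewrite ltr0n.
have [->|nm] := eqVneq n m.
  rewrite muln1 (eq_bigr (fun=> 1)) => [|j _]; last by rewrite subrr !mul0r cis0.
  by rewrite sumr_const card_ord.
rewrite muln0; pose z := e (n%:R - m%:R).
have zE (j : 'I_M) : e ((n%:R - m%:R) * j%:R) = z ^+ j.
  by rewrite -cis_natM; congr cis; ring.
rewrite (eq_bigr _ (fun j _ => zE j)).
have z1 : z != 1.
  have step (p q : nat) : (p < q)%N -> (q < M)%N -> e (q%:R - p%:R) != 1.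
    move=> pq qM; apply: cis_neq1.
      by rewrite divr_gt0// subr_gt0 ltr_nat.
    by rewrite ltr_pdivrMr// mul1r ltrBlDr ltr_wpDr// ltr_nat.
  rewrite /z; have [lt|gt|h] := ltngtP n m; last by rewrite h eqxx in nm.
  - by rewrite -opprB mulNr cisN invr_eq1 step.
  - exact: step.
have := subrX1 z M; rewrite -cis_natM mulrCA divff ?gt_eqF// mulr1.
rewrite cisD cisN -[n%:R]/(n%:~R) -[m%:R]/(m%:~R) !cis_int invr1 mulr1 subrr.
by move/esym/eqP; rewrite mulf_eq0 subr_eq0 (negPf z1)/= => /eqP.
Qed.

Lemma parseval (h : nat -> R[i]) :
  \sum_(m < M) normc (\sum_(j < M) h j * e (m%:R * j%:R)) ^+ 2 =
  M%:R * \sum_(j < M) normc (h j) ^+ 2.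
Proof.
apply: (@complexI R); rewrite rmorphM rmorph_nat !rmorph_sum/= mulr_sumr.
under eq_bigr => m _ do rewrite normc_sqrC conjc_sum mulr_sumr.
rewrite exchange_big/=; apply: eq_bigr => k _.
under eq_bigr => m _ do rewrite mulr_suml.
rewrite exchange_big/= (bigD1 k)//= [X in _ + X]big1 ?addr0 => [|j jk].
- under eq_bigr => m _.
    rewrite conjcM conjc_cis mulrACA -cisD subrr cis0 mulr1 -normc_sqrC.
    over.
  by rewrite sumr_const card_ord mulr_natl.
- under eq_bigr => m _.
    rewrite conjcM conjc_cis mulrACA -cisD.
    have -> : m%:R * j%:R / M%:R - m%:R * k%:R / M%:R =
      (j%:R - k%:R) * m%:R / M%:R :> R by ring.
    over.
  rewrite -mulr_sumr root_orthogonal//.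
  have -> : (nat_of_ord j == k) = false by apply/eqP => /val_inj h1; rewrite h1 eqxx in jk.
  by rewrite muln0 mulr0.
Qed.

Lemma parseval_conj (h : nat -> R[i]) :
  \sum_(m < M) normc (\sum_(j < M) h j * e (- (m%:R * j%:R))) ^+ 2 =
  M%:R * \sum_(j < M) normc (h j) ^+ 2.
Proof.
rewrite -[in RHS](eq_bigr _ (fun (j : 'I_M) _ => congr1 (fun x => x ^+ 2) (normcJ_eq (h j)))).
rewrite -(parseval (fun j => conjc (h j))); apply: eq_bigr => m _.
rewrite -normcJ_eq conjc_sum; congr (normc _ ^+ 2); apply: eq_bigr => j _.
by rewrite conjcM conjc_cis mulNr opprK.
Qed.

End DiscreteFourier.

(** Padding [c] with zeros up to length [2 * N] removes wrap-around, as [k + m < 2 * N]. The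
    transform of the correlation is then [A * C], with [A] bounded by [B], and Parseval applies on
    both sides. *)
Lemma convolution_bound (R : realType) (N : nat) (a c : nat -> R[i]) (B : R) :
  (0 < N)%N -> 0 <= B ->
  (forall om, normc (\sum_(n < 2 * N) a n * cis (om * n%:R)) <= B) ->
  \sum_(m < N) normc (\sum_(k < N) c k * a (k + m)%N) ^+ 2 <=
    B ^+ 2 * \sum_(k < N) normc (c k) ^+ 2.
Proof.
move=> N0 B0 hB; set M := (2 * N)%N; have M0 : (0 < M)%N by rewrite muln_gt0.
have MR : (0 : R) < M%:R by rewrite ltr0n.
have NM : (N <= M)%N by rewrite leq_pmull.
pose c' k := if (k < N)%N then c k else 0.
pose A j := \sum_(n < M) a n * cis (n%:R * j%:R / M%:R : R).
pose C j := \sum_(k < M) c' k * cis (- (k%:R * j%:R) / M%:R : R).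
pose b m := \sum_(j < M) A j * C j * cis (- (m%:R * j%:R) / M%:R : R).
have sumc (f : nat -> R) : (forall k, (N <= k)%N -> f k = 0) ->
    \sum_(k < M) f k = \sum_(k < N) f k.
  move=> f0; rewrite (big_ord_widen M f NM) [RHS]big_mkcond; apply: eq_bigr => k _.
  by case: ltnP => // /f0.
have bE m : (m < N)%N -> b m = M%:R * \sum_(k < N) c k * a (k + m)%N.
  move=> mN; rewrite /b.
  have step (j : 'I_M) : A j * C j * cis (- (m%:R * j%:R) / M%:R) =
      \sum_(k < M) \sum_(n < M) c' k * (a n * cis ((n%:R - (k + m)%:R) * j%:R / M%:R)).
    rewrite [A j * _]mulrC /C mulr_suml mulr_suml; apply: eq_bigr => k _.
    rewrite /A mulr_sumr mulr_suml; apply: eq_bigr => n _.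
    have -> : (n%:R - (k + m)%:R) * j%:R / M%:R =
        - (k%:R * j%:R) / M%:R + n%:R * j%:R / M%:R + - (m%:R * j%:R) / M%:R :> R.
      by rewrite natrD; ring.
    by rewrite !cisD; ring.
  rewrite (eq_bigr _ (fun j _ => step j)) exchange_big/=.
  rewrite mulr_sumr (big_ord_widen M (fun k => M%:R * (c k * a (k + m)%N)) NM).
  rewrite [RHS]big_mkcond/=; apply: eq_bigr => k _; rewrite exchange_big/= /c'.
  case: ltnP => kN; last by rewrite big1// => n _; rewrite big1// => j _; rewrite mul0r.
  have kmM : (k + m < M)%N
    by apply: leq_trans (_ : N + N <= M)%N; [rewrite -addnS leq_add// ltnW | rewrite /M; lia].
  have sumj (n : 'I_M) : \sum_(j < M) c k * (a n * cis ((n%:R - (k + m)%:R) * j%:R / M%:R)) =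
      c k * a n * (M * (nat_of_ord n == k + m)%N)%:R.
    by rewrite -(root_orthogonal R M0)// mulr_sumr; apply: eq_bigr => j _; rewrite mulrA.
  rewrite (eq_bigr _ (fun n _ => sumj n)) (bigD1 (Ordinal kmM))//= big1 ?addr0 => [|n nk].
    by rewrite eqxx muln1; ring.
  have -> : (nat_of_ord n == k + m)%N = false.
    by apply/eqP => h; move/eqP: nk; apply; apply/val_inj.
  by rewrite muln0 mulr0.
have M2 : 0 < M%:R ^+ 2 :> R by rewrite exprn_gt0.
rewrite -(ler_pM2l M2).
have -> : M%:R ^+ 2 * (\sum_(m < N) normc (\sum_(k < N) c k * a (k + m)%N) ^+ 2) =
    \sum_(m < N) normc (b m) ^+ 2.
  rewrite mulr_sumr; apply: eq_bigr => m _.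
  by rewrite bE// normcM normc_nat exprMn.
apply: le_trans (_ : \sum_(m < M) normc (b m) ^+ 2 <= _).
  rewrite (big_ord_widen M (fun m => normc (b m) ^+ 2) NM).
  rewrite [leRHS](bigID (fun i : 'I_M => (i < N)%N))/=.
  by rewrite lerDl sumr_ge0// => i _; rewrite sqr_ge0.
have := parseval_conj M0 (fun j => A j * C j).
under eq_bigr => m _ do under eq_bigr => j _ do rewrite -mulNr.
rewrite /b => ->.
have := parseval_conj M0 c'.
rewrite (sumc (fun k => normc (c' k) ^+ 2)) => [hC|k kN]; last first.
  by rewrite /c'; case: ltnP kN => // _ _; rewrite normc0 expr0n.
rewrite expr2 -mulrA ler_pM2l// mulrCA.
have -> : M%:R * \sum_(k < N) normc (c k) ^+ 2 = \sum_(j < M) normc (C j) ^+ 2.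
  have -> : \sum_(k < N) normc (c k) ^+ 2 = \sum_(k < N) normc (c' k) ^+ 2.
    by apply: eq_bigr => k _; rewrite /c' ltn_ord.
  rewrite -hC; apply: eq_bigr => j _; congr (normc _ ^+ 2).
  by apply: eq_bigr => k _; congr (_ * cis (- _ / _)); rewrite mulrC.
rewrite mulr_sumr ler_sum// => j _.
rewrite normcM exprMn ler_wpM2r ?sqr_ge0// lerXn2r ?nnegrE ?normc_ge0//.
rewrite (_ : A j = \sum_(n < M) a n * cis (j%:R / M%:R * n%:R))//.
by apply: eq_bigr => n _; congr (_ * cis _); ring.
Qed.

(** * The measure-preserving system *)

Section ProductContinuity.
Import ArrowAsProduct.

Lemma prod_continuous (I : eqType) (K : I -> topologicalType) (S : topologicalType)
    (f : S -> forall i, K i) :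
  (forall i, continuous (fun x => f x i)) -> continuous (f : S -> prod_topology K).
Proof.
move=> h x; apply/cvg_sup => n A [B [[C oC <-] CB sA]].
by apply: (filterS sA); apply: (h n x); exact: open_nbhs_nbhs.
Qed.

End ProductContinuity.

Section ShiftSpace.
Variable d : nat.
Notation letter := 'I_d.+2.
Implicit Types (x : full_shift d).

Definition word_at x (i : int) n : seq letter := mkseq (fun k => x (i + k%:Z)) n.

Lemma word_atS x i n : word_at x i n.+1 = rcons (word_at x i n) (x (i + n%:Z)).
Proof. exact: mkseqS. Qed.

Lemma size_word_at x i n : size (word_at x i n) = n.
Proof. exact: size_mkseq. Qed.

Lemma iter_shiftE k x n : iter k (@left_shift d) x n = x (n + k%:Z).
Proof.
elim: k n => [|k IH] n /=; first by rewrite addr0.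
by rewrite /left_shift IH -addrA -intS.
Qed.

Lemma coord_continuous n :
  continuous ((fun x => x n) : full_shift d -> discrete_topology letter).
Proof.
move=> x.
exact: (@proj_continuous int (fun=> (discrete_topology letter : topologicalType)) n x).
Qed.

Lemma open_coord n (B : set letter) : open [set x : full_shift d | B (x n)].
Proof.
have o : open (B : set (discrete_topology letter)) by exact: discrete_open.
exact: ((continuousP _).1 (@coord_continuous n) B o).
Qed.

Lemma open_word n i (B : set (seq letter)) :
  open [set x : full_shift d | B (word_at x i n)].
Proof.
elim: n B => [|n IH] B.
  have [b|nb] := pselect (B [::]).
    by rewrite (_ : [set x | _] = setT) ?predeqE//; exact: openT.
  by rewrite (_ : [set x | _] = set0) ?predeqE//; exact: open0.
rewrite (_ : [set x | _] = \bigcup_(a in [set: letter])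
    ([set x : full_shift d | x (i + n%:Z) = a] `&`
     [set x | B (rcons (word_at x i n) a)])); last first.
  apply/seteqP; split=> x.
    by rewrite /mkset word_atS => Bx; exists (x (i + n%:Z)).
  by move=> [a _ [/= <-]]; rewrite word_atS.
apply: bigcup_open => a _; apply: openI; first exact: (open_coord _ [set a]).
exact: (IH [set w | B (rcons w a)]).
Qed.

Lemma open_measurable_shift (A : set (full_shift d)) : open A -> measurable A.
Proof. by move=> oA; exact: sub_sigma_algebra. Qed.

Lemma measurable_left_shift : measurable_fun setT (@left_shift d).
Proof.
apply: (@measurability _ _ _ _ _ _ (@open (full_shift d))) => // _ [A oA <-].
rewrite setTI; apply: open_measurable_shift.
have c : continuous (@left_shift d).
  have Q := @prod_continuous int (fun=> (discrete_topology letter : topologicalType))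
    (full_shift d) (@left_shift d).
  by apply: Q => n; exact: coord_continuous.
exact: ((continuousP _).1 c A oA).
Qed.

Variable zeta : letter -> seq letter.
Notation X := (subst_space zeta).

(** The complement is a countable union of open sets, one for each position and length of a
    forbidden word. *)
Lemma measurable_subst_space : measurable X.
Proof.
rewrite (_ : X = ~` (\bigcup_(i in [set: int]) \bigcup_(n in [set: nat])
    [set x | ~ lang zeta (word_at x i n)])); last first.
  apply/seteqP; split=> x.
    by move=> Xx [i _ [n _]]; apply; exact: Xx.
  move=> nx i n; apply: contrapT => h; apply: nx; exists i => //; exists n => //.
apply/measurableC/countable_bigcupT_measurable => // i.
apply/countable_bigcupT_measurable => // n.
apply: open_measurable_shift; exact: (open_word _ _ [set w | ~ lang zeta w]).
Qed.

Lemma subst_space_word x i n : X x -> lang zeta (word_at x i n).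
Proof. exact. Qed.

Lemma word_at_shift x i n : word_at (left_shift x) i n = word_at x (i + 1) n.
Proof. by apply: eq_map => k; rewrite /left_shift addrAC. Qed.

Lemma preimage_subst_space : @left_shift d @^-1` X = X.
Proof.
apply/seteqP; split=> x Xx i n.
  have := subst_space_word (i - 1) n Xx.
  by rewrite word_at_shift subrK.
by have := subst_space_word (i + 1) n Xx; rewrite -word_at_shift.
Qed.

End ShiftSpace.

Section RealIntegral.
Context dd (T : measurableType dd) (R : realType).
Variable mu : probability T R.
Variable X : set T.
Hypothesis mX : measurable X.
Hypothesis muX : mu X = 1%E.

Lemma probability_capr (A : set T) : measurable A -> mu (A `&` X) = mu A.
Proof.
move=> mA; have XC : mu (~` X) = 0%E by rewrite probability_setC// muX subee.
rewrite [RHS](measureDI mu mA mX) [X in (X + _)%E](_ : _ = 0%E) ?add0e//.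
apply: (subset_measure0 _ _ _ XC); [exact: measurableD | exact: measurableC | by move=> x []].
Qed.

Lemma Rintegral_sum I (r : seq I) (f : I -> T -> R) :
  (forall i, mu.-integrable X (EFin \o f i)) ->
  mu.-integrable X (EFin \o (fun x => \sum_(i <- r) f i x)) /\
  \int[mu]_(x in X) (\sum_(i <- r) f i x) = \sum_(i <- r) \int[mu]_(x in X) f i x.
Proof.
move=> hf; elim: r => [|i r [IHi IH]].
  split; first by under eq_fun do rewrite big_nil; exact: integrable0.
  rewrite big_nil; under eq_Rintegral do rewrite big_nil.
  by rewrite Rintegral_cst// mul0r.
split; last by rewrite big_cons; under eq_Rintegral do rewrite big_cons; rewrite RintegralD// IH.
rewrite (_ : _ \o _ = (EFin \o f i) \+ (EFin \o (fun x => \sum_(j <- r) f j x)%R))%E; last first.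
  by apply/funext => x /=; rewrite big_cons.
exact: integrableD.
Qed.

Lemma integrable_of_bounded (f : T -> R) (M : R) : measurable_fun X f ->
  (forall x, X x -> `|f x| <= M) -> mu.-integrable X (EFin \o f).
Proof.
move=> mf hM; apply: measurable_bounded_integrable => //.
  by rewrite (le_lt_trans (probability_le1 mu mX))// ltry.
exists M; split; first exact: num_real.
by move=> y My x Xx /=; rewrite (le_trans (hM _ Xx))// ltW.
Qed.

Lemma simple_mean (I : finType) (A : I -> set T) (phi : I -> R) :
  (forall i, measurable (A i)) ->
  mu.-integrable X (EFin \o (fun x => \sum_i phi i * \1_(A i) x)) /\
  \int[mu]_(x in X) (\sum_i phi i * \1_(A i) x) = \sum_i phi i * fine (mu (A i)).
Proof.
move=> mA.
have h1 i : mu.-integrable X (EFin \o \1_(A i)).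
  apply: (@integrable_of_bounded _ 1); first exact: measurable_indic.
  by move=> x _; rewrite indicE; case: (_ \in _); rewrite ?normr1 ?normr0.
have h i : mu.-integrable X (EFin \o (fun x => phi i * \1_(A i) x)).
  by rewrite (_ : _ \o _ = (fun x => (phi i)%:E * (EFin \o \1_(A i)) x)%E)//; exact: integrableZl.
have [hi ->] := Rintegral_sum (index_enum I) h; split => //.
apply: eq_bigr => i _; rewrite RintegralZl// /Rintegral.
rewrite integral_indic//; congr (_ * fine _); exact: probability_capr.
Qed.

Lemma Rintegral_invariant (S : T -> T) (f : T -> R) :
  measurable_fun setT S -> S @^-1` X = X -> invariant_measure mu S ->
  measurable_fun X f -> (forall x, X x -> 0 <= f x) ->
  \int[mu]_(x in X) f (S x) = \int[mu]_(x in X) f x.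
Proof.
move=> mS SX inv mf f0; congr fine.
have h := ge0_integral_pushforward mS mu mX (f := EFin \o f).
rewrite SX in h; rewrite -h.
- by apply: eq_measure_integral => A mA _; exact: inv.
- exact/measurable_EFinP.
- by move=> x; rewrite inE => Xx; rewrite lee_fin f0.
Qed.

End RealIntegral.

Section Correlations.
Variables (R : realType) (d : nat) (zeta : 'I_d.+2 -> seq 'I_d.+2).
Notation letter := 'I_d.+2.
Notation X := (subst_space zeta).
Variable mu : probability (full_shift d) R.
Hypothesis muX : mu X = 1%E.
Hypothesis mu_inv : invariant_measure mu (@left_shift d).
Hypothesis mu_wm : weakly_mixing mu (@left_shift d).
Let mX : measurable X := measurable_subst_space zeta.

Definition cyl (n : int) (a : letter) : set (full_shift d) := [set x | x n = a].

Lemma measurable_cyl n a : measurable (cyl n a).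
Proof. by apply: open_measurable_shift; exact: (open_coord n [set a]). Qed.

Definition freq a : R := fine (mu (cyl 0 a)).
(** Covariance of the indicators of two letters at positions [n] and [m]. *)
Definition cor (n m : nat) (u : letter * letter) : R :=
  fine (mu (cyl n u.1 `&` cyl m u.2)) - freq u.1 * freq u.2.

Lemma cor_shift k n m u : cor (n + k) (m + k) u = cor n m u.
Proof.
elim: k => [|k IH]; first by rewrite !addn0.
rewrite -IH /cor; congr (fine _ - _).
rewrite -[RHS]mu_inv; last by apply: measurableI; exact: measurable_cyl.
have e (p : nat) a : cyl p.+1 a = @left_shift d @^-1` cyl p a by rewrite -addn1 PoszD.
by rewrite !addnS !e.
Qed.

Definition swap_pair (u : letter * letter) := (u.2, u.1).

Lemma cor_swap n m u : cor n m u = cor m n (swap_pair u).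
Proof. by rewrite /cor /swap_pair/= setIC mulrC. Qed.

Definition total_cor k : R := \sum_u `|cor k 0 u|.

Lemma total_corE n m : \sum_u `|cor n m u| = total_cor `|n - m|%N.
Proof.
have le p q : (q <= p)%N -> \sum_u `|cor p q u| = total_cor (p - q).
  move=> qp; apply: eq_bigr => u _; by have := cor_shift q (p - q) 0 u; rewrite subnK// add0n => ->.
have [mn|/ltnW nm] := leqP m n; first by rewrite le// distnEl.
rewrite distnEr// -(le _ _ nm).
rewrite (reindex swap_pair)/=; last by exists swap_pair => -[].
by apply: eq_bigr => u _; rewrite cor_swap; case: u.
Qed.

Lemma total_cor_mean eps : 0 < eps -> exists N0, forall N, (N0 <= N)%N ->
  \sum_(k < N) total_cor k <= eps * N%:R.
Proof.
move=> eps0; have cvg0 : (fun N => N%:R^-1 * \sum_(k < N) total_cor k) @ \oo --> (0 : R).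
  rewrite (_ : (fun N => _) = (fun N => \sum_u N%:R^-1 * \sum_(k < N) `|cor k 0 u|)); last first.
    apply/funext => N; rewrite -mulr_sumr; congr (_ * _).
    by rewrite exchange_big.
  elim: (index_enum _) => [|u r IH]; first by under eq_fun do rewrite big_nil; exact: cvg_cst.
  under eq_fun do rewrite big_cons.
  suff hu : (fun N => N%:R^-1 * \sum_(k < N) `|cor k 0 u|) @ \oo --> (0 : R).
    by have h := cvgD hu IH; rewrite addr0 in h; exact: h.
  rewrite (_ : (fun N => _) = (fun N => N%:R^-1 * \sum_(k < N)
      `|fine (mu (iter k (@left_shift d) @^-1` cyl 0 u.1 `&` cyl 0 u.2)) -
        fine (mu (cyl 0 u.1)) * fine (mu (cyl 0 u.2))|)).
    exact: mu_wm (measurable_cyl 0 u.1) (measurable_cyl 0 u.2).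
  apply/funext => N; congr (_ * _); apply: eq_bigr => k _.
  rewrite /cor (_ : cyl k u.1 = iter k (@left_shift d) @^-1` cyl 0 u.1)//.
  by apply/seteqP; split=> x; rewrite /cyl /= iter_shiftE add0r.
have /cvgrPdist_le/(_ eps eps0)[N0 _ h] := cvg0.
exists N0.+1 => N lt; have N0N : (0 : R) < N%:R by rewrite ltr0n; case: N lt.
have := h N (ltnW lt); rewrite /= sub0r normrN; move/(le_trans (ler_norm _)).
by rewrite mulrC ler_pdivrMr.
Qed.

(** Each distance to [n] is attained at most once on either side. *)
Lemma sum_dist (f : nat -> R) n N : (forall k, 0 <= f k) -> (n < N)%N ->
  \sum_(m < N) f `|n - m|%N <= 2 * \sum_(k < N) f k.
Proof.
move=> f0 nN.
have mono M : (M <= N)%N -> \sum_(k < M) f k <= \sum_(k < N) f k.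
  move=> MN; rewrite (big_ord_widen N f MN) [leRHS](bigID (fun k : 'I_N => (k < M)%N))/=.
  by rewrite lerDl sumr_ge0.
rewrite -(big_mkord xpredT (fun m => f `|n - m|%N)) (big_cat_nat (n := n.+1))//=.
rewrite mulr_natl mulr2n; apply: lerD.
  rewrite big_mkord (reindex_inj rev_ord_inj)/=.
  apply: le_trans (mono n.+1 nN); rewrite ler_sum// => k _.
  have kn : (k <= n)%N by rewrite -ltnS.
  by rewrite subSS distnEl ?leq_subr// subKn.
rewrite -{1}[n.+1]add0n big_addn big_mkord.
apply: le_trans (_ : \sum_(k < (N - n.+1).+1) f k <= _); last first.
  by apply: mono; rewrite subnSK// leq_subr.
rewrite big_ord_recl ler_wpDl// ler_sum// => k _.
rewrite addnC distnEr; last exact: leq_trans (leqnSn n) (leq_addr _ _).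
by rewrite addSn -addnS addKn.
Qed.

Lemma tw_word_at (F : letter -> R[i]) om x i N :
  tw F om (word_at x i N) = \sum_(n < N) F (x (i + n%:Z)) * cis (om * n%:R).
Proof.
elim: N => [|N IH]; first by rewrite big_ord0.
rewrite word_atS -cats1 tw_cat IH big_ord_recr/= size_word_at; congr (_ + _).
by rewrite mulr0 addr0 mulrC.
Qed.

Lemma sqr_normc_sum (I : finType) (z : I -> R[i]) :
  normc (\sum_i z i) ^+ 2 = \sum_i \sum_j complex.Re (z i * conjc (z j)).
Proof.
rewrite sqr_normc_Re conjc_sum mulr_suml (raddf_sum (@complex.Re R)).
apply: eq_bigr => i _; rewrite mulr_sumr.
exact: (raddf_sum (@complex.Re R)).
Qed.

Lemma letter_mean (phi : letter -> R) n :
  mu.-integrable X (EFin \o (fun x => phi (x n))) /\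
  \int[mu]_(x in X) phi (x n) = \sum_a phi a * fine (mu (cyl n a)).
Proof.
have [h1 h2] := simple_mean mX muX phi (measurable_cyl n).
have e x : phi (x n) = \sum_a phi a * \1_(cyl n a) x.
  rewrite (bigD1 (x n))//= big1 => [|a ax]; first by rewrite indicE mem_set// mulr1 addr0.
  by rewrite indicE memNset ?mulr0// => /esym h; rewrite h eqxx in ax.
by split; [under eq_fun do rewrite e | under eq_Rintegral do rewrite e].
Qed.

Lemma pair_mean (phi : letter * letter -> R) n m :
  mu.-integrable X (EFin \o (fun x => phi (x n, x m))) /\
  \int[mu]_(x in X) phi (x n, x m) =
    \sum_u phi u * fine (mu (cyl n u.1 `&` cyl m u.2)).
Proof.
have mA (u : letter * letter) : measurable (cyl n u.1 `&` cyl m u.2).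
  by apply: measurableI; exact: measurable_cyl.
have [h1 h2] := simple_mean mX muX phi mA.
have e x : phi (x n, x m) = \sum_u phi u * \1_(cyl n u.1 `&` cyl m u.2) x.
  rewrite (bigD1 (x n, x m))//= big1 => [|u ux]; first by rewrite indicE mem_set// mulr1 addr0.
  rewrite indicE memNset ?mulr0// => -[/= h1' h2']; move/eqP: ux; apply.
  by rewrite h1' h2'; case: u {h1' h2'}.
by split; [under eq_fun do rewrite e | under eq_Rintegral do rewrite e].
Qed.

(** Expand the square. The product of the letter frequencies contributes nothing since [F] has mean
    0, and the coefficients of the covariances have modulus at most 1, whatever [om] is. *)
Lemma mean_square_bound (F : letter -> R[i]) om N :
  (forall a, normc (F a) <= 1) -> \sum_a F a * ((freq a)%:C)%C = 0 ->
  mu.-integrable X (EFin \o (fun x => normc (tw F om (word_at x 0 N)) ^+ 2)) /\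
  \int[mu]_(x in X) normc (tw F om (word_at x 0 N)) ^+ 2 <=
    N%:R * (2 * \sum_(k < N) total_cor k).
Proof.
move=> F1 F0.
pose phi (n m : nat) (u : letter * letter) : R :=
  complex.Re ((F u.1 * cis (om * n%:R)) * conjc (F u.2 * cis (om * m%:R))).
have phi1 n m u : `|phi n m u| <= 1.
  apply: le_trans (ge_normc_Re _) _.
  by rewrite normcM normcJ_eq !normcM !normc_cis !mulr1 mulr_ile1// normc_ge0.
have sqE x : normc (tw F om (word_at x 0 N)) ^+ 2 =
    \sum_(n < N) \sum_(m < N) phi n m (x n, x m).
  rewrite tw_word_at sqr_normc_sum; apply: eq_bigr => n _.
  by rewrite (eq_bigr (fun m : 'I_N => phi n m (x n, x m))).
have phi0 n m : \sum_u phi n m u * (freq u.1 * freq u.2) = 0.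
  pose z (a : letter) (n : nat) := F a * cis (om * n%:R) * ((freq a)%:C)%C.
  have z0 k : \sum_a z a k = 0.
    rewrite -[RHS](mulr0 (cis (om * k%:R))) -[in RHS]F0 mulr_sumr; apply: eq_bigr => a _.
    by rewrite /z; ring.
  rewrite (eq_bigr (fun u : letter * letter => complex.Re (z u.1 n * conjc (z u.2 m)))).
    rewrite -(raddf_sum (@complex.Re R)) -(pair_bigA _ (fun a b => z a n * conjc (z b m)))/=.
    under eq_bigr => a _ do rewrite -mulr_sumr -conjc_sum z0 conjc0 mulr0.
    by rewrite big1.
  move=> u _; rewrite /phi /z !conjcM conjc_real.
  move: (F u.1 * _) (conjc (F u.2)) (conjc (cis _)) => x y w.
  have -> : x * ((freq u.1)%:C)%C * (y * w * ((freq u.2)%:C)%C) =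
    x * (y * w) * ((freq u.1 * freq u.2)%:C)%C by rewrite rmorphM/=; ring.
  by move: (x * (y * w)) (freq _ * _) => [p q] r /=; rewrite mulr0 subr0.
have H1 n := Rintegral_sum mX (index_enum 'I_N)
  (fun m : 'I_N => (pair_mean (phi n m) n m).1).
have [hI hE] := Rintegral_sum mX (index_enum 'I_N) (fun n : 'I_N => (H1 n).1).
split; first by under eq_fun do rewrite sqE.
under eq_Rintegral do rewrite sqE.
rewrite hE mulr_natl -[X in _ <= _ *+ X]card_ord -sumr_const; apply: ler_sum => n _.
rewrite (H1 n).2.
apply: le_trans (sum_dist (f := total_cor) _ (ltn_ord n)); last first.
  by move=> k; apply: sumr_ge0.
apply: ler_sum => m _; rewrite (pair_mean (phi n m) n m).2 -total_corE.
rewrite (_ : \sum_u _ = \sum_u phi n m u * cor n m u +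
    \sum_u phi n m u * (freq u.1 * freq u.2)); last first.
  by rewrite -big_split/=; apply: eq_bigr => u _; rewrite -mulrDr subrK.
rewrite phi0 addr0; apply: ler_sum => u _; apply: le_trans (ler_norm _) _.
by rewrite normrM ler_piMl.
Qed.

(** If no word of length [N] were suitable, the square would exceed [(eps * N) ^+ 2] at every point
    of [X], whereas its mean is at most half of that for large [N]. *)
Lemma weak_mixing_small_means (F : letter -> R[i]) :
  (forall a, normc (F a) <= 1) -> \sum_a F a * ((freq a)%:C)%C = 0 ->
  small_means zeta F.
Proof.
move=> F1 F0 om eps eps0.
have e0 : 0 < eps ^+ 2 / 4 by rewrite divr_gt0// exprn_gt0.
have [N0 hN0] := total_cor_mean e0.
exists N0.+1 => N lt; have N_gt0 : (0 : R) < N%:R by rewrite ltr0n; case: N lt.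
apply: contrapT => nw.
have big x : X x -> eps * N%:R < normc (tw F om (word_at x 0 N)).
  move=> Xx; rewrite ltNge; apply/negP => le; apply: nw.
  by exists (word_at x 0 N); rewrite size_word_at; split => //; exact: subst_space_word.
have [hI hE] := mean_square_bound om N F1 F0.
have cI : mu.-integrable X (EFin \o (fun=> (eps * N%:R) ^+ 2)).
  by apply: (@integrable_of_bounded _ _ _ _ _ mX _ `|(eps * N%:R) ^+ 2|);
    first exact: measurable_cst.
have := le_Rintegral mX cI hI.
have -> : \int[mu]_(x in X) (eps * N%:R) ^+ 2 = (eps * N%:R) ^+ 2.
  by rewrite Rintegral_cst// [fine _](congr1 fine muX) mulr1.
have hX x : X x -> (eps * N%:R) ^+ 2 <= normc (tw F om (word_at x 0 N)) ^+ 2.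
  by move=> Xx; apply: lerXn2r; rewrite ?nnegrE ?normc_ge0 ?mulr_ge0 ?ltW// big.
move=> /(_ hX) h; have := le_trans h hE; apply/negP; rewrite -ltNge.
have h2 := ler_wpM2l (ltW N_gt0) (hN0 N (ltnW lt)).
have e2 : 0 < N%:R * (eps ^+ 2 * N%:R) by rewrite !mulr_gt0// exprn_gt0.
rewrite exprMn; move: h2 e2; move: (\sum_(k < N) _) (N%:R : R) (eps ^+ 2) => t n e; lra.
Qed.

End Correlations.

(** * From twisted sums to averages of correlations *)

Section SpectralAverage.
Variables (R : realType) (d : nat) (zeta : 'I_d.+2 -> seq 'I_d.+2).
Notation letter := 'I_d.+2.
Notation X := (subst_space zeta).
Variable mu : probability (full_shift d) R.
Hypothesis muX : mu X = 1%E.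
Hypothesis mu_inv : invariant_measure mu (@left_shift d).
Let mX : measurable X := measurable_subst_space zeta.

Lemma measurable_word_fun (phi : seq letter -> R) i n D :
  measurable D -> measurable_fun D (fun x => phi (word_at x i n)).
Proof.
move=> mD _ Y mY; apply: measurableI => //.
by apply: open_measurable_shift; exact: (open_word n i (phi @^-1` Y)).
Qed.

Lemma measurable_coord_fun (phi : letter -> R) i D :
  measurable D -> measurable_fun D (fun x : full_shift d => phi (x i)).
Proof.
move=> mD _ Y mY; apply: measurableI => //.
by apply: open_measurable_shift; exact: (open_coord i (phi @^-1` Y)).
Qed.

Lemma subst_space_iter k x : X x -> X (iter k (@left_shift d) x).
Proof. by move=> Xx; elim: k => //= k IH; rewrite -(preimage_subst_space zeta) in IH. Qed.

Lemma iter_koopmanE (f : full_shift d -> R[i]) k x :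
  iter k (koopman (@left_shift d)) f x = f (iter k (@left_shift d) x).
Proof. by elim: k x => //= k IH x; rewrite /koopman /= IH -iterSr. Qed.

Variables (F : letter -> R[i]) (f g : full_shift d -> R[i]) (N : nat) (B : R).
Hypothesis fF : forall x, X x -> f x = F (x 0).
Hypothesis gL2 : in_L2 mu X g.
Hypothesis N_gt0 : (0 < N)%N.
Hypothesis B_gt0 : 0 < B.
Hypothesis FB : forall x om, X x ->
  normc (\sum_(n < 2 * N) F (x n%:Z) * cis (om * n%:R)) <= B.

Let G x : R := normc (g x) ^+ 2.
Let M := \sum_a normc (F a).

Lemma normc_letter_le a : normc (F a) <= M.
Proof. by rewrite /M (bigD1 a)//= lerDl sumr_ge0// => b _; exact: normc_ge0. Qed.

Lemma sqr_norm_integrable : mu.-integrable X (EFin \o G).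
Proof.
case: gL2 => mRe mIm fin; apply/integrableP; split.
  apply/measurable_EFinP; rewrite /G; under eq_fun do rewrite sqr_normcE.
  by apply: measurable_funD; exact: measurable_funX.
rewrite (eq_integral (fun x => (G x)%:E))// => x _ /=.
by rewrite ger0_norm// sqr_ge0.
Qed.

(** A bounded function times [g] is controlled through [|g| <= 1 + |g|^2]. *)
Lemma dominated_integrable (h : full_shift d -> R) (C : R) :
  measurable_fun X h -> (forall x, X x -> `|h x| <= C * (1 + G x)) ->
  mu.-integrable X (EFin \o h).
Proof.
move=> mh hC.
have iM : mu.-integrable X (EFin \o (fun x => C * (1 + G x))).
  have i1 : mu.-integrable X (EFin \o (fun=> 1 : R)).
    apply: (@integrable_of_bounded _ _ _ _ _ mX _ 1); first exact: measurable_cst.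
    by move=> x _; rewrite normr1.
  have h1 := integrableZl mX C (integrableD mX i1 sqr_norm_integrable).
  exact: h1.
apply: (le_integrable mX _ _ iM); first exact/measurable_EFinP.
by move=> x Xx /=; rewrite lee_fin (le_trans (hC x Xx))// ler_norm.
Qed.

Let w (k : nat) (x : full_shift d) : R[i] := F (x k%:Z) * conjc (g x).

Lemma integrable_part k :
  mu.-integrable X (EFin \o (fun x => complex.Re (w k x))) /\
  mu.-integrable X (EFin \o (fun x => complex.Im (w k x))).
Proof.
case: gL2 => mRe mIm _.
have mF := (measurable_coord_fun (fun a => complex.Re (F a)) k%:Z mX).
have mF' := (measurable_coord_fun (fun a => complex.Im (F a)) k%:Z mX).
have bw x : normc (w k x) <= M * (1 + G x).
  rewrite normcM normcJ_eq; apply: ler_pM; rewrite ?normc_ge0 ?normc_letter_le//.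
  by rewrite /G; move: (normc (g x)) => t; nra.
split; apply: (@dominated_integrable _ M).
- rewrite (_ : (fun x => _) = (fun x => complex.Re (F (x k%:Z)) * complex.Re (g x) +
    complex.Im (F (x k%:Z)) * complex.Im (g x))).
    by apply: measurable_funD; exact: measurable_funM.
  by apply/funext => x; rewrite /w; case: (F _) (g x) => [p q] [r s] /=; rewrite mulrN opprK.
- by move=> x _; exact: le_trans (ge_normc_Re _) (bw x).
- rewrite (_ : (fun x => _) = (fun x => complex.Im (F (x k%:Z)) * complex.Re (g x) -
    complex.Re (F (x k%:Z)) * complex.Im (g x))).
    by apply: measurable_funB; exact: measurable_funM.
  by apply/funext => x; rewrite /w; case: (F _) (g x) => [p q] [r s] /=; rewrite mulrN addrC.
- by move=> x _; exact: le_trans (ge_normc_Im _) (bw x).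
Qed.

Lemma correlationE k : inner mu X (iter k (koopman (@left_shift d)) f) g =
  Complex (\int[mu]_(x in X) complex.Re (F (x k%:Z) * conjc (g x)))
          (\int[mu]_(x in X) complex.Im (F (x k%:Z) * conjc (g x))).
Proof.
have e x : X x -> iter k (koopman (@left_shift d)) f x * conjc (g x) = F (x k%:Z) * conjc (g x).
  move=> Xx; rewrite iter_koopmanE fF; last exact: subst_space_iter.
  by rewrite iter_shiftE add0r.
by rewrite /inner /cintegral; congr Complex; apply: eq_Rintegral => x;
  rewrite inE => Xx; rewrite e.
Qed.

Let c k := inner mu X (iter k (koopman (@left_shift d)) f) g.

(** In coordinates, [|h \o T^m|^2] for the function [h] of the overview. *)
Let H (m : nat) (x : full_shift d) : R :=
  normc (\sum_(k < N) conjc (c k) * F (x (k + m)%N%:Z)) ^+ 2.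

Lemma H_integrable m : mu.-integrable X (EFin \o H m).
Proof.
apply: (@integrable_of_bounded _ _ _ _ _ mX _ ((\sum_(k < N) normc (c k) * M) ^+ 2)).
  pose phi (v : seq letter) := normc (\sum_(k < N) conjc (c k) * F (nth ord0 v k)) ^+ 2.
  rewrite (_ : H m = (fun x => phi (word_at x m N))); first exact: measurable_word_fun.
  apply/funext => x; congr (normc _ ^+ 2); apply: eq_bigr => k _.
  by rewrite nth_mkseq// addnC.
move=> x _; rewrite ger0_norm ?sqr_ge0// lerXn2r ?nnegrE ?normc_ge0//.
  by rewrite sumr_ge0// => k _; rewrite mulr_ge0 ?normc_ge0// sumr_ge0// => a _; exact: normc_ge0.
apply: le_trans (normc_sum _ _ _) _; apply: ler_sum => k _.
by rewrite normcM normcJ_eq ler_wpM2l ?normc_ge0// normc_letter_le.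
Qed.

Lemma H_mean m : \int[mu]_(x in X) H m x = \int[mu]_(x in X) H 0 x.
Proof.
elim: m => // m <-.
have mH : measurable_fun X (H m).
  by case/integrableP: (H_integrable m) => /measurable_EFinP.
rewrite -(Rintegral_invariant mX (@measurable_left_shift d) (preimage_subst_space zeta) mu_inv mH).
  apply: eq_Rintegral => x _; congr (normc _ ^+ 2); apply: eq_bigr => k _.
  by rewrite /left_shift addnS -addn1 PoszD.
by move=> x _; exact: sqr_ge0.
Qed.

Let A := \sum_(k < N) normc (c k) ^+ 2.

Lemma H_mean_le : N%:R * \int[mu]_(x in X) H 0 x <= B ^+ 2 * A.
Proof.
have [hI hE] := Rintegral_sum mX (index_enum 'I_N) (fun m : 'I_N => H_integrable m).
have -> : N%:R * \int[mu]_(x in X) H 0 x = \int[mu]_(x in X) (\sum_(m < N) H m x).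
  rewrite hE (eq_bigr _ (fun (m : 'I_N) _ => H_mean m)).
  by rewrite sumr_const card_ord mulr_natl.
have -> : B ^+ 2 * A = \int[mu]_(x in X) (B ^+ 2 * A).
  by rewrite Rintegral_cst// [fine _](congr1 fine muX) mulr1.
apply: le_Rintegral => //.
  by apply: (@integrable_of_bounded _ _ _ _ _ mX _ `|B ^+ 2 * A|); first exact: measurable_cst.
move=> x Xx.
have -> : A = \sum_(k < N) normc (conjc (c k)) ^+ 2.
  by apply: eq_bigr => k _; rewrite normcJ_eq.
exact: (@convolution_bound R N (fun n => F (x n%:Z)) (fun k => conjc (c k)) B N_gt0
  (ltW B_gt0) (fun om => FB om Xx)).
Qed.

Lemma norm2_sqr : norm2 mu X g ^+ 2 = \int[mu]_(x in X) G x.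
Proof. by rewrite sqr_sqrtr// Rintegral_ge0// => x _; exact: sqr_ge0. Qed.

(** [A] is the integral of the real part of [h * conjc g]. In place of the Cauchy-Schwarz
    inequality, [|h| |g| <= t / 2 * |h|^2 + |g|^2 / (2 * t)] is integrated. *)
Lemma spectral_average : A <= B ^+ 2 / N%:R * norm2 mu X g ^+ 2.
Proof.
pose u k x := complex.Re (c k) * complex.Re (w k x) + complex.Im (c k) * complex.Im (w k x).
have iu k : mu.-integrable X (EFin \o u k) /\
    \int[mu]_(x in X) u k x = normc (c k) ^+ 2.
  have [hr hi] := integrable_part k.
  have hr' := integrableZl mX (complex.Re (c k)) hr.
  have hi' := integrableZl mX (complex.Im (c k)) hi.
  split; first exact: (integrableD mX hr' hi').
  rewrite /u RintegralD// RintegralZl// RintegralZl//.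
  by rewrite sqr_normcE !expr2 {4 6}/c correlationE.
have [hI hE] := Rintegral_sum mX (index_enum 'I_N) (fun k : 'I_N => (iu k).1).
have AE : A = \int[mu]_(x in X) \sum_(k < N) u k x.
  by rewrite hE; apply: eq_bigr => k _; rewrite (iu k).2.
have N0 : (0 : R) < N%:R by rewrite ltr0n.
(* For this weight [H_mean_le] bounds the first term by [A / 2], which is absorbed in the left-hand
   side. *)
pose t : R := N%:R / B ^+ 2.
have t0 : 0 < t by rewrite divr_gt0// exprn_gt0.
have pw x : X x -> \sum_(k < N) u k x <= 2^-1 * t * H 0 x + 2^-1 * t^-1 * G x.
  move=> Xx; pose h := \sum_(k < N) conjc (c k) * F (x (k + 0)%N%:Z).
  have -> : \sum_(k < N) u k x = complex.Re (h * conjc (g x)).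
    rewrite /h mulr_suml (raddf_sum (@complex.Re R)); apply: eq_bigr => k _.
    rewrite -mulrA addn0 -/(w k x) /u.
    by case: (c k) (w k x) => [p q] [r s] /=; rewrite mulNr opprK.
  apply: le_trans (ler_norm _) (le_trans (ge_normc_Re _) _).
  rewrite normcM normcJ_eq /H -/h /G.
  move: (normc h) (normc (g x)) => p q.
  have : 0 <= t^-1 * (t * p - q) ^+ 2 by rewrite mulr_ge0 ?sqr_ge0// invr_ge0 ltW.
  have -> : t^-1 * (t * p - q) ^+ 2 = t * p ^+ 2 - 2 * (p * q) + t^-1 * q ^+ 2.
    by field; rewrite gt_eqF.
  by move: (t^-1) => s; lra.
have i1 := integrableZl mX (2^-1 * t) (H_integrable 0).
have i2 := integrableZl mX (2^-1 * t^-1) sqr_norm_integrable.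
have i3 := integrableD mX i1 i2.
have := le_Rintegral mX hI i3 pw; rewrite -AE.
rewrite RintegralD// RintegralZl//; last exact: H_integrable.
rewrite RintegralZl//; last exact: sqr_norm_integrable.
rewrite -norm2_sqr; have := H_mean_le.
move: (\int[mu]_(x in X) H 0 x) (norm2 mu X g ^+ 2) A => h n a h1 h2.
have B2 : 0 < B ^+ 2 by rewrite exprn_gt0.
have h3 : t * h <= a by rewrite /t mulrAC ler_pdivrMr// [leRHS]mulrC.
have -> : B ^+ 2 / N%:R = t^-1 by rewrite /t invf_div.
move: h2 h3; rewrite -!mulrA; move: (t^-1 * n) (t * h) => p q; lra.
Qed.

End SpectralAverage.

Lemma cylindrical0_letter (R : realType) (d : nat) (zeta : 'I_d.+2 -> seq 'I_d.+2)
    (f : full_shift d -> R[i]) :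
  subst_space zeta !=set0 -> cylindrical0 (subst_space zeta) f ->
  exists F : 'I_d.+2 -> R[i], (forall x, subst_space zeta x -> f x = F (x 0)) /\
    forall a, normc (F a) <= sup_norm (subst_space zeta) f.
Proof.
move=> [y Xy] fc; set X := subst_space zeta.
pose E a := [set x | X x /\ x 0 = a].
(* A letter that no point of [X] carries at position 0 gets the value 0, so that the bound by the
   sup norm holds for all letters. *)
pose F a := if `[< E a (xget y (E a)) >] then f (xget y (E a)) else 0.
have fF x : X x -> f x = F (x 0).
  move=> Xx; have h : E (x 0) (xget y (E (x 0))) by apply: (xgetPex y); exists x.
  by rewrite /F asboolT//; case: h => h1 h2; exact: fc.
have ub : has_ubound [set normc (f x) | x in X].
  exists (\sum_a normc (F a)) => _ [x Xx <-].
  by rewrite fF// (bigD1 (x 0))//= lerDl sumr_ge0// => b _; exact: normc_ge0.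
exists F; split=> // a; rewrite /F; case: asboolP => [[Xz _]|_].
  by apply: ub_le_sup => //; exists (xget y (E a)).
rewrite normc0; apply: le_trans (normc_ge0 (f y)) _.
by apply: ub_le_sup => //; exists y.
Qed.

Theorem theorem2p3 (R : realType) (d : nat)
    (zeta : 'I_d.+2 -> seq 'I_d.+2)
    (zeta_subst : substitution zeta)
    (zeta_prim : primitive_subst zeta)
    (zeta_aper : aperiodic_subst zeta)
    (irr : irreducible_poly (char_poly (subst_mx rat zeta)))
    (no_unit : forall z : R[i], eigenvalue (subst_mx R[i] zeta) z ->
       normc z != 1)
    (mu : probability (full_shift d) R)
    (mu_supp : mu (subst_space zeta) = 1%E)
    (mu_inv : invariant_measure mu (@left_shift d))
    (mu_wm : weakly_mixing mu (@left_shift d)) :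
  exists K gamma : R, [/\ 0 < K, 0 < gamma &
    forall (f g : full_shift d -> R[i]) (N : nat),
      cylindrical0 (subst_space zeta) f ->
      cintegral mu (subst_space zeta) f = 0 ->
      in_L2 mu (subst_space zeta) g ->
      (2 <= N)%N ->
      N%:R^-1 * \sum_(k < N)
        normc (inner mu (subst_space zeta)
                 (iter k (koopman (@left_shift d)) f) g) ^+ 2
      <= K * sup_norm (subst_space zeta) f ^+ 2
           * norm2 mu (subst_space zeta) g ^+ 2
           * ln N%:R `^ (- gamma)].
Proof.
have [K0 [gam [K00 gam0 bnd]]] := tw_log_bound zeta_subst zeta_prim irr no_unit.
(* The bound is used for words of length [2 * N] and then squared, whence the 4 and the doubled
   exponent. *)
exists (4 * K0 ^+ 2), (gam + gam); split; [by rewrite mulr_gt0// exprn_gt0|exact: addr_gt0|].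
move=> f g N fc f0 gL2 N2; set X := subst_space zeta in fc f0 gL2 *.
have X0 : X !=set0.
  apply/set0P/eqP => X0; have := mu_supp; rewrite -/X X0 measure0 => /esym/eqP.
  by rewrite onee_eq0.
have [F [fF Fs]] := cylindrical0_letter X0 fc.
set s := sup_norm X f in Fs *.
have s_ge0 : 0 <= s by apply: le_trans (normc_ge0 _) (Fs ord0).
have N_gt0 : (0 : R) < N%:R by rewrite ltr0n ltnW.
(* The letter function is divided by [s] below; for [s = 0] the function [f] vanishes on [X], and so
   do its correlations. *)
have [s0|s_neq0] := eqVneq s 0.
  rewrite s0 [0 ^+ 2]expr2 !mulr0 !mul0r big1 ?mulr0// => k _.
  have f00 x : X x -> f x = (fun=> 0) (x 0).
    move=> Xx; rewrite fF//; apply/eqP; rewrite -normc_eq0 eq_le normc_ge0 andbT -s0.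
    exact: Fs.
  rewrite (@correlationE _ _ _ mu (fun=> 0) _ g f00) -/X.
  have z (h : R[i] -> R) : h 0 = 0 -> \int[mu]_(x in X) h (0 * conjc (g x)) = 0.
    move=> h0; under eq_Rintegral do rewrite mul0r h0.
    by rewrite Rintegral_cst ?mul0r//; exact: measurable_subst_space.
  by rewrite !z// normc0 expr0n.
have s_gt0 : 0 < s by rewrite lt_def s_neq0.
pose F' a := F a * (s^-1%:C)%C.
have F'1 a : normc (F' a) <= 1.
  by rewrite normcM normcR ger0_norm ?invr_ge0// ler_pdivrMr// mul1r.
have F'0 : \sum_a F' a * ((freq mu a)%:C)%C = 0.
  have [_ hr] := letter_mean mu_supp (fun a => complex.Re (F a)) 0.
  have [_ hi] := letter_mean mu_supp (fun a => complex.Im (F a)) 0.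
  have er : \sum_a complex.Re (F a) * freq mu a = 0.
    rewrite -[LHS]hr; have := congr1 (@complex.Re R) f0; rewrite /= => <-.
    by apply: eq_Rintegral => x; rewrite inE => Xx; rewrite fF.
  have ei : \sum_a complex.Im (F a) * freq mu a = 0.
    rewrite -[LHS]hi; have := congr1 (@complex.Im R) f0; rewrite /= => <-.
    by apply: eq_Rintegral => x; rewrite inE => Xx; rewrite fF.
  have FE a : F a * ((freq mu a)%:C)%C =
    Complex (complex.Re (F a) * freq mu a) (complex.Im (F a) * freq mu a).
    by case: (F a) => p q; apply/eqP; rewrite eq_complex/= !mulr0 subr0 add0r !eqxx.
  have F0 : \sum_a F a * ((freq mu a)%:C)%C = 0.
    apply/eqP; rewrite eq_complex (raddf_sum (@complex.Re R)) (raddf_sum (@complex.Im R)).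
    rewrite (eq_bigr _ (fun a _ => congr1 (@complex.Re R) (FE a)))/= er eqxx/=.
    by rewrite (eq_bigr _ (fun a _ => congr1 (@complex.Im R) (FE a)))/= ei eqxx.
  rewrite /F'; under eq_bigr => a _ do rewrite mulrAC.
  by rewrite -mulr_suml F0 mul0r.
have tb := bnd F' F'1 (weak_mixing_small_means mu_supp mu_inv mu_wm F'1 F'0).
have ln2 : 0 < ln (2 * N)%:R :> R.
  by rewrite ln_gt0// ltr1n; lia.
pose B := s * (K0 * (2 * N)%:R * ln (2 * N)%:R `^ (- gam)).
have B_gt0 : 0 < B by rewrite !mulr_gt0// ?powR_gt0// ltr0n muln_gt0/= ltnW.
have FB x om : X x -> normc (\sum_(n < 2 * N) F (x n%:Z) * cis (om * n%:R)) <= B.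
  move=> Xx; have h := tb om _ (subst_space_word 0 (2 * N)%N Xx).
  rewrite size_word_at in h.
  have -> : \sum_(n < 2 * N) F (x n%:Z) * cis (om * n%:R) =
      (s%:C)%C * tw F' om (word_at x 0 (2 * N)).
    rewrite tw_word_at mulr_sumr; apply: eq_bigr => n _; rewrite /F' add0r.
    rewrite mulrA [X in _ = X * _]mulrCA -rmorphM/= divff// mulr1//.
  by rewrite normcM normcR ger0_norm// ler_pM2l//; apply: h; lia.
have h := spectral_average mu_supp mu_inv fF gL2 (ltnW N2) B_gt0 FB.
rewrite mulrC ler_pdivrMr//; apply: le_trans h _.
have -> : B ^+ 2 / N%:R = 4 * K0 ^+ 2 * s ^+ 2 * N%:R * (ln (2 * N)%:R `^ (- gam)) ^+ 2.
  by rewrite /B natrM; field; rewrite gt_eqF.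
have lnN : 0 < ln N%:R :> R by rewrite ln_gt0// ltr1n.
have lel : (ln (2 * N)%:R `^ (- gam)) ^+ 2 <= ln N%:R `^ (- (gam + gam)) :> R.
  rewrite opprD powRD; last by apply/implyP => _; rewrite gt_eqF.
  have pl : ln (2 * N)%:R `^ (- gam) <= ln N%:R `^ (- gam) :> R.
    rewrite !powRN lef_pV2 ?posrE ?powR_gt0//.
    apply: ge0_ler_powR; rewrite ?nnegrE ?(ltW gam0) ?(ltW lnN) ?(ltW ln2)//.
    by rewrite ler_ln ?posrE ?ltr0n ?muln_gt0 ?(ltnW N2)// ler_nat leq_pmull.
  by rewrite expr2 ler_pM// powR_ge0.
move: lel; move: (ln N%:R `^ (- (gam + gam))) ((ln (2 * N)%:R `^ (- gam)) ^+ 2) => q p pq.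
rewrite [leRHS](_ : _ = 4 * K0 ^+ 2 * s ^+ 2 * N%:R * q * norm2 mu X g ^+ 2); last by ring.
rewrite ler_wpM2r ?sqr_ge0// ler_wpM2l//.
rewrite mulr_ge0 ?(ltW N_gt0)// mulr_ge0 ?sqr_ge0// mulr_ge0 ?sqr_ge0//.
Qed.
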